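(* Let $\mathbb{M}$ be a loop-free matroid and let $k$ be a field. The matroid fan $\Delta_{\mathbb{M}}$ is tropically realizable over $k$ if and only if the matroid $\mathbb{M}$ is realizable over $k$.
   Context: Matroid fan. Let $E=\{e_0,\dots,e_n\}$ be the underlying set of $\mathbb{M}$, $d=\operatorname{rank}(\mathbb{M})-1$, $N=\mathbb{Z}^E/\langle e_0+\cdots+e_n\rangle$, $N_{\mathbb{R}}=N\otimes\mathbb{R}$, and $e_I=\sum_{e_i\in I}e_i\in N_{\mathbb{R}}$ for $I\subset E$. The matroid fan $\Delta_{\mathbb{M}}$ is the pure $d$-dimensional simplicial fan in $N_{\mathbb{R}}$ whose cones are the cones spanned by $\{e_{F_1},\dots,e_{F_k}\}$ for flags $F_1\subsetneq\cdots\subsetneq F_k$ of nonempty proper flats of $\mathbb{M}$. All its maximal cones are given weight $1$. Tropicalization (with respect to the trivial valuation). Let $T$ be the torus over $k$ with lattice of one-parameter subgroups $N$. For a $d$-dimensional subvariety $Y^\circ\subset T$, $\operatorname{Trop}(Y^\circ)$ is the set of $v\in N_{\mathbb{R}}$ such that the initial degeneration $\operatorname{in}_v(Y^\circ)\subset T$ is nonempty; it is the support of a rational fan of pure dimension $d$. A point of $\operatorname{Trop}(Y^\circ)$ is smooth if it has a neighborhood homeomorphic to $\mathbb{R}^d$. For $v$ in an open dense set of smooth points, a $d$-dimensional subtorus $T_v$ acts freely on $\operatorname{in}_v Y^\circ$, and the tropical multiplicity $m(v)$ is the length of the zero-dimensional quotient $\operatorname{in}_vY^\circ/T_v$ (measured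 over $k$, i.e. the $k$-dimension of its coordinate ring); $m$ extends to a locally constant function on the smooth points. $\Delta_{\mathbb{M}}$ is tropically realizable over $k$ if there is a subvariety $Y^\circ$ of $T$ over $k$ with $\operatorname{Trop}(Y^\circ)=|\Delta_{\mathbb{M}}|$ and $m(v)=1$ for $v$ in the relative interior of every maximal cone. $\mathbb{M}$ is realizable over $k$ if there are hyperplanes $H_0,\dots,H_n$ in $\mathbb{P}^d_k$ such that the codimension of any intersection $H_{i_0}\cap\cdots\cap H_{i_r}$ equals the rank of the flat spanned by $e_{i_0},\dots,e_{i_r}$; equivalently, $H_{j_0}\cap\cdots\cap H_{j_d}=\emptyset$ if and only if $\{e_{j_0},\dots,e_{j_d}\}$ is a basis for $\mathbb{M}$. *)

(* Defs.v *)
From HB Require Import structures.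
From mathcomp Require Import all_boot all_order all_algebra finmap.
From mathcomp Require Import all_classical all_reals topology normedtype.
(* The notations of monalg clash with those of topology. *)
From mathcomp Require Import -(notations) monalg.

Set Implicit Arguments.
Unset Strict Implicit.
Unset Printing Implicit Defensive.

Import Order.TTheory GRing.Theory Num.Theory.
Import numFieldNormedType.Exports.

Local Open Scope ring_scope.

(** * Matroids *)

Record matroid (E : finType) := Matroid {
  indep : {set {set E}};
  indep0 : finset.set0 \in indep;
  indepS : forall A B : {set E}, A \subset B -> B \in indep -> A \in indep;
  indep_aug : forall A B : {set E}, A \in indep -> B \in indep ->
    (#|A| < #|B|)%N -> exists2 x, x \in B :\: A & x |: A \in indep }.

Section MatroidNotions.
Variables (E : finType) (M : matroid E).
Implicit Types (A F : {set E}).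

Definition loop_free := forall x : E, [set x]%SET \in indep M.

Definition mrank A : nat := \max_(B in indep M | B \subset A) #|B|.

Definition flat F : bool :=
  [forall x, (x \notin F) ==> (mrank F < mrank (x |: F))%N].

Definition flat_span A : {set E} := \bigcap_(F : {set E} | flat F && (A \subset F)) F.

(* A flag of flats is given by the set of its members. *)
Definition flag (P : {set {set E}}) : bool :=
  [forall F in P, [&& flat F, F != finset.set0 & F != finset.setT]] &&
  [forall F in P, forall G in P, (F \subset G) || (G \subset F)].

Definition maximal_flag (P : {set {set E}}) : bool := maxset flag P.

(* The rank is positive when M is loop-free and E is nonempty, so that the
   truncated predecessor is then the honest rank - 1. *)
Definition mdim : nat := (mrank finset.setT).-1.

End MatroidNotions.

(* Linear subspaces of P^d are the projectivizations of the vector subspaces of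
   k^(d+1); the codimension is computed in k^(d+1), so that the empty subspace
   has codimension d+1. *)
Definition realizable (k : fieldType) n (M : matroid 'I_n.+1) :=
  exists2 H : 'I_n.+1 -> {vspace 'rV[k]_(mdim M).+1},
    forall i, \dim (H i) = mdim M
  & forall S : {set 'I_n.+1}, S != finset.set0 ->
      ((mdim M).+1 - \dim (\bigcap_(i in S) H i)%VS)%N = mrank M (flat_span M S).

(** * The matroid fan *)

(* N = Z^E / (e_0 + ... + e_n) is identified with Z^n through its basis
   e_1, ..., e_n, so that e_0 = (-1, ..., -1). *)
Definition evec (R : nzRingType) n (i : 'I_n.+1) : 'rV[R]_n :=
  if unlift ord0 i is Some j then delta_mx 0 j else const_mx (-1).

Definition evec_set (R : nzRingType) n (I : {set 'I_n.+1}) : 'rV[R]_n :=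
  \sum_(i in I) evec R i.

Lemma evec_sum (R : nzRingType) n (a : 'I_n.+1 -> R) :
  \sum_i a i *: evec R i = \row_j (a (lift ord0 j) - a ord0).
Proof.
apply/rowP => j; rewrite mxE summxE big_ord_recl /= addrC.
rewrite /evec unlift_none !mxE mulrN1; congr (_ - _).
rewrite (bigD1 j) //= liftK !mxE !eqxx mulr1 big1 ?addr0 // => l lj.
by rewrite liftK !mxE [j == l]eq_sym (negbTE lj) andbF mulr0.
Qed.

Lemma evec_surj (R : nzRingType) n (v : 'rV[R]_n) :
  exists a : 'I_n.+1 -> R, \sum_i a i *: evec R i = v.
Proof.
exists (fun i => if unlift ord0 i is Some j then v 0 j else 0).
by rewrite evec_sum; apply/rowP => j; rewrite mxE liftK unlift_none subr0.
Qed.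

Lemma evec_ker (R : nzRingType) n (a : 'I_n.+1 -> R) :
  \sum_i a i *: evec R i = 0 <-> exists c, a =1 fun=> c.
Proof.
rewrite evec_sum; split=> [/rowP a0 | [c ac]]; last first.
  by apply/rowP => j; rewrite !mxE !ac subrr.
exists (a ord0) => i; case: (unliftP ord0 i) => [j ->|-> //].
by apply/subr0_eq; have := a0 j; rewrite !mxE.
Qed.

Section MatroidFan.
Local Open Scope classical_set_scope.
Variables (R : realType) (n : nat) (M : matroid 'I_n.+1).

Definition flag_cone (P : {set {set 'I_n.+1}}) : set 'rV[R]_n :=
  [set v | exists2 c : {set 'I_n.+1} -> R,
     forall F, F \in P -> 0 <= c F & v = \sum_(F in P) c F *: evec_set R F].

Definition flag_cone_relint (P : {set {set 'I_n.+1}}) : set 'rV[R]_n :=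
  [set v | exists2 c : {set 'I_n.+1} -> R,
     forall F, F \in P -> 0 < c F & v = \sum_(F in P) c F *: evec_set R F].

Definition matroid_fan_support : set 'rV[R]_n :=
  [set v | exists2 P : {set {set 'I_n.+1}}, flag M P & flag_cone P v].

End MatroidFan.

(** * Group algebras and Laurent polynomials *)

(* monalg equips malg U k with a ring structure for monoids U in which 1 is the
   only unit, which excludes groups. *)
Definition group_algebra (k : fieldType) (U : zmodType) : Type := malg U k.

HB.instance Definition _ (k : fieldType) (U : zmodType) :=
  GRing.Lmodule.copy (group_algebra k U) (malg U k).

Section GroupAlgebra.
Local Open Scope fset_scope.
Variables (k : fieldType) (U : zmodType).
Implicit Types (f g h : group_algebra k U) (u w : U) (a b : k).

Definition monomial a u : group_algebra k U := mkmalgU u a.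

Definition coef f u : k := mcoeff u f.

Definition supp f : {fset U} := msupp f.

Definition galg_one : group_algebra k U := monomial 1 0.

Definition galg_mul f g : group_algebra k U :=
  \sum_(u <- supp f) \sum_(w <- supp g) monomial (coef f u * coef g w) (u + w).

Let monomial0 u : monomial 0 u = 0. Proof. exact: monalgU0. Qed.

Let mulw (d1 d2 : {fset U}) f g : supp f `<=` d1 -> supp g `<=` d2 ->
  galg_mul f g =
  \sum_(u <- d1) \sum_(w <- d2) monomial (coef f u * coef g w) (u + w).
Proof.
move=> le1 le2; rewrite /galg_mul (big_fset_incl _ le1) /=.
  apply/eq_bigr => u _; apply/big_fset_incl => // w _ /mcoeff_outdom g0.
  by rewrite /coef g0 mulr0 monomial0.
move=> u _ /mcoeff_outdom f0; rewrite big1 // => w _.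
by rewrite /coef f0 mul0r monomial0.
Qed.

Let mulC : commutative galg_mul.
Proof.
move=> f g; rewrite /galg_mul exchange_big; apply: eq_bigr => u _.
by apply: eq_bigr => w _; rewrite mulrC addrC.
Qed.

Let mulDl : left_distributive galg_mul +%R.
Proof.
move=> f g h; rewrite (mulw (msuppD_le f g) (fsubset_refl (supp h))).
rewrite (mulw (fsubsetUl (supp f) (supp g)) (fsubset_refl (supp h))).
rewrite (mulw (fsubsetUr (supp f) (supp g)) (fsubset_refl (supp h))).
rewrite -big_split /=; apply: eq_bigr => u _.
rewrite -big_split /=; apply: eq_bigr => w _.
by rewrite /coef mcoeffD mulrDl [monomial _ _]monalgUD.
Qed.

Let mul0 : left_zero 0 galg_mul.
Proof. by move=> f; rewrite /galg_mul /supp msupp0 big_seq_fset0. Qed.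

Let mulMM a b u w :
  galg_mul (monomial a u) (monomial b w) = monomial (a * b) (u + w).
Proof.
by rewrite (mulw msuppU_le msuppU_le) !big_seq_fset1 /coef !mcoeffUU.
Qed.

Let expand f : f = \sum_(u <- supp f) monomial (coef f u) u.
Proof. exact: monalgE. Qed.

Let mul_suml (s : seq U) (F : U -> group_algebra k U) g :
  galg_mul (\sum_(u <- s) F u) g = \sum_(u <- s) galg_mul (F u) g.
Proof.
exact: (big_morph (galg_mul^~ g) (fun _ _ => mulDl _ _ _) (mul0 _)).
Qed.

Let mul_sumr (s : seq U) (F : U -> group_algebra k U) g :
  galg_mul g (\sum_(u <- s) F u) = \sum_(u <- s) galg_mul g (F u).
Proof. by rewrite mulC mul_suml; apply: eq_bigr => u _; rewrite mulC. Qed.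

Let mulA : associative galg_mul.
Proof.
move=> f g h; rewrite [f]expand !(mul_suml _ _ g) !(mul_suml _ _ h) mul_suml.
apply: eq_bigr => u _; set m := monomial _ u.
rewrite [g]expand [in LHS](mul_suml _ _ h) [LHS](mul_sumr _ _ m).
rewrite [in RHS](mul_sumr _ _ m) [RHS](mul_suml _ _ h).
apply: eq_bigr => w _; set p := monomial _ w.
rewrite [h]expand [in LHS](mul_sumr _ _ p) [LHS](mul_sumr _ _ m) [RHS]mul_sumr.
by apply: eq_bigr => x _; rewrite !mulMM mulrA addrA.
Qed.

Let mul1 : left_id galg_one galg_mul.
Proof.
move=> f; rewrite (mulw msuppU_le (fsubset_refl _)) big_seq_fset1 [RHS]expand.
by apply: eq_bigr => u _; rewrite /coef mcoeffUU mul1r add0r.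
Qed.

Let one_neq0 : galg_one != 0.
Proof. by rewrite /galg_one /monomial monalgU_eq0 oner_eq0. Qed.

HB.instance Definition _ := GRing.Zmodule_isComNzRing.Build (group_algebra k U)
  mulA mulC mul1 mulDl one_neq0.

Lemma galg_mulE f g : f * g =
  \sum_(u <- supp f) \sum_(w <- supp g) monomial (coef f u * coef g w) (u + w).
Proof. by []. Qed.

Lemma galg_oneE : 1 = monomial 1 0 :> group_algebra k U.
Proof. by []. Qed.

End GroupAlgebra.

(* The coordinate ring of the torus T with lattice of one-parameter subgroups
   N = Z^n; the character lattice is the dual lattice Z^n. *)
Notation laurent k n := (group_algebra k 'rV[int]_n).

(** * Tropicalization *)

Section Tropicalization.
Local Open Scope classical_set_scope.
Variables (k : fieldType) (R : realType) (n : nat).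
Implicit Types (f : laurent k n) (v : 'rV[R]_n) (u : 'rV[int]_n).

Definition pairing u v : R := \sum_j (u 0 j)%:~R * v 0 j.

(* The minimum convention: in_v(Y) is the degeneration of t^(-v) Y as t -> 0. *)
Definition initial_form v f : laurent k n :=
  \sum_(u <- supp f | all (fun w => pairing u v <= pairing w v) (supp f))
    monomial (coef f u) u.

(* The ideal of in_v(Y), where Y is the closed subscheme of T defined by I. *)
Definition initial_ideal (I : {pred laurent k n}) v : set (laurent k n) :=
  [set f | exists2 s : seq (laurent k n * laurent k n),
     forall p, p \in s -> p.2 \in I
   & f = \sum_(p <- s) p.1 * initial_form v p.2].

Definition Trop (I : {pred laurent k n}) : set 'rV[R]_n :=
  [set v | ~ initial_ideal I v 1].

Definition homeomorphic_Rn (A : set 'rV[R]_n) (d : nat) :=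
  exists (f : 'rV[R]_n -> 'rV[R]_d) (g : 'rV[R]_d -> 'rV[R]_n),
    [/\ {within A, continuous f}, continuous g, forall y, A (g y),
        forall x, A x -> g (f x) = x & forall y, f (g y) = y].

Definition smooth_point (d : nat) (X : set 'rV[R]_n) v :=
  X v /\ exists2 V, nbhs v V & homeomorphic_Rn (X `&` V) d.

(* The rows of B span a subgroup of N; the corresponding morphism of tori
   G_m^d -> T is a closed immersion iff B has a right inverse. *)
Definition subtorus d (B : 'M[int]_(d, n)) :=
  exists C : 'M[int]_(n, d), B *m C = 1%:M.

(* The part of f of weight w under the action of the subtorus given by B, for
   which the monomial of exponent u has weight u *m B^T. *)
Definition weight_part d (B : 'M[int]_(d, n)) (w : 'rV[int]_d) f : laurent k n :=
  \sum_(u <- supp f | u *m B^T == w) monomial (coef f u) u.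

(* A closed subscheme of T is stable under a subtorus iff its ideal J is
   graded by the weights. The action is then automatically free, since T acts
   freely on itself by translation. *)
Definition subtorus_acts d (B : 'M[int]_(d, n)) (J : set (laurent k n)) :=
  forall f, J f -> forall w, J (weight_part B w f).

(* The coordinate ring of the quotient of the subscheme defined by J consists of
   the classes modulo J of the functions of weight 0; its dimension over k is m
   when it has a basis of cardinality m. *)
Definition quotient_length d (B : 'M[int]_(d, n)) (J : set (laurent k n)) (m : nat) :=
  exists2 b : 'I_m -> laurent k n, forall i, weight_part B 0 (b i) = b i
  & forall f, weight_part B 0 f = f ->
      exists! c : 'rV[k]_m, J (f - \sum_i c 0 i *: b i).

Definition generic_multiplicity (d : nat) (I : {pred laurent k n}) v (m : nat) :=
  exists B : 'M[int]_(d, n),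
    [/\ subtorus B, subtorus_acts B (initial_ideal I v)
      & quotient_length B (initial_ideal I v) m].

(* m(v) = m: near the smooth point v, the multiplicity computed by a free
   quotient is m on a dense, relatively open subset of Trop(Y); d is the
   dimension of Y. *)
Definition tropical_multiplicity (d : nat) (I : {pred laurent k n}) v (m : nat) :=
  smooth_point d (Trop I) v /\
  exists V O : set 'rV[R]_n,
    [/\ nbhs v V, open O,
        Trop I `&` V `<=` closure (Trop I `&` O)
      & forall w, (Trop I `&` O) w -> generic_multiplicity d I w m].

End Tropicalization.

(* A subvariety of T is an integral closed subscheme, i.e., a prime ideal of the
   coordinate ring. *)
Definition tropically_realizable (R : realType) (k : fieldType) n
    (M : matroid 'I_n.+1) :=
  exists2 Y : prime_idealr (laurent k n),
    @Trop k R n Y = @matroid_fan_support R n M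
  & forall (P : {set {set 'I_n.+1}}) (v : 'rV[R]_n),
      maximal_flag M P -> flag_cone_relint P v ->
      tropical_multiplicity (mdim M) Y v 1.

(* Main.v *)
Require Import Defs.
From HB Require Import structures.
From mathcomp Require Import all_boot all_order all_algebra finmap.
From mathcomp Require Import all_classical all_reals topology normedtype.
From mathcomp Require Import fingroup perm ring_quotient fraction.
From mathcomp Require Import -(notations) monalg.
From mathcomp Require Import sequences exp.
From mathcomp Require Import zify ring.

Set Implicit Arguments.
Unset Strict Implicit.
Unset Printing Implicit Defensive.

Import Order.TTheory GRing.Theory Num.Theory.
Import numFieldNormedType.Exports.

Local Open Scope ring_scope.

(** Write y_i, for i in E, for the homogeneous coordinates of the torus: [eps i] is
    the exponent of the character y_i / y_0, and [hat w] lifts a point w of N_R to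
    the weights of the y_i, with weight 0 for y_0. A point w is in the support of
    the matroid fan exactly when the sets of indices of weight at least t are all
    flats ([fan_levels], [levels_fan]). A maximal flag of flats amounts to an
    ordered partition of E into d + 1 blocks, and to a basis [b] of the matroid
    with one element in each block ([maximal_flag_adapted]); in the interior of
    its cone the weights are constant on the blocks and decrease strictly from
    one block to the next ([relint_stepsP]).

    From a realization to a tropical realization. The normal vectors r_i of the
    hyperplanes represent the matroid ([realizable_represents]), and Y is the ideal
    of the linear space that they parametrize: y_i is the linear form r_i at a
    generic point. If w is not in the fan, then some set of indices of weight at
    least t is not a flat, and some y_x is a linear combination of coordinates of
    greater weight, so that an initial form in Y is a unit. If w is in the interior
    of the cone of a maximal flag, then the r_i are triangular in the adapted basis
    and y_i degenerates to its term in the block of i. The initial degeneration is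
    thus a translate of a d-dimensional subtorus ([initial_idealP]), so w is
    tropical, with multiplicity 1. The rest of the fan follows since the
    tropicalization is closed ([Trop_perturbation]).

    From a tropical realization to a realization. Let F be the function field of Y.
    In the interior of a maximal cone there is a point w0, at which the multiplicity
    is computed by a free quotient, whose weights on the basis are as independent
    over Q as possible ([independent_dense]).

    - The coordinates of the basis, other than y_0, are algebraically independent,
      because monomials in them have distinct weights at w0 ([S_algind]). They form
      a transcendence basis: a larger independent family would give a valuation of
      F whose center has too many distinct weights for a point of the fan
      ([coords_algebraic]).
    - The fan contains no other point with the same weights as w0 on the basis.
      Hence every valuation ring above the local ring O of the monomial valuation
      of weight w0 makes the characters of weight 0 units, and these characters are
      integral over O ([weight0_integral]). Multiplicity 1 says that they are
      constant modulo functions of positive weight, and Nakayama's lemma puts them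
      into O ([weight0_local]). So F is generated by the coordinates of the basis.
    - A discrete valuation of the rational function field F also has its center in
      the fan, and on a point of the fan the least weight is attained on the basis
      ([levels_min]). So y_i has no pole, and degree at most 1, in any coordinate
      of the basis and in all of them together ([chi_affine]).
    - Comparing leading terms at w0, y_i is a linear combination over k of the
      coordinates of the basis ([chi_linear]).
    - The generator e_G of the ray of a flat G is tropical, so that G cannot contain
      all but one of the coordinates in a linear relation ([relation_flat]). This
      forces the vectors of coefficients of the y_i to represent the matroid
      ([relations_represent]). *)

(** * Fields of fractions of prime quotients *)

Section PrimeField.
Local Open Scope quotient_scope.
Variables (A : comNzRingType) (I : prime_idealr A).

Let Q := {ideal_quot I}.
Let unitQ : {pred Q} := fun x => `[< exists y, y * x = 1 >].
Let invQ (x : Q) : Q :=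
  if pselect (exists y, y * x = 1) is left e then projT1 (cid e) else x.

Let mulVQ : {in unitQ, left_inverse 1 invQ *%R}.
Proof.
move=> x /asboolP e; rewrite /invQ; case: pselect => // e'.
exact: (projT2 (cid e')).
Qed.

Let unitPQ : forall x y : Q, y * x = 1 -> x \in unitQ.
Proof. by move=> x y yx; apply/asboolP; exists y. Qed.

Let invQ_out : {in [predC unitQ], invQ =1 id}.
Proof.
move=> x /negP nx; rewrite /invQ; case: pselect => // e.
by case: nx; apply/asboolP.
Qed.

Let Qu : Type := Q.
HB.instance Definition _ := GRing.ComNzRing.on Qu.
HB.instance Definition _ :=
  GRing.ComNzRing_hasMulInverse.Build Qu mulVQ unitPQ invQ_out.
HB.instance Definition _ :=
  GRing.ComUnitRing_isIntegral.Build Qu (@Quotient.rquot_IdomainAxiom A I).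

(** The fraction field of the quotient is a field in which the prime ideal becomes the
    ideal of a point; [invQ] only provides the units that fractions require. *)
Lemma prime_field : exists (F : fieldType) (phi : {rmorphism A -> F}),
  forall a, (a \in I) <-> phi a = 0.
Proof.
exists {fraction Qu}, (@tofrac Qu \o (\pi_Q : A -> Qu)) => a.
rewrite /=; split=> [aI|/eqP].
  apply/eqP; rewrite tofrac_eq0 -(rmorph0 (\pi_Q : {rmorphism A -> Q})).
  by rewrite -Quotient.idealrBE subr0.
rewrite tofrac_eq0 -(rmorph0 (\pi_Q : {rmorphism A -> Q})).
by rewrite -Quotient.idealrBE subr0.
Qed.

End PrimeField.

(** * Supports and weights in group algebras *)

HB.lock Definition restrict (k : fieldType) (U : zmodType) (P : set U)
    (f : group_algebra k U) : group_algebra k U :=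
  \sum_(u <- supp f | `[< P u >]) monomial (coef f u) u.
Canonical restrict_unlockable := Unlockable restrict.unlock.

Section Support.
Variables (k : fieldType) (U : zmodType).
Implicit Types (f g : group_algebra k U) (u v w : U) (a b c : k).
Implicit Types (P Q : set U).

Lemma gcoef0 u : coef (0 : group_algebra k U) u = 0.
Proof. exact: mcoeff0. Qed.
Lemma gcoefD f g u : coef (f + g) u = coef f u + coef g u.
Proof. exact: mcoeffD. Qed.
Lemma gcoefN f u : coef (- f) u = - coef f u.
Proof. exact: mcoeffN. Qed.
Lemma gcoefB f g u : coef (f - g) u = coef f u - coef g u.
Proof. by rewrite gcoefD gcoefN. Qed.
Lemma coef_monomial a u w : coef (monomial a u) w = if u == w then a else 0.
Proof. by rewrite /coef /monomial mcoeffU; case: eqP. Qed.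
Lemma gcoef_sum (J : Type) (s : seq J) (p : pred J) (F : J -> group_algebra k U) u :
  coef (\sum_(j <- s | p j) F j) u = \sum_(j <- s | p j) coef (F j) u.
Proof.
by rewrite (big_morph (fun f => coef f u) (fun f g => gcoefD f g u) (gcoef0 u)).
Qed.
Lemma galgP f g : (forall u, coef f u = coef g u) -> f = g.
Proof. by move=> fg; apply/malgP. Qed.
Lemma mem_supp f u : (u \in supp f) = (coef f u != 0).
Proof. by rewrite /coef mcoeff_neq0. Qed.
Lemma galgE f : f = \sum_(u <- supp f) monomial (coef f u) u.
Proof. exact: monalgE. Qed.

Lemma monomial0 u : monomial 0 u = 0 :> group_algebra k U.
Proof. by apply: galgP => w; rewrite coef_monomial gcoef0; case: eqP. Qed.
Lemma monomialD a b u : monomial (a + b) u = monomial a u + monomial b u.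
Proof.
apply: galgP => w; rewrite gcoefD !coef_monomial.
by case: eqP => // _; rewrite addr0.
Qed.
Lemma monomialN a u : monomial (- a) u = - monomial a u.
Proof.
apply: galgP => w; rewrite gcoefN !coef_monomial.
by case: eqP => // _; rewrite oppr0.
Qed.

Lemma monomialM a b u w :
  monomial a u * monomial b w = monomial (a * b) (u + w).
Proof.
have suppm c v : c != 0 -> supp (monomial c v) = [fset v]%fset.
  move=> c0; apply/fsetP => x; rewrite mem_supp coef_monomial in_fset1 [x == v]eq_sym.
  by case: (v == x); rewrite ?c0 ?eqxx.
have [->|a0] := eqVneq a 0; first by rewrite monomial0 !mul0r monomial0.
have [->|b0] := eqVneq b 0; first by rewrite monomial0 !mulr0 monomial0.
by rewrite galg_mulE !suppm // !big_seq_fset1 !coef_monomial !eqxx.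
Qed.

Lemma monomialV a u : a != 0 -> monomial a^-1 (- u) * monomial a u = 1.
Proof. by move=> a0; rewrite monomialM mulVf // addNr. Qed.

Lemma gcoefM_neq0 f g u : coef (f * g) u != 0 ->
  exists v w, [/\ coef f v != 0, coef g w != 0 & u = v + w].
Proof.
apply: contra_neqP => nex; rewrite galg_mulE gcoef_sum big_seq big1 // => v.
rewrite mem_supp => fv; rewrite gcoef_sum big_seq big1 // => w.
rewrite mem_supp => gw; rewrite coef_monomial; case: eqP => // e.
by case: nex; exists v, w.
Qed.

Lemma coef_monomialM a v f u :
  coef (monomial a v * f) u = a * coef f (u - v).
Proof.
rewrite [in LHS](galgE f) big_distrr gcoef_sum /=.
under eq_bigr do rewrite monomialM coef_monomial.
have [uf|/negbTE uf] := boolP (u - v \in supp f).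
  rewrite (big_fsetD1 (u - v)) //= [v + (u - v)]addrC subrK eqxx.
  rewrite big_seq big1 ?addr0 // => w; rewrite in_fsetD1 => /andP[nw _].
  by case: eqP => // e; move: nw; rewrite -e [v + w]addrC addrK eqxx.
rewrite big_seq big1.
  by move/negbT: uf; rewrite mem_supp negbK => /eqP ->; rewrite mulr0.
by move=> w wf; case: eqP => // e; move: uf; rewrite -e [v + w]addrC addrK wf.
Qed.

(** The exponents are kept in an arbitrary set, which is tracked through sums and
    products instead of the exact support. *)
Definition suppin P f := forall u, coef f u != 0 -> P u.

Lemma suppinS P Q f : (P `<=` Q)%classic -> suppin P f -> suppin Q f.
Proof. by move=> PQ Pf u /Pf/PQ. Qed.
Lemma suppin0 P : suppin P 0.
Proof. by move=> u; rewrite gcoef0 eqxx. Qed.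
Lemma suppinD P f g : suppin P f -> suppin P g -> suppin P (f + g).
Proof.
move=> Pf Pg u; rewrite gcoefD; have [->|/Pf//] := eqVneq (coef f u) 0.
by rewrite add0r; exact: Pg.
Qed.
Lemma suppinN P f : suppin P f -> suppin P (- f).
Proof. by move=> Pf u; rewrite gcoefN oppr_eq0; exact: Pf. Qed.
Lemma suppinB P f g : suppin P f -> suppin P g -> suppin P (f - g).
Proof. by move=> Pf Pg; apply: suppinD => //; apply: suppinN. Qed.
Lemma suppinM P Q T f g : (forall v w, P v -> Q w -> T (v + w)) ->
  suppin P f -> suppin Q g -> suppin T (f * g).
Proof.
move=> PQT Pf Qg u /gcoefM_neq0[v [w [fv gw ->]]].
by apply: PQT; [apply: Pf|apply: Qg].
Qed.
Lemma suppin_monomial P a u : P u -> suppin P (monomial a u).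
Proof.
by move=> Pu w; rewrite coef_monomial; case: (eqVneq u w) => [<-//|_]; rewrite eqxx.
Qed.
Lemma suppin1 P : P 0 -> suppin P 1.
Proof. exact: suppin_monomial. Qed.
Lemma suppin_sum P (J : eqType) (s : seq J) (p : pred J)
    (F : J -> group_algebra k U) :
  (forall j, j \in s -> p j -> suppin P (F j)) ->
  suppin P (\sum_(j <- s | p j) F j).
Proof.
move=> PF; rewrite big_seq_cond; apply: (big_ind (suppin P)).
- exact: suppin0.
- exact: suppinD.
- by move=> j /andP[]; exact: PF.
Qed.

Lemma coef_restrict P f u : coef (restrict P f) u = if `[< P u >] then coef f u else 0.
Proof.
rewrite unlock gcoef_sum.
under eq_bigr do rewrite coef_monomial.
have [uf|uf] := boolP (u \in supp f); last first.
  have ->: coef f u = 0 by apply/eqP; move: uf; rewrite mem_supp negbK.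
  rewrite if_same big_seq_cond big1 // => w /andP[wf _].
  by case: eqP => // e; move: uf; rewrite -e wf.
rewrite big_mkcond /= (big_fsetD1 u) //= eqxx big_seq big1 ?addr0 // => w.
by rewrite in_fsetD1 => /andP[/negbTE -> _]; rewrite if_same.
Qed.

Lemma restrictD P f g : restrict P (f + g) = restrict P f + restrict P g.
Proof.
apply: galgP => u; rewrite gcoefD !coef_restrict gcoefD.
by case: ifP; rewrite ?addr0.
Qed.
Lemma restrict0 P : restrict P 0 = 0 :> group_algebra k U.
Proof. by apply: galgP => u; rewrite coef_restrict gcoef0 if_same. Qed.
Lemma restrict_in P f : suppin P (restrict P f).
Proof. by move=> u; rewrite coef_restrict; case: asboolP; rewrite ?eqxx. Qed.
Lemma restrict_id P f : suppin P f -> restrict P f = f.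
Proof.
move=> Pf; apply: galgP => u; rewrite coef_restrict; case: asboolP => // nPu.
by apply/esym/eqP; apply: contra_notT nPu; exact: Pf.
Qed.
Lemma restrict_out P f : suppin (~` P)%classic f -> restrict P f = 0.
Proof.
move=> Pf; apply: galgP => u; rewrite coef_restrict gcoef0; case: asboolP => // Pu.
by apply/eqP; apply: contraPT Pu; exact: Pf.
Qed.

(** Terms of least weight exist, since the support is finite. *)
Lemma supp_min (R : realType) (lam : U -> R) f : f != 0 ->
  exists2 u, coef f u != 0 & suppin [set w | lam u <= lam w] f.
Proof.
move=> f0; have [u0 u0f] : exists u, coef f u != 0.
  apply: contra_neqP f0 => nex; apply: galgP => u; rewrite gcoef0.
  by apply/eqP; apply: contra_notT nex => fu; exists u.
have minseq (s : seq U) : exists2 u, u \in u0 :: s &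
    forall w, w \in u0 :: s -> lam u <= lam w.
  elim: s => [|v s [u us um]].
    by exists u0; rewrite ?mem_head // => w; rewrite inE => /eqP ->.
  have [le|/ltW le] := leP (lam u) (lam v).
    exists u; first by move: us; rewrite !inE orbCA => ->; rewrite orbT.
    move=> w; rewrite !inE orbCA => /orP[/eqP ->//|ws].
    by apply: um; rewrite inE.
  exists v; first by rewrite !inE eqxx orbT.
  move=> w; rewrite !inE orbCA => /orP[/eqP ->//|ws].
  by apply: le_trans le _; apply: um; rewrite inE.
have [u us um] := minseq (supp f); exists u.
  by move: us; rewrite inE => /orP[/eqP ->//|]; rewrite mem_supp.
by move=> w fw; apply: um; rewrite inE mem_supp fw orbT.
Qed.

End Support.


(** * Initial ideals and tropical points *)

Section Tropical.
Variables (k : fieldType) (R : realType) (n : nat).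
Implicit Types (u : 'rV[int]_n) (w : 'rV[R]_n) (f g p q : laurent k n).

Lemma pairingD u1 u2 w : pairing (u1 + u2) w = pairing u1 w + pairing u2 w.
Proof.
by rewrite /pairing -big_split /=; apply: eq_bigr => j _; rewrite mxE rmorphD mulrDl.
Qed.
Lemma pairing0 w : pairing 0 w = 0.
Proof. by rewrite /pairing big1 // => j _; rewrite mxE mul0r. Qed.
Lemma pairingN u w : pairing (- u) w = - pairing u w.
Proof. by apply/eqP; rewrite -addr_eq0 -pairingD addNr pairing0. Qed.
Lemma pairingB u1 u2 w : pairing (u1 - u2) w = pairing u1 w - pairing u2 w.
Proof. by rewrite pairingD pairingN. Qed.
Lemma pairing_sum (J : Type) (s : seq J) (p : pred J) (F : J -> 'rV[int]_n) w :
  pairing (\sum_(j <- s | p j) F j) w = \sum_(j <- s | p j) pairing (F j) w.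
Proof.
exact: (big_morph (fun u => pairing u w) (fun u v => pairingD u v w) (pairing0 w)).
Qed.
Lemma pairingMz u w (z : int) : pairing (u *~ z) w = z%:~R * pairing u w.
Proof.
have nat_case m : pairing (u *+ m) w = m%:R * pairing u w.
  elim: m => [|m IH]; first by rewrite mulr0n pairing0 mul0r.
  by rewrite mulrS pairingD IH -natr1 mulrDl mul1r addrC.
case: z => m; first by rewrite -pmulrn nat_case.
by rewrite NegzE mulrNz -pmulrn pairingN nat_case mulrNz mulNr -pmulrn.
Qed.
Lemma pairingMn u w (j : nat) : pairing (u *+ j) w = j%:R * pairing u w.
Proof. by rewrite pmulrn pairingMz. Qed.
Lemma pairingZ u w (z : int) : pairing (z *: u) w = z%:~R * pairing u w.
Proof.
by rewrite /pairing big_distrr /=; apply: eq_bigr => j _; rewrite mxE rmorphM mulrA.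
Qed.

(** The exponent of the character y_i / y_0, where the y_i are the homogeneous
    coordinates. *)
Definition eps (i : 'I_n.+1) : 'rV[int]_n :=
  if unlift ord0 i is Some j then delta_mx 0 j else 0.

(** The lift of a point of N_R to R^E whose coordinate at e_0 vanishes. *)
Definition hat w (i : 'I_n.+1) : R := if unlift ord0 i is Some j then w 0 j else 0.

Lemma eps0 : eps ord0 = 0. Proof. by rewrite /eps unlift_none. Qed.
Lemma eps_lift j : eps (lift ord0 j) = delta_mx 0 j.
Proof. by rewrite /eps liftK. Qed.
Lemma hat0 w : hat w ord0 = 0. Proof. by rewrite /hat unlift_none. Qed.
Lemma hat_lift w j : hat w (lift ord0 j) = w 0 j.
Proof. by rewrite /hat liftK. Qed.

Lemma pairing_delta j w : pairing (delta_mx 0 j) w = w 0 j.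
Proof.
rewrite /pairing (bigD1 j) //= mxE !eqxx mul1r big1 ?addr0 // => i ij.
by rewrite mxE eqxx (negbTE ij) mul0r.
Qed.

Lemma pairing_eps i w : pairing (eps i) w = hat w i.
Proof.
case: (unliftP ord0 i) => [j ->|->]; last by rewrite eps0 pairing0 hat0.
by rewrite eps_lift hat_lift pairing_delta.
Qed.

Lemma sum_eps u : u = \sum_j u 0 j *: eps (lift ord0 j).
Proof. by rewrite {1}(row_sum_delta u); apply: eq_bigr => j _; rewrite eps_lift. Qed.

Lemma hat_inj w w' : hat w =1 hat w' -> w = w'.
Proof. by move=> ww; apply/rowP => j; rewrite -!hat_lift. Qed.

Section Ideal.
Variable I : prime_idealr (laurent k n).
Implicit Types (a : R).
Local Open Scope classical_set_scope.

Lemma initial_form0 w : initial_form w (0 : laurent k n) = 0.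
Proof.
rewrite /initial_form /supp big1_seq // => v /andP[_].
by rewrite -[msupp _]/(supp 0) mem_supp gcoef0 eqxx.
Qed.

(** The initial form of a nonzero element is its part of least weight. *)
Lemma initial_formE w q : q != 0 -> exists u0,
  [/\ coef q u0 != 0, suppin [set u | pairing u0 w <= pairing u w] q &
  initial_form w q = restrict [set u | pairing u w = pairing u0 w] q].
Proof.
move=> q0; have [u0 u0q qmin] := @supp_min _ _ R (fun u => pairing u w) _ q0.
exists u0; split=> //; apply: galgP => u.
rewrite coef_restrict /initial_form gcoef_sum.
rewrite -big_filter; set s := [seq _ <- _ | _].
have su : u \in s -> coef q u != 0 by rewrite mem_filter mem_supp => /andP[].
have us : (u \in s) = `[< pairing u w = pairing u0 w >] && (coef q u != 0).
  rewrite mem_filter mem_supp; case: (boolP (coef q u != 0)) => [qu|]; last by rewrite !andbF.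
  rewrite !andbT; apply/allP/asboolP => [le|-> v]; last by rewrite mem_supp => /qmin.
  by apply/eqP; rewrite eq_le (qmin _ qu) andbT; apply: le; rewrite mem_supp.
under eq_bigr do rewrite coef_monomial.
have [/[dup] us1|us1] := boolP (u \in s).
  rewrite us => /andP[/asboolP e _]; case: asboolP => // _.
  rewrite (bigD1_seq u) //=; last by apply: filter_uniq; apply: fset_uniq.
  by rewrite eqxx big1 ?addr0 // => v /negbTE ->.
rewrite big_seq big1 => [|v vs]; last by case: eqP => // e; rewrite -e vs in us1.
case: ifP => // e; move: us1; rewrite us e /= negbK => /eqP //.
Qed.

Lemma initial_idealD w f g :
  initial_ideal I w f -> initial_ideal I w g -> initial_ideal I w (f + g).
Proof.
move=> [s sI ->] [t tI ->]; exists (s ++ t); last by rewrite big_cat.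
by move=> x; rewrite mem_cat => /orP[/sI|/tI].
Qed.

Lemma initial_idealM w f g : initial_ideal I w g -> initial_ideal I w (f * g).
Proof.
move=> [s sI ->]; exists [seq (f * x.1, x.2) | x <- s].
  by move=> _ /mapP[x /sI ? ->].
by rewrite big_map big_distrr /=; apply: eq_bigr => x _; rewrite mulrA.
Qed.

Lemma initial_ideal0 w : initial_ideal I w 0.
Proof. by exists [::]; rewrite ?big_nil. Qed.

Lemma initial_idealN w f : initial_ideal I w f -> initial_ideal I w (- f).
Proof. by rewrite -mulN1r; exact: initial_idealM. Qed.

(** Multiplying initial forms by monomials shows that the homogeneous components of
    elements of the initial ideal are leading parts of elements of the ideal. *)
Lemma initial_ideal_lift w g a : initial_ideal I w g ->
  exists2 f, f \in I & suppin [set u | a < pairing u w]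
    (f - restrict [set u | pairing u w = a] g).
Proof.
pose good g := exists2 f, f \in I & suppin [set u | a < pairing u w]
  (f - restrict [set u | pairing u w = a] g).
have good0 : good 0.
  by exists 0; [exact: idealr0 | rewrite restrict0 subr0; exact: suppin0].
have goodD g1 g2 : good g1 -> good g2 -> good (g1 + g2).
  move=> [f1 f1I f1P] [f2 f2I f2P]; exists (f1 + f2); first exact: rpredD.
  by rewrite restrictD opprD addrACA; exact (suppinD f1P f2P).
move=> [s sI ->]; rewrite -/(good _) big_seq; apply: (big_ind good) => //.
move=> [p q] /sI /= qI; have [->|q0] := eqVneq q 0.
  by rewrite initial_form0 mulr0.
have [u0 [_]] := initial_formE w q0; set b := pairing u0 w => bq ->.
rewrite [p]galgE mulr_suml; apply: (big_ind good) => // v _.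
have monoP P : P v -> suppin P (monomial (coef p v) v) by exact: suppin_monomial.
have mulP : suppin [set u | pairing u w = pairing v w + b]
    (monomial (coef p v) v * restrict [set u | pairing u w = b] q).
  apply: (suppinM (P := [set v]) _ (monoP _ _) (@restrict_in _ _ _ _)) => //.
  by move=> v1 u /= -> ub; rewrite pairingD ub.
have [e|ne] := eqVneq a (pairing v w + b).
  exists (monomial (coef p v) v * q); first exact: idealMr.
  rewrite restrict_id; last by rewrite e; exact: mulP.
  rewrite -mulrBr; apply: (suppinM (P := [set v])
      (Q := [set u | b < pairing u w]) _ (monoP _ _)) => //.
    by move=> v1 u /= -> ub; rewrite pairingD e ltrD2l.
  move=> u; rewrite gcoefB coef_restrict /=; case: asboolP => [|ub].
    by rewrite subrr eqxx.
  by rewrite subr0 => /bq /=; rewrite le_eqVlt => /orP[/eqP/esym|].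
exists 0; first exact: idealr0.
rewrite restrict_out ?subr0; first exact: suppin0.
by apply: suppinS mulP => u /= ->; apply/eqP; rewrite eq_sym.
Qed.

(** The converse of [initial_ideal_lift]: the part of weight [a] is the initial form
    or zero. *)
Lemma mem_initial_ideal w f a : f \in I -> suppin [set u | a <= pairing u w] f ->
  initial_ideal I w (restrict [set u | pairing u w = a] f).
Proof.
move=> fI fa; have [->|f0] := eqVneq f 0.
  by rewrite restrict0; exact: initial_ideal0.
have [u0 [fu0 fmin fE]] := initial_formE w f0.
have [<-|ab] := eqVneq (pairing u0 w) a.
  exists [:: (1, f)]; last by rewrite big_seq1 mul1r.
  by move=> x; rewrite inE => /eqP ->.
rewrite restrict_out; first exact: initial_ideal0.
move=> u fu /= ua; have := fmin u fu; rewrite /= ua => ba.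
by move: ab; rewrite eq_le ba fa.
Qed.

(** When the initial ideal contains 1, its lift to the ideal is a unit modulo terms
    of positive weight. *)
Lemma notin_Trop w : ~ Trop I w <->
  exists2 f, f \in I & suppin [set u | 0 < pairing u w] (f - 1).
Proof.
split=> [/contrapT I1|[f fI fP] T].
  have [f fI fP] := initial_ideal_lift 0 I1; exists f => //.
  by rewrite restrict_id // in fP; apply: suppin1; rewrite /= pairing0.
apply: T; have f0 : suppin [set u | 0 <= pairing u w] f.
  rewrite -[f](subrK 1); apply: suppinD; last by apply: suppin1; rewrite /= pairing0.
  by apply: suppinS fP => u /=; exact: ltW.
have := mem_initial_ideal fI f0; rewrite (_ : restrict _ _ = 1) //.
rewrite -[in LHS](subrK 1 f) restrictD restrict_out ?add0r.
  by rewrite restrict_id //; apply: suppin1; rewrite /= pairing0.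
by apply: suppinS fP => u /= + u0; rewrite u0 ltxx.
Qed.

(** Monomials are units: at a tropical point none of them is the leading part of an
    element of the ideal. *)
Lemma Trop_lead w f c u : Trop I w -> f \in I ->
  suppin [set v | pairing u w < pairing v w] (f - monomial c u) -> c = 0.
Proof.
move=> T fI fP; apply: contraPP T => /eqP c0; apply/notin_Trop.
exists (monomial c^-1 (- u) * f); first exact: idealMr.
have -> : monomial c^-1 (- u) * f - 1 =
    monomial c^-1 (- u) * (f - monomial c u) :> laurent k n.
  by rewrite mulrBr (monomialV u c0).
apply: (suppinM (P := [set - u]) _ _ fP); last exact: suppin_monomial.
by move=> v1 v /= -> uv; rewrite pairingD pairingN addrC subr_gt0.
Qed.

(** A subset [m] of an extension field that behaves like the maximal ideal of a
    valuation ring of center [w] shows that [w] is tropical. *)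
Lemma Trop_place (F : fieldType) (phi : {rmorphism laurent k n -> F}) (m : set F) w :
  (forall f, f \in I -> phi f = 0) -> m 0 -> ~ m 1 ->
  (forall x y, m x -> m y -> m (x + y)) ->
  (forall c u, 0 < pairing u w -> m (phi (monomial c u))) -> Trop I w.
Proof.
move=> phiI m0 m1 mD mX; apply: contrapT => /notin_Trop[f fI fP]; apply: m1.
suff: m (phi (1 - f)) by rewrite rmorphB rmorph1 phiI // subr0.
have {}fP : suppin [set u | 0 < pairing u w] (1 - f).
  by rewrite -opprB; apply: suppinN.
rewrite (galgE (1 - f)) rmorph_sum big_seq; apply: (big_ind m) => // u.
by rewrite mem_supp => /fP; exact: mX.
Qed.

End Ideal.
End Tropical.

(** * Flats of a matroid *)

Section Matroid.
Variables (E : finType) (M : matroid E).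
Implicit Types (A B C F G : {set E}) (P : {set {set E}}).
Local Open Scope nat_scope.

Lemma mrank_witness A : exists B, [/\ B \in indep M, B \subset A & #|B| = mrank M A].
Proof.
have h0 : (finset.set0 \in indep M) && (finset.set0 \subset A).
  by rewrite indep0 finset.sub0set.
rewrite /mrank (bigop.bigmax_eq_arg finset.set0) //.
by case: arg_maxnP => // B /andP[BM BA] _; exists B.
Qed.

Lemma mrank_max A B : B \in indep M -> B \subset A -> #|B| <= mrank M A.
Proof. by move=> BM BA; apply: (leq_bigmax_cond B); rewrite BM. Qed.

Lemma mrank_indep A : A \in indep M -> mrank M A = #|A|.
Proof.
move=> AM; apply/eqP; rewrite eqn_leq mrank_max // andbT.
by have [B [_ BA <-]] := mrank_witness A; apply: subset_leq_card.
Qed.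

Lemma mrank_le_card A : mrank M A <= #|A|.
Proof. by have [B [_ BA <-]] := mrank_witness A; apply: subset_leq_card. Qed.

Lemma mrankS A B : A \subset B -> mrank M A <= mrank M B.
Proof.
move=> AB; have [C [CM CA <-]] := mrank_witness A.
by apply: mrank_max => //; apply: fintype.subset_trans AB.
Qed.

Lemma mrank0 : mrank M finset.set0 = 0.
Proof. by rewrite mrank_indep ?indep0 // finset.cards0. Qed.

Lemma indep_card A : (A \in indep M) = (mrank M A == #|A|).
Proof.
apply/idP/eqP => [/mrank_indep//|e]; have [B [BM BA cB]] := mrank_witness A.
by have/eqP <- : B == A by rewrite eqEcard BA cB e leqnn.
Qed.

(** Augmentation, one element at a time. *)
Lemma indep_extend A C k : A \in indep M -> A \subset C ->
  #|A| <= k <= mrank M C ->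
  exists B, [/\ B \in indep M, A \subset B, B \subset C & #|B| = k].
Proof.
move=> AM AC /andP[Ak]; elim: k Ak => [|k IH] Ak kC.
  by exists A; split=> //; apply/eqP; rewrite -leqn0.
move: Ak; rewrite leq_eqVlt => /orP[/eqP <-|Ak]; first by exists A.
have [B [BM AB BC cB]] := IH Ak (ltnW kC).
have [D [DM DC cD]] := mrank_witness C.
have [|x] := indep_aug BM DM; first by rewrite cB cD.
rewrite finset.in_setD => /andP[xB xD] xBM; exists (x |: B); split => //.
- by apply: fintype.subset_trans AB (finset.subsetU1 _ _).
- by rewrite finset.subUset finset.sub1set BC andbT (fintype.subsetP DC).
- by rewrite cardsU1 xB cB.
Qed.

Lemma flatP F : reflect (forall x, x \notin F -> mrank M F < mrank M (x |: F)) (flat M F).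
Proof. by apply: (iffP forallP) => h x; [exact/implyP/h|exact/implyP/h]. Qed.

(** A basis of [A] extends to a basis of [F]; adding an element [x] outside [F] would
    keep it independent, and enlarge the rank of [A]. *)
Lemma flat_closed F A x : flat M F -> A \subset F ->
  mrank M (x |: A) = mrank M A -> x \in F.
Proof.
move=> /flatP Fl AF e; apply: contraT => /[dup] xF /Fl lt.
have [B [BM BA cB]] := mrank_witness A.
have [|B' [B'M BB' B'F cB']] := indep_extend BM (fintype.subset_trans BA AF) (k := mrank M F).
  by rewrite cB mrankS //=.
have [C [CM CF cC]] := mrank_witness (x |: F).
have [|y] := indep_aug B'M CM; first by rewrite cB' cC.
rewrite finset.in_setD => /andP[yB yC] yBM.
have yF : y \notin F.
  apply: contraL (leqnn #|y |: B'|) => yF; rewrite -ltnNge.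
  rewrite [X in _ < X]cardsU1 yB cB' ltnS; apply: mrank_max => //.
  by rewrite finset.subUset finset.sub1set yF.
have yx : y = x.
  by move/fintype.subsetP/(_ y yC): CF; rewrite finset.in_setU1 (negbTE yF) orbF => /eqP.
have : x |: B \in indep M by apply: indepS yBM; rewrite yx finset.setUS.
move/(mrank_max (A := x |: A)); rewrite finset.setUS // e cardsU1 cB.
rewrite (contra (fintype.subsetP (fintype.subset_trans BA AF) x) xF) add1n ltnn.
by move=> /(_ isT).
Qed.

Lemma flat_indepU1 F A x : flat M F -> A \in indep M -> A \subset F -> x \notin F ->
  x |: A \in indep M.
Proof.
move=> Fl AM AF xF; rewrite indep_card eqn_leq mrank_le_card /=.
have xA : x \notin A by apply: contraNN xF; apply: (fintype.subsetP AF).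
rewrite cardsU1 xA add1n -(mrank_indep AM) ltn_neqAle mrankS ?finset.subsetU1 // andbT.
by apply: contraNneq xF => e; apply: (flat_closed Fl AF).
Qed.

Lemma flat_setT : flat M finset.setT.
Proof. by apply/flatP => x; rewrite finset.in_setT. Qed.

Lemma flat_bigcap (p : pred {set E}) : (forall F, p F -> flat M F) ->
  flat M (\bigcap_(F | p F) F)%SET.
Proof.
move=> pF; apply/flatP => x xn; rewrite ltn_neqAle mrankS ?finset.subsetU1 // andbT.
apply: contraNneq xn => e; apply/finset.bigcapP => F Fp.
by apply: (flat_closed (pF F Fp) _ (esym e)); apply: finset.bigcap_inf.
Qed.

Lemma flat_set0 : loop_free M -> flat M finset.set0.
Proof.
by move=> lf; apply/flatP => x _; rewrite mrank0 finset.setU0 mrank_indep ?cards1 ?lf.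
Qed.

Lemma mrank_flat_lt F G : flat M F -> F \proper G -> mrank M F < mrank M G.
Proof.
move=> /flatP Fl /properP[FG [x xG xF]]; apply: leq_trans (Fl x xF) _.
by apply: mrankS; rewrite finset.subUset finset.sub1set xG.
Qed.

Lemma flat_eq F G : flat M F -> F \subset G -> mrank M G <= mrank M F -> F = G.
Proof.
move=> Fl FG le; apply/eqP; rewrite eqEproper FG /=; apply: contraTN le => FpG.
by rewrite -ltnNge mrank_flat_lt.
Qed.

(** The closure as a set of elements that do not enlarge the rank: unlike
    [flat_span], its rank is visible. *)
Definition mclosure A := [set x | mrank M (x |: A) == mrank M A].

Lemma sub_mclosure A : A \subset mclosure A.
Proof. by apply/fintype.subsetP => x xA; rewrite inE (finset.setUidPr _) ?eqxx // finset.sub1set. Qed.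

Lemma mrank_mclosure A : mrank M (mclosure A) = mrank M A.
Proof.
apply/eqP; rewrite eqn_leq (mrankS (sub_mclosure A)) andbT leqNgt; apply/negP => lt.
have [B [BM BA cB]] := mrank_witness A.
have [C [CM CF cC]] := mrank_witness (mclosure A).
have [|y] := indep_aug BM CM; first by rewrite cB cC.
rewrite finset.in_setD => /andP[yB /(fintype.subsetP CF)]; rewrite inE => /eqP yA.
move/(mrank_max (A := y |: A)); rewrite finset.setUS // yA cardsU1 yB cB add1n ltnn.
by move=> /(_ isT).
Qed.

Lemma flat_mclosure A : flat M (mclosure A).
Proof.
apply/flatP => x; rewrite inE mrank_mclosure => ne.
apply: (leq_trans (n := mrank M (x |: A))); last first.
  by apply: mrankS; rewrite finset.setUS // sub_mclosure.
by rewrite ltn_neqAle eq_sym ne mrankS // finset.subsetU1.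
Qed.

Lemma mclosure_min A F : flat M F -> A \subset F -> mclosure A \subset F.
Proof.
by move=> Fl AF; apply/fintype.subsetP => x; rewrite inE => /eqP; apply: flat_closed.
Qed.

(** The rank of the flat in the definition of realizability is the rank of the set. *)
Lemma mrank_flat_span A : mrank M (flat_span M A) = mrank M A.
Proof.
rewrite -[RHS]mrank_mclosure; congr mrank; apply/eqP; rewrite finset.eqEsubset.
apply/andP; split; first by apply: finset.bigcap_inf; rewrite flat_mclosure sub_mclosure.
by apply/finset.bigcapsP => F /andP[Fl AF]; apply: mclosure_min.
Qed.

(** Elements at distinct levels of a function with flat level sets are independent,
    also over an independent set of higher level: adding them in the order of
    decreasing levels, each is outside a flat that contains the previous ones. *)
Lemma level_indep d (T : orderType d) (h : E -> T) (c : T) A B :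
  (forall t, flat M [set i | (t <= h i)%O]) ->
  A \in indep M -> (forall i, i \in A -> (c <= h i)%O) ->
  (forall i, i \in B -> (h i < c)%O) -> {in B &, injective h} ->
  A :|: B \in indep M.
Proof.
move=> hfl AM Ac; move: {2}#|B| (leqnn #|B|) => m.
elim: m B => [|m IH] B Bm Bc Bi.
  by move: Bm; rewrite leqn0 cards_eq0 => /eqP ->; rewrite finset.setU0.
have [->|[b0 b0B]] := finset.set_0Vmem B; first by rewrite finset.setU0.
have [b bB bmin] := @arg_minP _ _ _ b0 (mem B) h b0B.
have {}bB : b \in B := bB.
have BbM : A :|: (B :\ b) \in indep M.
  apply: IH => [|i|i j]; first by move: Bm; rewrite (cardsD1 b B) bB.
    by rewrite finset.in_setD1 => /andP[_]; apply: Bc.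
  by rewrite !finset.in_setD1 => /andP[_ iB] /andP[_ jB]; apply: Bi.
rewrite -(finset.setD1K bB) finset.setUCA.
have [e|[b1 b1B]] := finset.set_0Vmem (B :\ b).
  rewrite e finset.setU0; apply: (flat_indepU1 (hfl c)) => //.
    by apply/fintype.subsetP => i /Ac; rewrite inE.
  by rewrite inE -ltNge Bc.
have [b2 b2B bmin2] := @arg_minP _ _ _ b1 (mem (B :\ b)) h b1B.
have : b2 \in B :\ b := b2B.
rewrite finset.in_setD1 => /andP[b2b {}b2B].
apply: (flat_indepU1 (hfl (h b2))) => //.
  rewrite finset.subUset; apply/andP; split; apply/fintype.subsetP => i.
    by move=> /Ac ci; rewrite inE (le_trans _ ci) // ltW // Bc.
  by move=> iB; rewrite inE; apply: bmin2.
rewrite inE -ltNge lt_neqAle bmin // andbT.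
by apply: contraNneq b2b => /Bi ->.
Qed.

End Matroid.

(** * Maximal flags and the support of the matroid fan *)

Section Fan.
Variables (R : realType) (n : nat) (M : matroid 'I_n.+1).
Hypothesis lf : loop_free M.
Notation E := 'I_n.+1.
Notation d := (mdim M).
Implicit Types (P : {set {set E}}) (F G : {set E}) (w : 'rV[R]_n).

Lemma mrankT : mrank M finset.setT = d.+1.
Proof.
rewrite /mdim prednK //; apply: leq_trans (mrankS M (finset.subsetT [set ord0])).
by rewrite mrank_indep ?lf // cards1.
Qed.

Lemma mrank_le_dim F : (mrank M F <= d.+1)%N.
Proof. by rewrite -mrankT mrankS // finset.subsetT. Qed.

Definition step (beta : E -> 'I_d.+1) (j : nat) : {set E} := [set i | (beta i < j)%N].

(** The members of a complete flag are the sets of indices of the first blocks of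
    an ordered partition, here the partition into the fibers of [beta]; the basis
    [b] picks one element in each block. *)
Record adapted (beta : E -> 'I_d.+1) (b : 'I_d.+1 -> E) : Prop := Adapted {
  adapted_section : cancel b beta;
  adapted0 : b (beta ord0) = ord0;
  adapted_flat : forall j, flat M (step beta j) }.

Section MaximalFlag.
Variable P : {set {set E}}.
Hypothesis maxP : maximal_flag M P.

Let flagP : flag M P. Proof. exact: maxsetp maxP. Qed.
Let flatP F : F \in P -> [/\ flat M F, F != finset.set0 & F != finset.setT].
Proof. by move=> FP; have /andP[/forall_inP/(_ F FP)/and3P[]] := flagP. Qed.
Let chainP F G : F \in P -> G \in P -> (F \subset G) || (G \subset F).
Proof. by move=> FP GP; have /andP[_ /forall_inP/(_ F FP)/forall_inP/(_ G GP)] := flagP. Qed.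
Let chain_rank F G : F \in P -> G \in P -> (mrank M F <= mrank M G)%N -> F \subset G.
Proof.
move=> FP GP le; have /orP[//|GF] := chainP FP GP.
by have [fG _ _] := flatP GP; rewrite (flat_eq fG GF le).
Qed.

(** The flat of rank [j] in the flag, obtained as the intersection of its members of
    rank at least [j]; it is the whole set when there is none. *)
Let Fs j : {set E} := (\bigcap_(F | (F \in P) && (j <= mrank M F)%N) F)%SET.

Let Fs_flat j : flat M (Fs j).
Proof. by apply: flat_bigcap => F /andP[/flatP[]]. Qed.

Let FsS i j : (i <= j)%N -> Fs i \subset Fs j.
Proof.
move=> ij; apply/finset.bigcapsP => F /andP[FP jF].
by apply: finset.bigcap_inf; rewrite FP (leq_trans ij).
Qed.

Let Fs_attained j : Fs j = finset.setT \/ (Fs j \in P) /\ (j <= mrank M (Fs j))%N.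
Proof.
have [/existsP[F0 F0P]|/existsPn none] :=
    boolP [exists F, (F \in P) && (j <= mrank M F)%N]; last first.
  by left; apply: big_pred0 => F; apply/negbTE.
right; have [G /andP[GP jG] Gmin] :=
  @arg_minnP _ F0 (fun F => (F \in P) && (j <= mrank M F)%N) (mrank M) F0P.
suff -> : Fs j = G by [].
apply/eqP; rewrite finset.eqEsubset; apply/andP; split.
  by apply: finset.bigcap_inf; rewrite GP.
apply/finset.bigcapsP => F /[dup] /andP[FP _] /Gmin; exact: chain_rank.
Qed.

(** By maximality no rank is skipped: otherwise a flat of the missing rank
    could be inserted into the flag. *)
Let mrank_Fs j : (0 < j <= d.+1)%N -> mrank M (Fs j) = j.
Proof.
move=> /andP[j0 jd]; apply/eqP; rewrite eqn_leq andbC; apply/andP; split.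
  by have [->|[]//] := Fs_attained j; rewrite mrankT.
rewrite leqNgt; apply/negP => ltj.
pose G := (\bigcup_(F | (F \in P) && (mrank M F < j)%N) F)%SET.
have Gj : (mrank M G < j)%N.
  have [/existsP[F0 F0P]|/existsPn none] :=
      boolP [exists F, (F \in P) && (mrank M F < j)%N]; last first.
    by rewrite /G big_pred0 ?mrank0 // => F; apply/negbTE.
  have [H /andP[HP Hj] Hmax] :=
    @arg_maxnP _ F0 (fun F => (F \in P) && (mrank M F < j)%N) (mrank M) F0P.
  apply: leq_ltn_trans (mrankS M _) Hj; apply/finset.bigcupsP.
  by move=> F /[dup] /andP[FP _] /Hmax; exact: chain_rank.
have GF : G \subset Fs j.
  apply/finset.bigcupsP => F /andP[FP Fj]; apply/finset.bigcapsP => H /andP[HP jH].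
  by apply: chain_rank => //; apply: ltnW; apply: leq_trans jH.
have [A [AM AG cA]] := mrank_witness M G.
have [|B [BM AB BF cB]] := indep_extend AM (fintype.subset_trans AG GF) (k := j).
  by rewrite cA (ltnW Gj) (ltnW ltj).
pose K := mclosure M B.
have Kflat : flat M K by exact: flat_mclosure.
have Kj : mrank M K = j by rewrite mrank_mclosure mrank_indep.
have KF : K \subset Fs j by apply: mclosure_min.
have GK : G \subset K.
  apply: fintype.subset_trans (mclosure_min Kflat (fintype.subset_trans AB (sub_mclosure M B))).
  apply/fintype.subsetP => x xG; rewrite inE eqn_leq (mrankS M (finset.subsetU1 x A)) andbT.
  by rewrite [leqRHS](mrank_indep AM) cA mrankS // finset.subUset finset.sub1set xG.
have KP : K \in P.
  have /maxsetP[_ Pmax] := maxP; suff KPP : K |: P = P by rewrite -KPP finset.setU11.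
  have KC F : F \in P -> (K \subset F) || (F \subset K).
    move=> FP; have [Fj|jF] := ltnP (mrank M F) j.
      by rewrite orbC (fintype.subset_trans _ GK) // /G (finset.bigcup_max F) ?FP.
    by rewrite (fintype.subset_trans KF) // /Fs finset.bigcap_inf // FP.
  apply: Pmax; last exact: finset.subsetUr.
  apply/andP; split.
    apply/forall_inP => F; rewrite finset.in_setU1 => /orP[/eqP ->|/flatP[-> -> ->]//].
    apply/and3P; split=> //; apply/eqP => e.
      by move: Kj j0; rewrite e mrank0 => <-.
    by move: Kj ltj; rewrite e => <-; rewrite ltnNge mrankS // finset.subsetT.
  apply/forall_inP => F FK; apply/forall_inP => H HK.
  move: FK HK; rewrite !finset.in_setU1 => /orP[/eqP ->|FP] /orP[/eqP ->|HP].
  - by rewrite fintype.subxx.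
  - exact: KC.
  - by rewrite orbC; exact: KC.
  - exact: chainP.
move: ltj; rewrite ltnNge -[X in (_ <= X)%N]Kj mrankS //.
by apply: finset.bigcap_inf; rewrite KP Kj /=.
Qed.

(** Each rank from 1 to d occurs once, so that the blocks are the successive
    differences of the members; any choice of elements in them gives a basis, and the
    element 0 is chosen in its own block. *)
Lemma maximal_flag_adapted : exists beta b,
  adapted beta b /\ P = [set step beta j.+1 | j : 'I_d].
Proof.
have FsT : Fs d.+1 = finset.setT.
  by apply: (flat_eq (Fs_flat _) (finset.subsetT _)); rewrite mrankT mrank_Fs ?leqnn.
pose beta (i : E) := [arg min_(j < (ord_max : 'I_d.+1) | i \in Fs j.+1) (j : nat)]%N.
have betaP i j : (beta i < j)%N = (i \in if (j == 0)%N then finset.set0 else Fs j) :> bool.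
  rewrite /beta; case: arg_minnP => [|l il lmin]; first by rewrite FsT finset.in_setT.
  case: j => [|j] /=; first by rewrite finset.in_set0 ltn0.
  apply/idP/idP => [lj|ij]; first exact: (fintype.subsetP (FsS lj)).
  have [jd|dj] := ltnP j d.+1; first exact: (lmin (Ordinal jd)).
  exact: leq_trans (ltn_ord l) (leqW dj).
have stepE j : step beta j = if (j == 0)%N then finset.set0 else Fs j.
  by apply/setP => i; rewrite inE betaP.
have step_flat j : flat M (step beta j).
  by rewrite stepE; case: ifP => _; [exact: flat_set0 | exact: Fs_flat].
have step_rank j : (j <= d.+1)%N -> mrank M (step beta j) = j.
  by rewrite stepE; case: j => [|j] jd; rewrite ?mrank0 // mrank_Fs.
have ex_b (j : 'I_d.+1) : exists i, beta i == j.
  have : ~~ (step beta j.+1 \subset step beta j).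
    apply/negP => /(mrankS M).
    by rewrite (step_rank _ (ltn_ord j)) (step_rank _ (ltnW (ltn_ord j))) ltnn.
  move=> /fintype.subsetPn[i]; rewrite !inE -leqNgt ltnS => ij ji; exists i.
  by rewrite -val_eqE eqn_leq ij.
pose b j := if j == beta ord0 then ord0 else xchoose (ex_b j).
exists beta, b; split.
  split=> // [j|]; last by rewrite /b eqxx.
  by rewrite /b; case: eqP => [->//|_]; apply/eqP; exact: (xchooseP (ex_b j)).
apply/setP => F; apply/idP/imsetP => [FP|[j _ ->]].
  have [fF F0 FT] := flatP FP.
  have rF : (0 < mrank M F < d.+1)%N.
    rewrite -mrankT mrank_flat_lt ?finset.properT // andbT.
    rewrite -(mrank0 M) mrank_flat_lt ?flat_set0 // finset.proper0 //.
  have jd : ((mrank M F).-1 < d)%N by case/andP: rF; case: (mrank M F).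
  exists (Ordinal jd) => //=; rewrite prednK; last by case/andP: rF.
  rewrite stepE gtn_eqF; last by case/andP: rF.
  apply/esym/(flat_eq (Fs_flat _)); first by apply: finset.bigcap_inf; rewrite FP /=.
  by rewrite mrank_Fs //; case/andP: rF => ->; exact: ltnW.
rewrite stepE /=; have [e|[]//] := Fs_attained j.+1.
have : mrank M (Fs j.+1) = j.+1 by rewrite mrank_Fs //= ltnS ltnW.
by rewrite e mrankT => - [] jd; have := ltn_ord j; rewrite -jd ltnn.
Qed.

End MaximalFlag.
End Fan.

Section FanPoints.
Variables (R : realType) (n : nat) (M : matroid 'I_n.+1).
Hypothesis lf : loop_free M.
Notation E := 'I_n.+1.
Notation d := (mdim M).
Implicit Types (P : {set {set E}}) (F G : {set E}) (w : 'rV[R]_n).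

Lemma hatD w w' i : hat (w + w') i = hat w i + hat w' i.
Proof.
case: (unliftP ord0 i) => [j ->|->]; rewrite ?hat_lift ?mxE ?hat0 //.
by rewrite addr0.
Qed.
Lemma hatZ c w i : hat (c *: w) i = c * hat w i.
Proof. by case: (unliftP ord0 i) => [j ->|->]; rewrite ?hat_lift ?mxE ?hat0 // mulr0. Qed.
Lemma hat_at0 i : hat (0 : 'rV[R]_n) i = 0.
Proof. by rewrite -(scale0r 0) hatZ mul0r. Qed.
Lemma hat_sum (J : Type) (s : seq J) (p : pred J) (F : J -> 'rV[R]_n) i :
  hat (\sum_(j <- s | p j) F j) i = \sum_(j <- s | p j) hat (F j) i.
Proof.
by rewrite (big_morph (fun w => hat w i) (fun w w' => hatD w w' i) (hat_at0 i)).
Qed.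

Lemma hat_evec_set F i : hat (evec_set R F) i = (i \in F)%:R - (ord0 \in F)%:R.
Proof.
have -> : evec_set R F = \sum_i (i \in F)%:R *: evec R i.
  rewrite /evec_set big_mkcond /=; apply: eq_bigr => j _.
  by case: (j \in F); rewrite ?scale1r ?scale0r.
rewrite evec_sum; case: (unliftP ord0 i) => [j ->|->]; rewrite ?hat_lift ?mxE //.
by rewrite hat0 subrr.
Qed.

(** The flats condition that characterizes the points of the matroid fan. *)
Definition levels w := forall t : R, flat M [set i | t <= hat w i].

(** Elements of distinct weights are independent. *)
Lemma levels_card w (T : {set E}) : levels w -> {in T &, injective (hat w)} ->
  (#|T| <= d.+1)%N.
Proof.
move=> lw Ti; rewrite -(mrankT lf); apply: mrank_max (finset.subsetT _).
rewrite -[T]finset.set0U.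
apply: (level_indep (c := 1 + \sum_i `|hat w i|) lw) => // [|i|i iT].
- exact: indep0.
- by rewrite finset.in_set0.
rewrite ltr_pwDl // (bigD1 i) //= (le_trans (ler_norm _)) // lerDl.
exact: sumr_ge0.
Qed.

(** For a combination of the members of a flag with nonnegative coefficients, the
    indices of weight at least [t] are the common elements of the members that contain
    a given one of them, which is chosen to be in as few members as possible. *)
Lemma fan_levels w : matroid_fan_support M w -> levels w.
Proof.
move=> [P /andP[/forall_inP Pf /forall_inP Pc] [c c0 ->]] t; set L := [set i | _].
pose s i := \sum_(F in P) c F * (i \in F)%:R.
have LE i : (i \in L) = (t <= s i - s ord0).
  rewrite inE hat_sum /s -sumrB; congr (_ <= _).
  by apply: eq_bigr => F _; rewrite hatZ hat_evec_set mulrBr.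
pose PI (i : E) := [set F in P | i \in F].
have [->|[i1 i1L]] := finset.set_0Vmem L; first exact: flat_set0.
have [i0 i0L i0min] := @arg_minnP _ i1 (mem L) (fun i => #|PI i|) i1L.
have {}i0L : i0 \in L := i0L.
suff -> : L = (\bigcap_(F | F \in PI i0) F)%SET.
  by apply: flat_bigcap => F; rewrite inE => /andP[/Pf/and3P[]].
apply/setP => j; apply/idP/finset.bigcapP => [jL F|jI].
  rewrite inE => /andP[FP i0F]; apply: contraT => jF.
  have : PI j \proper PI i0.
    apply/properP; split; last by exists F; rewrite !inE FP ?i0F ?(negbTE jF).
    apply/fintype.subsetP => G; rewrite !inE => /andP[GP jG]; rewrite GP /=.
    have /orP[/fintype.subsetP FG|/fintype.subsetP GF] := forall_inP (Pc F FP) G GP.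
      exact: FG.
    by rewrite (GF _ jG) in jF.
  by move=> /proper_card; rewrite ltnNge (i0min j jL).
move: i0L; rewrite !LE => /le_trans; apply; rewrite lerD2r; apply: ler_sum => F FP.
apply: ler_wpM2l; first exact: c0.
have [i0F|] := boolP (i0 \in F); last by rewrite ler0n.
by rewrite jI // inE FP.
Qed.

Section Adapted.
Variables (beta : E -> 'I_d.+1) (b : 'I_d.+1 -> E).
Hypothesis ad : adapted beta b.
Let betab := adapted_section ad.

Lemma b_inj : injective b. Proof. exact: can_inj betab. Qed.

(** The steps of the flag are the level sets of [d - beta]. *)
Lemma basis_indep : [set b j | j : 'I_d.+1] \in indep M.
Proof.
rewrite -[[set b j | j : _]]finset.set0U.
apply: (@level_indep _ M _ nat (fun i => d - beta i)%N d.+1).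
- move=> t; have -> : [set i | (t <= (d - beta i)%N)%O] = step beta (d.+1 - t).
    apply/setP => i; rewrite !inE leEnat; have := ltn_ord (beta i).
    by move: (beta i : nat) => m; lia.
  exact: (adapted_flat ad).
- exact: indep0.
- by move=> i; rewrite finset.in_set0.
- by move=> i _; rewrite ltEnat /= ltnS leq_subr.
move=> _ _ /imsetP[j _ ->] /imsetP[l _ ->]; rewrite !betab => e.
congr b; apply: val_inj => /=; have := ltn_ord j; have := ltn_ord l.
by move: e; move: (j : nat) (l : nat) => x y; lia.
Qed.

Lemma basis_card : #|[set b j | j : 'I_d.+1]| = d.+1.
Proof. by rewrite card_imset ?card_ord //; exact: b_inj. Qed.

Lemma basis_spans F : flat M F -> (forall j, b j \in F) -> F = finset.setT.
Proof.
move=> fF bF; apply: (flat_eq fF (finset.subsetT _)); rewrite (mrankT lf) -basis_card.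
apply: mrank_max basis_indep _; apply/fintype.subsetP => _ /imsetP[j _ ->].
exact: bF.
Qed.

(** At a point of the fan the least weight is attained on a basis: a flat that
    contains a basis is everything. *)
Lemma levels_min w t : levels w -> (forall j, t <= hat w (b j)) -> forall i, t <= hat w i.
Proof.
move=> lw wb i.
have e : [set i | t <= hat w i] = finset.setT.
  by apply: basis_spans => // j; rewrite inE.
have : i \in [set i | t <= hat w i] by rewrite e finset.in_setT.
by rewrite inE.
Qed.

(** Points in the interior of the cone of the flag satisfy [ordered] and [blockwise];
    the first condition is open and determines the cone. *)
Definition ordered w := forall i j : 'I_d.+1, (i < j)%N -> hat w (b j) < hat w (b i).
Definition blockwise w := forall i, hat w i = hat w (b (beta i)).

(** Over given weights on the basis [b], in strictly decreasing order, the fan has a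
    single point. If [i] had a weight different from that of the element of the basis
    in its block, then [i] could be added to the basis: one part of it is independent
    together with [i] by means of a flat of one of the two filtrations, by weights and
    by blocks, and the rest is added along the other one. *)
Lemma ordered_blockwise w : levels w -> ordered w -> blockwise w.
Proof.
move=> lw ow i; set j := beta i; have [->//|ibj] := eqVneq i (b j).
have ib l : i != b l by apply: contraNneq ibj => e; rewrite /j e betab.
have basisU1 : i |: [set b j | j : 'I_d.+1] \notin indep M.
  apply/negP => /mrank_max/(_ (finset.subsetT _)).
  rewrite (mrankT lf) cardsU1 basis_card.
  case: imsetP => [[l _ e]|_]; first by have := ib l; rewrite e eqxx.
  by rewrite add1n ltnn.
have bset (p q : pred 'I_d.+1) : (forall l : 'I_d.+1, p l || q l) ->
    (i |: [set b l | l in p]) :|: [set b l | l in q] \in indep M -> False.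
  move=> pq ind; move/negP: basisU1; apply; apply: indepS ind.
  apply/fintype.subsetP => x; rewrite !inE => /orP[->//|/imsetP[l _ ->]].
  case/orP: (pq l) => h; first by rewrite (imset_f b (h : l \in p)) orbT.
  by rewrite (imset_f b (h : l \in q)) orbT.
have D_indep (p : pred 'I_d.+1) : [set b l | l in p] \in indep M.
  by apply: indepS basis_indep; apply/fintype.subsetP => _ /imsetP[l _ ->]; apply: imset_f.
apply/eqP; rewrite eq_le !leNgt; apply/andP; split; apply/negP => lt.
  (* If [i] is heavier, the elements of the basis of weight at least [hat w i] lie in
     the flat of the blocks before that of [i]. *)
  apply: (bset [pred l | hat w i <= hat w (b l)] [pred l | hat w (b l) < hat w i]).
    by move=> l /=; case: leP.
  apply: (level_indep (c := hat w i) lw).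
  - apply: (flat_indepU1 (adapted_flat ad j)) => //; last by rewrite inE ltnn.
    apply/fintype.subsetP => _ /imsetP[l + ->]; rewrite !inE betab => il.
    rewrite ltnNge; apply: contraTN (lt_le_trans lt il) => jl; rewrite -leNgt.
    by move: jl; rewrite leq_eqVlt => /orP[/eqP/val_inj <-//|/ow/ltW].
  - by move=> x; rewrite !inE => /orP[/eqP ->//|/imsetP[l + ->]].
  - by move=> x /imsetP[l + ->]; rewrite inE.
  move=> _ _ /imsetP[l _ ->] /imsetP[m _ ->] e; congr b.
  by have [/ow|/ow|/val_inj//] := ltngtP l m; rewrite e ltxx.
(* If [i] is lighter, the elements of the basis in the blocks up to that of [i] lie in
   the flat of the elements of weight at least [hat w (b j)]. *)
apply: (bset [pred l : 'I_d.+1 | (l <= j)%N] [pred l : 'I_d.+1 | (j < l)%N]).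
  by move=> l /=; case: leqP.
apply: (@level_indep _ M _ nat (fun i => d - beta i)%N (d - j)%N).
- move=> t; have -> : [set i | (t <= (d - beta i)%N)%O] = step beta (d.+1 - t).
    apply/setP => x; rewrite !inE leEnat; have := ltn_ord (beta x).
    by move: (beta x : nat) => m; lia.
  exact: (adapted_flat ad).
- apply: (flat_indepU1 (lw (hat w (b j)))) => //; last by rewrite inE -ltNge.
  apply/fintype.subsetP => _ /imsetP[l + ->]; rewrite !inE.
  by rewrite leq_eqVlt => /orP[/eqP/val_inj ->//|/ow/ltW].
- move=> x; rewrite !inE leEnat => /orP[/eqP ->//|/imsetP[l + ->]].
  by rewrite betab inE => lj; apply: leq_sub2l.
- move=> x /imsetP[l + ->]; rewrite betab inE ltEnat /= => jl.
  by have := ltn_ord l; move: jl; move: (j : nat) (l : nat) => y z; lia.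
move=> _ _ /imsetP[l _ ->] /imsetP[m _ ->]; rewrite !betab => e.
congr b; apply: val_inj => /=; have := ltn_ord l; have := ltn_ord m.
by move: e; move: (m : nat) (l : nat) => x y; lia.
Qed.
End Adapted.
End FanPoints.

Section FanCones.
Variables (R : realType) (n : nat) (M : matroid 'I_n.+1).
Hypothesis lf : loop_free M.
Notation E := 'I_n.+1.
Notation d := (mdim M).
Implicit Types (P : {set {set E}}) (F G : {set E}) (w : 'rV[R]_n).

Section Adapted.
Variables (beta : E -> 'I_d.+1) (b : 'I_d.+1 -> E).
Hypothesis ad : adapted beta b.
Let betab := adapted_section ad.

Definition steps := [set step beta j.+1 | j : 'I_d].

Lemma step_inj : injective (fun j : 'I_d => step beta j.+1).
Proof.
move=> i j e; apply: val_inj; apply/eqP; rewrite eqn_leq /=.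
have bi l : b (widen_ord (leqnSn d) l) \in step beta l.+1 by rewrite inE betab /=.
by have := bi j; have := bi i; rewrite {1}e -{2}e !inE !betab /= !ltnS => -> ->.
Qed.

Lemma hat_cone (c : 'I_d -> R) i :
  hat (\sum_l c l *: evec_set R (step beta l.+1)) i =
  \sum_(l : 'I_d | (beta i <= l)%N) c l - \sum_(l : 'I_d | (beta ord0 <= l)%N) c l.
Proof.
rewrite hat_sum [X in _ = X - _]big_mkcond [X in _ = _ - X]big_mkcond -sumrB; apply: eq_bigr => l _.
rewrite hatZ hat_evec_set !inE !ltnS mulrBr.
by case: leqP => _; case: leqP => _; rewrite ?mulr1 ?mulr0.
Qed.

(** Points that are constant on the blocks are combinations of the members of the
    flag; the coefficients are the jumps between consecutive blocks. *)
Lemma blockwise_decomp w : blockwise beta b w ->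
  w = \sum_(l < d) (hat w (b (widen_ord (leqnSn d) l)) - hat w (b (lift ord0 l)))
      *: evec_set R (step beta l.+1).
Proof.
move=> bw; apply: hat_inj => i; rewrite hat_cone.
pose A j := hat w (b (inord j)).
have sumA m : (m <= d)%N -> \sum_(l < d | (m <= l)%N)
    (hat w (b (widen_ord (leqnSn d) l)) - hat w (b (lift ord0 l))) = A m - A d.
  move=> md; transitivity (\sum_(l < d | (m <= l)%N) (A l - A l.+1)).
    apply: eq_bigr => l _; rewrite /A; congr (hat w (b _) - hat w (b _)).
      by apply: val_inj; rewrite /= inordK // ltnS ltnW.
    by apply: val_inj; rewrite /= inordK // ltnS.
  rewrite -(big_geq_mkord m d xpredT (fun l => A l - A l.+1)).
  by rewrite -[RHS]opprB -telescope_sumr // -sumrN; apply: eq_bigr => l _; rewrite opprB.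
rewrite (sumA _ (leq_ord (beta i))) (sumA _ (leq_ord (beta ord0))).
rewrite opprB addrA subrK.
by rewrite /A !inord_val -!bw hat0 subr0.
Qed.

Lemma sum_steps (c : {set E} -> R) :
  \sum_(F in steps) c F *: evec_set R F =
  \sum_(l < d) c (step beta l.+1) *: evec_set R (step beta l.+1).
Proof. by rewrite big_imset //= => i j _ _; exact: step_inj. Qed.

(** The coefficients on the members of the flag are the jumps of the weights. *)
Lemma relint_stepsP w :
  flag_cone_relint steps w <-> ordered b w /\ blockwise beta b w.
Proof.
split=> [[c c0]|[ow bw]].
  rewrite sum_steps => we; split=> [i j ij|i]; rewrite we !hat_cone !betab //.
  rewrite ltrD2r [ltRHS](bigID (fun l : 'I_d => (j <= l)%N)) /=.
  rewrite [X in _ < X + _](eq_bigl (fun l : 'I_d => (j <= l)%N)); last first.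
    by move=> l; apply/andP/idP => [[]//|jl]; rewrite jl (leq_trans (ltnW ij)).
  have id : (i < d)%N by rewrite (leq_trans ij) // -ltnS.
  have step_in (l : 'I_d) : step beta l.+1 \in steps by apply: imset_f.
  rewrite ltrDl (bigD1 (Ordinal id)) /=; last by rewrite leqnn -ltnNge.
  apply: ltr_pwDl; first exact: (c0 _ (step_in (Ordinal id))).
  by apply: sumr_ge0 => l _; exact: ltW (c0 _ (step_in l)).
pose c F := \sum_(l < d | step beta l.+1 == F)
  (hat w (b (widen_ord (leqnSn d) l)) - hat w (b (lift ord0 l))).
have cE (l : 'I_d) : c (step beta l.+1) =
    hat w (b (widen_ord (leqnSn d) l)) - hat w (b (lift ord0 l)).
  by rewrite /c (big_pred1 l) // => m /=; apply/eqP/eqP => [/step_inj|->].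
exists c; first by move=> _ /imsetP[l _ ->]; rewrite cE subr_gt0; apply: ow.
by rewrite {1}(blockwise_decomp bw) sum_steps; apply: eq_bigr => l _; rewrite cE.
Qed.

Lemma flag_steps : flag M steps.
Proof.
apply/andP; split; apply/forall_inP => _ /imsetP[j _ ->].
  rewrite (adapted_flat ad); apply/and3P; split=> //.
    apply/finset.set0Pn; exists (b (widen_ord (leqnSn d) j)); first by rewrite inE betab /=.
  apply/eqP => /finset.setP/(_ (b ord_max)).
  by rewrite !inE betab /= ltnS leqNgt ltn_ord.
apply/forall_inP => _ /imsetP[l _ ->].
have [le|/ltnW le] := leqP j l; apply/orP; [left|right];
  by apply/fintype.subsetP => i; rewrite !inE !ltnS => /leq_trans; apply.
Qed.

Lemma cone_steps w : (forall i j : 'I_d.+1, (i <= j)%N -> hat w (b j) <= hat w (b i)) ->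
  blockwise beta b w -> matroid_fan_support M w.
Proof.
move=> ow bw; exists steps; first exact: flag_steps.
pose c F := \sum_(l < d | step beta l.+1 == F)
  (hat w (b (widen_ord (leqnSn d) l)) - hat w (b (lift ord0 l))).
have cE (l : 'I_d) : c (step beta l.+1) =
    hat w (b (widen_ord (leqnSn d) l)) - hat w (b (lift ord0 l)).
  by rewrite /c (big_pred1 l) // => m /=; apply/eqP/eqP => [/step_inj|->].
exists c; first by move=> _ /imsetP[l _ ->]; rewrite cE subr_ge0; apply: ow.
by rewrite {1}(blockwise_decomp bw) sum_steps; apply: eq_bigr => l _; rewrite cE.
Qed.

Lemma ordered_fan w : ordered b w -> blockwise beta b w -> matroid_fan_support M w.
Proof.
move=> ow bw; apply: cone_steps bw => i j; rewrite leq_eqVlt.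
by case/orP => [/eqP/val_inj ->|/ow/ltW].
Qed.

(** The point with weight [a j] on block [j], up to the normalization of the weight of
    the element 0. *)
Definition block_point (a : 'I_d.+1 -> R) : 'rV[R]_n :=
  \row_j (a (beta (lift ord0 j)) - a (beta ord0)).

Lemma hat_block_point a i : hat (block_point a) i = a (beta i) - a (beta ord0).
Proof.
by case: (unliftP ord0 i) => [j ->|->]; rewrite ?hat_lift ?mxE // hat0 subrr.
Qed.

Lemma block_point_blockwise a : blockwise beta b (block_point a).
Proof. by move=> i; rewrite !hat_block_point betab. Qed.

Lemma block_point_ordered (a : 'I_d.+1 -> R) :
  (forall i j : 'I_d.+1, (i < j)%N -> a j < a i) -> ordered b (block_point a).
Proof. by move=> a_dec i j ij; rewrite !hat_block_point !betab ltrD2r a_dec. Qed.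

End Adapted.

Lemma flag_sub_maximal P : flag M P -> exists2 P', maximal_flag M P' & P \subset P'.
Proof. by move=> fP; have [P' ? ?] := maxset_exists fP; exists P'. Qed.

Lemma exists_maximal_flag : exists P, maximal_flag M P.
Proof.
have [|P mP _] := @flag_sub_maximal finset.set0; last by exists P.
by apply/andP; split; apply/forall_inP => F; rewrite finset.in_set0.
Qed.

(** The level sets form a flag; a maximal flag that contains it is adapted to a basis,
    and the weights decrease, in the wide sense, along its blocks. *)
Lemma levels_fan w : levels M w -> matroid_fan_support M w.
Proof.
move=> lw; pose L t := [set i : E | t <= hat w i].
pose P0 := [set L (hat w i) | i : E] :\ finset.setT.
have [|P mP P0P] := @flag_sub_maximal P0.
  apply/andP; split; apply/forall_inP => F /finset.setD1P[FT /imsetP[i _ Fi]].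
    rewrite Fi lw /= -Fi FT andbT Fi.
    by apply/finset.set0Pn; exists i; rewrite inE.
  apply/forall_inP => G /finset.setD1P[GT /imsetP[j _ Gj]]; rewrite Fi Gj.
  have [le|/ltW le] := leP (hat w i) (hat w j); apply/orP; [right|left];
    by apply/fintype.subsetP => l; rewrite !inE; apply: le_trans.
have [beta [b [ad PE]]] := maximal_flag_adapted lf mP.
have betab := adapted_section ad.
have Lstep i : L (hat w i) = finset.setT \/ exists m, L (hat w i) = step beta m.
  have [->|LT] := eqVneq (L (hat w i)) finset.setT; [by left|right].
  have : L (hat w i) \in P.
    by apply: (fintype.subsetP P0P); apply/finset.setD1P; split=> //; apply: imset_f.
  by rewrite PE => /imsetP[m _ ->]; exists m.+1.
have bmono i j : (beta i <= beta j)%N -> hat w j <= hat w i.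
  move=> ij; have : j \in L (hat w j) by rewrite inE.
  suff : j \in L (hat w j) -> i \in L (hat w j) by move=> h /h; rewrite inE.
  case: (Lstep j) => [->|[m ->]]; first by rewrite !finset.in_setT.
  by rewrite !inE; apply: leq_ltn_trans.
apply: (cone_steps ad) => [i j ij|i]; first by apply: bmono; rewrite !betab.
by apply: le_anti; rewrite !bmono // betab.
Qed.

End FanCones.

(** * Valuation rings of a field *)

Section Valuation.
Variable F : fieldType.
Implicit Types (S V m : set F) (x y z : F) (p q : {poly F}).

Definition subring_set S :=
  [/\ S 1, forall x y, S x -> S y -> S (x - y) & forall x y, S x -> S y -> S (x * y)].

Definition ideal_set S m :=
  [/\ m 0, forall x y, m x -> m y -> m (x + y) & forall x y, S x -> m y -> m (x * y)].

Lemma subring_set0 S : subring_set S -> S 0.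
Proof. by case=> S1 SB _; rewrite -(subrr 1); apply: SB. Qed.
Lemma subring_setN S x : subring_set S -> S x -> S (- x).
Proof. by move=> rS Sx; rewrite -sub0r; case: (rS) => _ SB _; apply: SB => //; apply: subring_set0. Qed.
Lemma subring_setD S x y : subring_set S -> S x -> S y -> S (x + y).
Proof. by move=> rS Sx Sy; rewrite -[y]opprK; case: (rS) => _ SB _; apply: SB => //; apply: subring_setN. Qed.
Lemma subring_set_sum S (J : eqType) (s : seq J) (P : pred J) (G : J -> F) :
  subring_set S -> (forall j, j \in s -> P j -> S (G j)) -> S (\sum_(j <- s | P j) G j).
Proof.
move=> rS SG; rewrite big_seq_cond; apply: (big_ind S).
- exact: subring_set0.
- by move=> x y; apply: subring_setD.
- by move=> j /andP[]; apply: SG.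
Qed.
Lemma ideal_set_sum S m (J : eqType) (s : seq J) (P : pred J) (G : J -> F) :
  ideal_set S m -> (forall j, j \in s -> P j -> m (G j)) -> m (\sum_(j <- s | P j) G j).
Proof.
move=> [m0 mD _] mG; rewrite big_seq_cond; apply: (big_ind m) => //.
by move=> j /andP[]; apply: mG.
Qed.
Lemma subring_setX S x j : subring_set S -> S x -> S (x ^+ j).
Proof.
case=> S1 _ SM Sx; elim: j => [|j IH]; first by rewrite expr0.
by rewrite exprS; apply: SM.
Qed.

Definition coefs_in S p := forall i, S p`_i.

Lemma coefs_inD S m p q : ideal_set S m -> coefs_in m p -> coefs_in m q -> coefs_in m (p + q).
Proof. by case=> _ mD _ mp mq i; rewrite coefD; apply: mD. Qed.
Lemma coefs_inZ S m a p : ideal_set S m -> S a -> coefs_in m p -> coefs_in m (a *: p).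
Proof. by case=> _ _ mM Sa mp i; rewrite coefZ; apply: mM. Qed.
Lemma coefs_inM S m p q : ideal_set S m -> coefs_in S p -> coefs_in m q -> coefs_in m (p * q).
Proof.
move=> im Sp mq i; rewrite coefM; apply: (ideal_set_sum im) => j _ _.
by case: im => _ _ mM; apply: mM.
Qed.
Lemma coefs_inC m a : m 0 -> m a -> coefs_in m a%:P.
Proof. by move=> m0 ma i; rewrite coefC; case: ifP. Qed.

Lemma subring_ideal S : subring_set S -> ideal_set S S.
Proof.
by move=> rS; split; [exact: subring_set0 | move=> x y; exact: subring_setD | case: rS].
Qed.

(** Both the ring generated over [S] by [z] and the ideal generated in it by an ideal
    [m] of [S] have this form. *)
Definition adjoin m z : set F := [set x | exists2 p, coefs_in m p & x = p.[z]]%classic.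

Lemma adjoin_sub m z : m 0 -> (m `<=` adjoin m z)%classic.
Proof. by move=> m0 x mx; exists x%:P; rewrite ?hornerC //; apply: coefs_inC. Qed.
Lemma adjoin_ideal S m z : ideal_set S m -> ideal_set (adjoin S z) (adjoin m z).
Proof.
move=> im; have [m0 mD mM] := im; split.
- exact: adjoin_sub.
- by move=> _ _ [p mp ->] [q mq ->]; exists (p + q); rewrite ?hornerD //; apply: (coefs_inD im).
- by move=> _ _ [p Sp ->] [q mq ->]; exists (p * q); rewrite ?hornerM //; apply: (coefs_inM im).
Qed.
Lemma adjoin_subring S z : subring_set S -> subring_set (adjoin S z).
Proof.
move=> rS; have iS := subring_ideal rS; have [S1 SB _] := rS.
have [_ _ aM] := adjoin_ideal z iS; split=> //; first by apply: adjoin_sub => //; apply: subring_set0.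
move=> _ _ [p Sp ->] [q Sq ->]; exists (p - q); last by rewrite hornerD hornerN.
by move=> i; rewrite coefB; apply: SB.
Qed.
Lemma adjoin_gen S z : subring_set S -> adjoin S z z.
Proof.
move=> rS; exists 'X; last by rewrite hornerX.
by move=> i; rewrite coefX; case: eqP => _; [case: rS | exact: subring_set0].
Qed.

(** If 1 is in the extensions of [m] both by [z] and by its inverse, the
    relation of larger degree can be shortened with the help of the other. *)
Lemma adjoin_inv S m z : subring_set S -> ideal_set S m -> (m `<=` S)%classic -> ~ m 1 ->
  z != 0 -> adjoin m z 1 -> adjoin m z^-1 1 -> False.
Proof.
move=> rS im mS m1; have [m0 mD mM] := im; have [S1 SB SM] := rS.
suff main N z' p q : z' != 0 -> (size p + size q <= N)%N -> (size q <= size p)%N ->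
    coefs_in m p -> coefs_in m q -> p.[z'] = 1 -> q.[z'^-1] = 1 -> False.
  move=> z0 [p mp /esym pz] [q mq /esym qz].
  have [le|/ltnW le] := leqP (size q) (size p).
    exact: (main _ z p q z0 (leqnn _)).
  by apply: (main _ z^-1 q p _ (leqnn _)); rewrite ?invr_eq0 ?invrK.
elim: N z' p q => [|N IH] z' p q z0 sN le mp mq pz qz.
  move: sN; rewrite leqn0 addn_eq0 size_poly_eq0 => /andP[/eqP p0 _].
  by move: pz; rewrite p0 horner0 => /esym/eqP; rewrite oner_eq0.
have [/size1_polyC pE|p1] := leqP (size p) 1.
  by apply: m1; rewrite -pz pE hornerC.
set n := (size p).-1; have nE : size p = n.+1 by rewrite /n prednK // ltnW.
have n0 : (0 < n)%N by rewrite -ltnS -nE.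
pose a := p`_n; pose c := 1 - q`_0.
have Sc : S c by apply: SB => //; apply: mS.
pose r := \sum_(1 <= j < n.+1) q`_j *: 'X^(n - j).
have mX e b : m b -> coefs_in m (b *: 'X^e).
  by move=> mb i; rewrite coefZ coefXn; case: eqP => _; rewrite ?mulr1 ?mulr0.
have sumP (s : seq nat) (G : nat -> {poly F}) :
    (forall j, coefs_in m (G j)) -> coefs_in m (\sum_(j <- s) G j).
  move=> mG; apply: (big_ind (coefs_in m)) => //.
    by move=> i; rewrite coef0.
  by move=> ? ?; apply: (coefs_inD im).
have mr : coefs_in m r by apply: sumP => j; apply: mX.
have rz : r.[z'] = z' ^+ n * c.
  have -> : c = \sum_(1 <= j < n.+1) q`_j * z'^-1 ^+ j.
    rewrite /c -qz (horner_coef_wide _ (_ : size q <= n.+1)%N); last by rewrite -nE.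
    by rewrite -(big_mkord xpredT (fun j => q`_j * z'^-1 ^+ j)) big_ltn //= expr0 mulr1 addrC addKr.
  rewrite /r horner_sum mulr_sumr big_nat [RHS]big_nat; apply: eq_bigr => j /andP[_ jn].
  rewrite hornerZ hornerXn mulrCA; congr (_ * _).
  by rewrite exprVn expfB_cond // (negbTE z0).
(* Multiply the relation of [p] by [c] and replace the leading power by means of the
   relation of [q], multiplied by the [n]-th power of [z']: the degree drops. *)
pose p' := c *: (p - a *: 'X^n) + (q`_0)%:P + a *: r.
have mp0 : coefs_in m (p - a *: 'X^n).
  apply: (coefs_inD im mp); rewrite -scaleNr; apply: mX.
  by rewrite -mulN1r; apply: mM; [apply: subring_setN|exact: mp].
have mp' : coefs_in m p'.
  apply: (coefs_inD im); first apply: (coefs_inD im).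
  - exact: (coefs_inZ im Sc mp0).
  - exact: (coefs_inC m0 (mq 0%N)).
  - exact: (coefs_inZ im (mS _ (mp n)) mr).
have sp' : (size p' <= n)%N.
  rewrite (leq_trans (size_polyD _ _)) // geq_max; apply/andP; split.
    rewrite (leq_trans (size_polyD _ _)) // geq_max; apply/andP; split.
      apply: leq_trans (size_scale_leq _ _) _; apply/leq_sizeP => j nj.
      rewrite coefB coefZ coefXn; case: eqP => [->|/eqP jn]; first by rewrite mulr1 subrr.
      by rewrite mulr0 subr0 nth_default // nE ltn_neqAle eq_sym jn.
    exact: leq_trans (size_polyC_leq1 _) n0.
  apply: leq_trans (size_scale_leq _ _) _; apply/leq_sizeP => l nl.
  rewrite coef_sum big_nat big1 // => j /andP[j0 _]; rewrite coefZ coefXn.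
  by rewrite gtn_eqF ?mulr0 // (leq_trans _ nl) // ltn_subrL j0.
have p'z : p'.[z'] = 1.
  rewrite /p' !(hornerD, hornerZ, hornerN, hornerC, hornerXn) rz pz /c; ring.
have [le'|/ltnW le'] := leqP (size q) (size p').
  by apply: (IH z' p' q) => //; rewrite -ltnS (leq_trans _ sN) // nE addSn ltnS leq_add2r.
apply: (IH z'^-1 q p'); rewrite ?invr_eq0 ?invrK //.
by rewrite -ltnS (leq_trans _ sN) // nE addSn ltnS addnC leq_add2r.
Qed.

Record valring V : Prop := Valring {
  val_subring : subring_set V;
  val_total : forall x, V x \/ V x^-1 }.

(** The maximal ideal of a valuation ring; 0 is listed apart since its inverse is 0. *)
Definition vmax V : set F := [set x | x = 0 \/ ~ V x^-1]%classic.

(** Chevalley's extension theorem. A maximal pair of a ring and a proper ideal of it,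
    ordered by inclusion of both, is a valuation ring with its maximal ideal: by
    [adjoin_inv] the pair can be extended by any element or by its inverse. *)
Lemma chevalley S m : subring_set S -> ideal_set S m -> (m `<=` S)%classic -> ~ m 1 ->
  exists V, [/\ valring V, (S `<=` V)%classic & (m `<=` vmax V)%classic].
Proof.
move=> rS im mS m1.
(* A pair of subsets of [F] is a single subset of [F * bool], as Zorn's lemma is stated
   for sets ordered by inclusion. *)
pose ring_of (A : set (F * bool)) : set F := [set x | A (x, true)]%classic.
pose ideal_of (A : set (F * bool)) : set F := [set x | A (x, false)]%classic.
pose good (A : set (F * bool)) := [/\ subring_set (ring_of A), ideal_set (ring_of A) (ideal_of A),
  (ideal_of A `<=` ring_of A)%classic, ~ ideal_of A 1 &
  (S `<=` ring_of A)%classic /\ (m `<=` ideal_of A)%classic].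
pose mk (V n : set F) : set (F * bool) := [set x | if x.2 then V x.1 else n x.1]%classic.
have good0 : good (mk S m) by split=> //; split.
have [A [gA Amax]] : exists A, (A = set0 \/ good A) /\
    forall B, (A `<` B)%classic -> ~ (B = set0 \/ good B).
  apply: Zorn_bigcup => C CP tC.
  have [nC|] := pselect (exists2 A, C A & good A); last first.
    move=> none; left; rewrite -subset0 => x [A CA Ax].
    have [A0|gA] := CP A CA; first by rewrite A0 in Ax.
    by case: none; exists A.
  right; have two (s t : F * bool) :
      (\bigcup_(X in C) X)%classic s -> (\bigcup_(X in C) X)%classic t ->
      exists A, [/\ C A, good A, A s & A t].
    move=> [A CA Ax] [B CB By].
    have gA : good A by case: (CP A CA) => // A0; rewrite A0 in Ax.
    have gB : good B by case: (CP B CB) => // B0; rewrite B0 in By.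
    have [AB|BA] := tC A B CA CB.
      by exists B; split=> //; apply: AB.
    by exists A; split=> //; apply: BA.
  have [A0 CA0 gA0] := nC; split.
  - split; first by exists A0 => //; case: gA0 => [[]].
      move=> x y Ux Uy; have [A [CA gA Ax Ay]] := two _ _ Ux Uy.
      by exists A => //; case: gA => [[_ rB _] _ _ _ _]; apply: rB.
    move=> x y Ux Uy; have [A [CA gA Ax Ay]] := two _ _ Ux Uy.
    by exists A => //; case: gA => [[_ _ rM] _ _ _ _]; apply: rM.
  - split; first by exists A0 => //; case: gA0 => _ [].
      move=> x y Ux Uy; have [A [CA gA Ax Ay]] := two _ _ Ux Uy.
      by exists A => //; case: gA => [_ [_ iD _] _ _ _]; apply: iD.
    move=> x y Ux Uy; have [A [CA gA Ax Ay]] := two _ _ Ux Uy.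
    by exists A => //; case: gA => [_ [_ _ iM] _ _ _]; apply: iM.
  - move=> x [A CA Ax]; exists A => //.
    by have [A0'|[_ _ + _ _]] := CP A CA; [rewrite A0' in Ax | apply].
  - move=> [A CA Ax]; have [A0'|[_ _ _ + _]] := CP A CA; first by rewrite A0' in Ax.
    exact.
  - case: gA0 => _ _ _ _ [SA mA].
    by split=> x; [move/SA | move/mA] => Ax; exists A0.
have {gA} [rA iA sA nA [SA mA]] : good A.
  case: gA => // A0; exfalso; apply: (Amax (mk S m)); last by right.
  by rewrite A0; split=> // /(_ (1, true)); apply; case: rS.
exists (ring_of A); split; [|exact: SA|]; last first.
  move=> x /mA Ax; have [x0|x0] := eqVneq x 0; first by left.
  right=> Vx; apply: nA; rewrite -(mulVf x0); by case: iA => _ _ iM; exact: (iM _ _ Vx Ax).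
split=> // z; have [->|z0] := eqVneq z 0; first by left; apply: subring_set0.
have grow y : ~ ring_of A y -> adjoin (ideal_of A) y 1.
  move=> nVy; apply: contrapT => n1; pose B := mk (adjoin (ring_of A) y) (adjoin (ideal_of A) y).
  apply: (Amax B).
    split; last first.
      by move=> BA; apply: nVy; apply: (BA (y, true)); apply: (adjoin_gen y rA).
    have h1 := @adjoin_sub (ring_of A) y (subring_set0 rA).
    have i0 : ideal_of A 0 by case: iA.
    by have h2 := @adjoin_sub (ideal_of A) y i0; move=> [x []] Ax; [apply: h1|apply: h2].
  right; split.
  - exact: (adjoin_subring y rA).
  - exact: (adjoin_ideal y iA).
  - by move=> x [p mp /= xE]; exists p => // i; apply: sA.
  - exact: n1.
  - split=> x; [move/SA|move/mA] => Ax; apply: adjoin_sub => //.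
      exact: subring_set0.
    by case: iA.
have [Vz|nVz] := pselect (ring_of A z); first by left.
right; apply: contrapT => nVz'.
exact: (adjoin_inv rA iA sA nA z0 (grow _ nVz) (grow _ nVz')).
Qed.

End Valuation.

Section ValuationTheory.
Variable F : fieldType.
Implicit Types (S V m O : set F) (x y z : F) (p q : {poly F}).

Section Valring.
Variable V : set F.
Hypothesis vV : valring V.
Let rV := val_subring vV.
Let V1 : V 1. Proof. by case: rV. Qed.
Let VM x y : V x -> V y -> V (x * y). Proof. by case: rV => _ _; apply. Qed.

Lemma vmax0 : vmax V 0. Proof. by left. Qed.
Lemma vmax_sub x : vmax V x -> V x.
Proof.
case=> [->|nV]; first exact: subring_set0.
by case: (val_total vV x).
Qed.
Lemma vmax1 : ~ vmax V 1.
Proof. by case=> [/eqP|]; [rewrite oner_eq0 | rewrite invr1; apply]. Qed.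
Lemma vmaxM x y : V x -> vmax V y -> vmax V (x * y).
Proof.
move=> Vx [->|nV]; first by rewrite mulr0; left.
have [->|x0] := eqVneq x 0; first by rewrite mul0r; left.
right; rewrite invfM => Vxy; apply: nV.
by rewrite -[_^-1](mulVKf x0); apply: VM.
Qed.
Lemma vmaxD x y : vmax V x -> vmax V y -> vmax V (x + y).
Proof.
have half a b : a != 0 -> vmax V a -> vmax V b -> V (b / a) -> vmax V (a + b).
  move=> a0 ma mb Vba; have -> : a + b = (1 + b / a) * a by field.
  by apply: vmaxM => //; apply: subring_setD.
move=> mx my; have [x0|x0] := eqVneq x 0; first by rewrite x0 add0r.
have [y0|y0] := eqVneq y 0; first by rewrite y0 addr0.
have [Vyx|] := val_total vV (y / x); first exact: half.
by rewrite invfM invrK mulrC => Vxy; rewrite addrC; apply: half.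
Qed.
Lemma vmaxN x : vmax V x -> vmax V (- x).
Proof. by rewrite -mulN1r; apply: vmaxM; apply: subring_setN. Qed.
Lemma vmax_sum (J : eqType) (s : seq J) (P : pred J) (G : J -> F) :
  (forall j, j \in s -> P j -> vmax V (G j)) -> vmax V (\sum_(j <- s | P j) G j).
Proof.
move=> mG; rewrite big_seq_cond; apply: (big_ind (vmax V)).
- exact: vmax0.
- exact: vmaxD.
- by move=> j /andP[]; apply: mG.
Qed.
Lemma vmaxX x j : vmax V (x ^+ j) -> vmax V x.
Proof.
move=> mx; have [->|x0] := eqVneq x 0; first by left.
right=> Vx; apply: vmax1; rewrite -(mulVf (expf_neq0 j x0)) -exprVn.
by apply: vmaxM => //; apply: subring_setX.
Qed.

Definition vunit x := [/\ x != 0, V x & V x^-1].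

Lemma vunit1 : vunit 1.
Proof. by split; rewrite ?oner_eq0 ?invr1. Qed.
Lemma vunitM x y : vunit x -> vunit y -> vunit (x * y).
Proof.
by move=> [x0 Vx Vx'] [y0 Vy Vy']; split; rewrite ?mulf_neq0 ?invfM //; apply: VM.
Qed.
Lemma vunitV x : vunit x -> vunit x^-1.
Proof. by move=> [x0 Vx Vx']; split; rewrite ?invr_eq0 ?invrK. Qed.
Lemma vunitX x j : vunit x -> vunit (x ^+ j).
Proof.
by move=> ux; elim: j => [|j IH]; rewrite ?expr0 ?exprS; [exact: vunit1|apply: vunitM].
Qed.
Lemma vunit_notmax x : vunit x -> ~ vmax V x.
Proof. by move=> [/eqP x0 _ Vx'] []. Qed.
Lemma not_vmax x : ~ vmax V x -> x != 0 /\ V x^-1.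
Proof.
move=> nm; split; first by apply/eqP => x0; apply: nm; left.
by apply: contrapT => nV; apply: nm; right.
Qed.
Lemma vunit_sub x : V x -> ~ vmax V x -> vunit x.
Proof. by move=> Vx /not_vmax[]. Qed.

(** In a vanishing sum two terms have the same, minimal, value: otherwise dividing by
    the term of minimal value would express 1 in the maximal ideal. *)
Lemma min_attained_twice (T : eqType) (s : seq T) (t : T -> F) : uniq s -> s != [::] ->
  (forall l, l \in s -> t l != 0) -> \sum_(l <- s) t l = 0 ->
  exists l l', [/\ l \in s, l' \in s, l != l' & vunit (t l / t l')].
Proof.
move=> us s0 t0 st0.
have [l0 l0s l0min] : exists2 l0, l0 \in s & forall l, l \in s -> V (t l / t l0).
  elim: s s0 t0 {us st0} => // l s IH _ t0.
  have tl : t l != 0 by apply: t0; rewrite mem_head.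
  have [s0|s0] := eqVneq s [::].
    by exists l; rewrite s0 ?mem_head // => x; rewrite inE => /eqP ->; rewrite divff.
  have [||l1 l1s l1min] := IH => // [x xs|]; first by apply: t0; rewrite inE xs orbT.
  have tl1 : t l1 != 0 by apply: t0; rewrite inE l1s orbT.
  have [Vl|Vl] := val_total vV (t l / t l1).
    exists l1; first by rewrite inE l1s orbT.
    by move=> x; rewrite inE => /orP[/eqP ->//|]; apply: l1min.
  exists l; first exact: mem_head.
  move=> x; rewrite inE => /orP[/eqP ->|xs]; first by rewrite divff.
  have -> : t x / t l = (t x / t l1) * (t l / t l1)^-1.
    by field; rewrite ?tl ?tl1.
  by apply: VM => //; apply: l1min.
apply: contrapT => nex; apply: vmax1.
have -> : 1 = - \sum_(l <- s | l != l0) t l / t l0.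
  apply/eqP; rewrite -addr_eq0 -[X in X + _](divff (t0 _ l0s)).
  by rewrite -(bigD1_seq l0) //= -mulr_suml st0 mul0r.
apply: vmaxN; apply: vmax_sum => l ls ll0.
apply: contrapT => nm; apply: nex; exists l, l0; split=> //.
by apply: vunit_sub => //; apply: l0min.
Qed.

End Valring.

(** Either [z] is in the maximal ideal of some valuation ring above [S] and [m], or the
    ideal generated by [m] and [z] in [S[z]] is everything; the latter yields a
    relation for [z], which is integrality of its inverse when [S] is local. *)
Lemma chevalley_adjoin (S m : set F) z : subring_set S -> ideal_set S m ->
  (m `<=` S)%classic ->
  (exists V, [/\ valring V, (S `<=` V)%classic, (m `<=` vmax V)%classic & vmax V z]) \/
  (exists p, [/\ coefs_in S p, m p`_0 & p.[z] = 1]).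
Proof.
move=> rS im mS; have [S1 SB SM] := rS; have [m0 mD mM] := im.
pose m' : set F := [set x | exists p, [/\ coefs_in S p, m p`_0 & x = p.[z]]]%classic.
have [[p [Sp mp e]]|m1] := pselect (m' 1); first by right; exists p.
left; have [||V [vV SV mV]] := @chevalley F (adjoin S z) m' (adjoin_subring z rS) _ _ m1.
- split.
  + by exists 0; split; rewrite ?horner0 ?coef0 // => i; rewrite coef0; apply: subring_set0.
  + move=> _ _ [p [Sp mp ->]] [q [Sq mq ->]]; exists (p + q).
    split; rewrite ?hornerD ?coefD //; last exact: mD.
    exact: (coefs_inD (subring_ideal rS)).
  + move=> _ _ [p Sp ->] [q [Sq mq ->]]; exists (p * q).
    split; rewrite ?hornerM // ?coefM ?big_ord1; last exact: mM.
    exact: (coefs_inM (subring_ideal rS)).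
- by move=> x [p [Sp _ ->]]; exists p.
exists V; split=> //.
- by apply: subset_trans SV; apply: adjoin_sub; apply: subring_set0.
- apply: subset_trans mV => x mx; exists x%:P; split; rewrite ?hornerC ?coefC //.
  by apply: coefs_inC; [exact: subring_set0 | exact: mS].
- apply: mV; exists 'X; split; rewrite ?hornerX ?coefX //.
  by move=> i; rewrite coefX; case: eqP => // _; apply: subring_set0.
Qed.

Section Nakayama.
Variables (O m : set F).
Hypotheses (rO : subring_set O) (im : ideal_set O m) (mO : (m `<=` O)%classic).
Hypothesis local : forall a, m a -> 1 - a != 0 /\ O (1 - a)^-1.

Let O0 := subring_set0 rO.
Let OM x y : O x -> O y -> O (x * y). Proof. by case: rO => _ _; apply. Qed.
Let O1 : O 1. Proof. by case: rO. Qed.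

Definition integral_over z :=
  exists (N : nat) (o : nat -> F), (forall l, O (o l)) /\ z ^+ N = \sum_(l < N) o l * z ^+ l.

Definition span_set (T : seq F) : set F :=
  [set x | exists2 c : nat -> F, forall i, O (c i) & x = \sum_(i < size T) c i * T`_i]%classic.

Lemma span_set_in T t : t \in T -> span_set T t.
Proof.
move=> tT; exists (fun i => (i == index t T)%:R) => [i|]; first by case: eqP.
have it : (index t T < size T)%N by rewrite index_mem.
rewrite (bigD1 (Ordinal it)) //= eqxx mul1r nth_index // big1 ?addr0 // => i ne.
by rewrite (_ : (_ == _) = false) ?mul0r //; apply/negbTE; move: ne; rewrite -val_eqE.
Qed.
Lemma span_setD T x y : span_set T x -> span_set T y -> span_set T (x + y).
Proof.
move=> [c Oc ->] [c' Oc' ->]; exists (fun i => c i + c' i).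
  by move=> i; apply: subring_setD.
by rewrite -big_split /=; apply: eq_bigr => i _; rewrite mulrDl.
Qed.
Lemma span_setZ T a x : O a -> span_set T x -> span_set T (a * x).
Proof.
move=> Oa [c Oc ->]; exists (fun i => a * c i); first by move=> i; apply: OM.
by rewrite big_distrr /=; apply: eq_bigr => i _; rewrite mulrA.
Qed.
Lemma span_set_sum T (J : eqType) (s : seq J) (G : J -> F) :
  (forall j, j \in s -> span_set T (G j)) -> span_set T (\sum_(j <- s) G j).
Proof.
move=> sG; rewrite big_seq; apply: (big_ind (span_set T)) => //.
- by exists (fun=> 0) => //; rewrite big1 // => i _; rewrite mul0r.
- exact: span_setD.
Qed.

(** Finitely many integral elements generate a finite module: the products of the
    powers of each below its degree span it, and they belong to every multiplicative
    set that contains the elements. *)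
Lemma integral_span (zs : seq F) : (forall z, z \in zs -> integral_over z) ->
  exists T : seq F, [/\ 1 \in T, forall z t, z \in zs -> t \in T -> span_set T (z * t) &
    forall P : set F, P 1 -> (forall x y, P x -> P y -> P (x * y)) ->
      (forall z, z \in zs -> P z) -> forall t, t \in T -> P t].
Proof.
elim: zs => [|z zs IH] izs.
  by exists [:: 1]; split=> [|//|P P1 _ _ t]; rewrite inE // => /eqP ->.
have [|T [T1 Tz TP]] := IH; first by move=> x xz; apply: izs; rewrite inE xz orbT.
have [|N [o [Oo zN]]] := izs z; first exact: mem_head.
have N0 : (0 < N)%N.
  by case: N zN => // /eqP; rewrite expr0 big_ord0 oner_eq0.
pose T2 := [seq z ^+ l * t | l <- iota 0 N, t <- T].
have T2in l t : (l < N)%N -> t \in T -> z ^+ l * t \in T2.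
  by move=> lN tT; apply: allpairs_f; rewrite ?mem_iota.
have span_pow l x : (l < N)%N -> span_set T x -> span_set T2 (z ^+ l * x).
  move=> lN [c Oc ->]; rewrite big_distrr /= -(big_mkord xpredT (fun i => z ^+ l * (c i * T`_i))).
  apply: span_set_sum => i; rewrite mem_index_iota => iT.
  by rewrite mulrCA; apply: span_setZ => //; apply/span_set_in/T2in/mem_nth.
exists T2; split.
- by rewrite -[1](mulr1 1) -[X in X * _](expr0 z); apply: T2in.
- move=> x _ + /allpairsP[[l t] /= [+ tT ->]]; rewrite mem_iota add0n => xz /andP[_ lN].
  move: xz; rewrite inE => /orP[/eqP ->|xz]; last first.
    by rewrite mulrCA; apply: span_pow => //; apply: Tz.
  rewrite mulrA -exprS; move: lN; rewrite leq_eqVlt => /orP[/eqP lN|lN].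
    rewrite lN zN mulr_suml -(big_mkord xpredT (fun i => o i * z ^+ i * t)).
    apply: span_set_sum => i; rewrite mem_index_iota => iN.
    by rewrite -mulrA; apply: span_setZ => //; apply/span_set_in/T2in.
  by apply/span_set_in/T2in.
move=> P P1 PM Pz _ /allpairsP[[l t] /= [_ tT ->]]; apply: (PM _ _).
  have Pz0 : P z by apply: Pz; rewrite mem_head.
  by elim: l => [|l IHl]; rewrite ?expr0 ?exprS //; apply: (PM _ _).
by apply: TP tT => // x xz; apply: Pz; rewrite inE xz orbT.
Qed.

Lemma prod_1m (J : eqType) (s : seq J) (P : pred J) (G : J -> F) :
  (forall j, j \in s -> P j -> m (1 - G j)) -> m (1 - \prod_(j <- s | P j) G j).
Proof.
have [m0 mD mM] := im; move=> mG; rewrite big_seq_cond.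
apply: (big_ind (fun x => m (1 - x))) => [|x y mx my|j /andP[]].
- by rewrite subrr.
- have -> : 1 - x * y = (1 - x) + x * (1 - y) by ring.
  apply: mD => //; apply: mM => //; rewrite -[x](subKr 1).
  by case: rO => _ OB _; apply: OB => //; apply: mO.
- exact: mG.
Qed.

(** A matrix that is congruent to the identity has a determinant congruent to 1. *)
Lemma det_1m r (A : 'M[F]_r) : (forall i j, m ((i == j)%:R - A i j)) -> m (1 - \det A).
Proof.
have [m0 mD mM] := im; move=> mA.
have OA i j : O (A i j).
  rewrite -[A i j](subKr (i == j)%:R); case: rO => _ OB _; apply: OB; last exact: mO.
  by case: eqP.
have Oprod (s : seq 'I_r) (P : pred 'I_r) (G : 'I_r -> F) :
    (forall j, O (G j)) -> O (\prod_(j <- s | P j) G j).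
  by move=> OG; apply: (big_ind O).
rewrite /determinant (bigD1 (1%g : {perm 'I_r})) //= opprD addrA; apply: (mD _ _).
  rewrite odd_perm1 expr0 mul1r; apply: prod_1m => i _ _.
  by rewrite perm1; have := mA i i; rewrite eqxx.
rewrite -sumrN; apply: (ideal_set_sum im) => s _ s1.
have ON1 : O (- 1) by apply: subring_setN.
have [i si] : exists i, s i != i.
  apply/existsP; rewrite -negb_forall; apply: contra s1 => /forallP h.
  by apply/eqP/permP => i; rewrite perm1; apply/eqP/h.
rewrite (bigD1 i) //=; set x := (_ ^+ _ * _); rewrite -[- x]mulN1r; apply: (mM _ _ ON1).
apply: (mM _ _); first exact: subring_setX.
rewrite mulrC; apply: (mM _ _); first exact: Oprod.
have := mA i (s i); rewrite eq_sym (negbTE si) sub0r => mN.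
by have := mM _ _ ON1 mN; rewrite mulN1r opprK.
Qed.

(** Nakayama's lemma for the algebra [O[P]], where the multiplicative set [P] is
    generated by finitely many integral elements [zs]. If every element of [P] is in
    [O] modulo [m P], then the finitely many generators of the module satisfy a linear
    system over [O] whose matrix is the identity modulo [m]; its determinant is a unit
    and Cramer's rule puts the generators into [O]. *)
Lemma nakayama (zs : seq F) (P : set F) :
  (forall z, z \in zs -> integral_over z) ->
  P 1 -> (forall x y, P x -> P y -> P (x * y)) -> (forall z, z \in zs -> P z) ->
  (forall Q : set F, Q 1 -> (forall z x, z \in zs -> Q x -> Q (z * x)) -> (P `<=` Q)%classic) ->
  (forall y, P y -> exists o (J : seq (F * F)),
    [/\ O o, forall e, e \in J -> m e.1 /\ P e.2 & y = o + \sum_(e <- J) e.1 * e.2]) ->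
  (P `<=` O)%classic.
Proof.
have [m0 mD mM] := im; move=> izs P1 PM Pz Pmin Pm.
have [T [T1 Tz TP]] := integral_span izs.
have {}TP t : t \in T -> P t by apply: TP.
have PT : (P `<=` span_set T)%classic.
  apply: Pmin; first exact: span_set_in.
  move=> z x zz [c Oc ->]; rewrite big_distrr /= -(big_mkord xpredT (fun i => z * (c i * T`_i))).
  apply: span_set_sum => i; rewrite mem_index_iota => iT.
  by rewrite mulrCA; apply: span_setZ => //; apply: Tz => //; apply: mem_nth.
have row_of (i : 'I_(size T)) : exists oc : F * (nat -> F),
    [/\ O oc.1, forall j, m (oc.2 j) & T`_i = oc.1 + \sum_(j < size T) oc.2 j * T`_j].
  have [o [J [Oo mJ tE]]] := Pm _ (TP _ (mem_nth 0 (ltn_ord i))).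
  suff [c mc cE] : exists2 c : nat -> F, forall j, m (c j) &
      \sum_(e <- J) e.1 * e.2 = \sum_(j < size T) c j * T`_j.
    by exists (o, c); split; rewrite //= -cE.
  elim: J mJ {tE} => [|a J IH] mJ.
    by exists (fun=> 0) => //; rewrite big_nil big1 // => j _; rewrite mul0r.
  have [|c mc cE] := IH; first by move=> a' aJ; apply: mJ; rewrite inE aJ orbT.
  have [ma Pa] := mJ a (mem_head _ _); have [e Oe eE] := PT _ Pa.
  exists (fun j => c j + e j * a.1); first by move=> j; apply: mD => //; apply: mM.
  rewrite big_cons cE eE big_distrr /= addrC -big_split /=; apply: eq_bigr => j _; ring.
have [oc ocP] := choice row_of.
pose A := \matrix_(i, j) ((i == j)%:R - (oc i).2 j) : 'M[F]_(size T).
pose t := \col_i T`_i : 'cV[F]_(size T).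
have At : A *m t = \col_i (oc i).1.
  apply/colP => i; rewrite !mxE; have [_ _ e] := ocP i.
  transitivity (T`_i - \sum_(j < size T) (oc i).2 j * T`_j); last by rewrite {1}e addrK.
  rewrite (bigD1 i) //= [in RHS](bigD1 i) //= !mxE eqxx mulrBl mul1r opprD addrA.
  congr (_ + _); rewrite -sumrN; apply: eq_bigr => j ji.
  by rewrite !mxE eq_sym (negbTE ji) sub0r mulNr.
have mA i j : m ((i == j)%:R - A i j) by rewrite mxE subKr; have [] := ocP i.
have OA i j : O (A i j).
  rewrite -[A i j](subKr (i == j)%:R); case: rO => _ OB _; apply: OB; last exact: mO.
  by case: eqP.
have OA' i j : O ((i == j)%:R - (oc i).2 j) by have := OA i j; rewrite mxE.
have [] := local (det_1m mA); rewrite subKr => detA OdetV.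
have OT (i : 'I_(size T)) : O T`_i.
  have : \adj A *m (A *m t) = (\det A) *: t by rewrite mulmxA mul_adj_mx mul_scalar_mx.
  move/colP/(_ i); rewrite At !mxE => e.
  have -> : T`_i = (\det A)^-1 * (\det A * T`_i) by rewrite mulKf.
  rewrite -e; apply: OM => //; apply: subring_set_sum => // j _ _.
  rewrite !mxE; apply: OM; last by have [] := ocP j.
  rewrite /cofactor; apply: OM; first by apply: subring_setX => //; apply: subring_setN.
  rewrite /determinant; apply: subring_set_sum => // s _ _; apply: OM.
    by apply: subring_setX => //; apply: subring_setN.
  by apply: (big_ind O) => // l _; rewrite !mxE; exact: OA'.
by move=> y /PT[c Oc ->]; apply: subring_set_sum => // i _ _; apply: OM.
Qed.

End Nakayama.
End ValuationTheory.

(** * Valuation rings and tropical points *)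

(** The values at the generic point [phi] of the characters and of the constants. They
    are locked to prevent the comparison of monomials by computation. *)
HB.lock Definition chi (k : fieldType) (n : nat) (F : fieldType)
  (phi : {rmorphism laurent k n -> F}) u := phi (monomial 1 u).
HB.lock Definition kap (k : fieldType) (n : nat) (F : fieldType)
  (phi : {rmorphism laurent k n -> F}) c := phi (monomial c 0).

Section Characters.
Variables (k : fieldType) (n : nat) (F : fieldType) (phi : {rmorphism laurent k n -> F}).
Implicit Types (u : 'rV[int]_n) (c : k) (f : laurent k n).

Notation chi := (chi phi).
Notation kap := (kap phi).

Lemma chiE u : chi u = phi (monomial 1 u). Proof. by rewrite unlock. Qed.
Lemma kapE c : kap c = phi (monomial c 0). Proof. by rewrite unlock. Qed.

Lemma phi_monomial c u : phi (monomial c u) = kap c * chi u.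
Proof. by rewrite kapE chiE -rmorphM monomialM mulr1 add0r. Qed.
Lemma chi0 : chi 0 = 1. Proof. rewrite chiE; exact: rmorph1. Qed.
Lemma chiD u v : chi (u + v) = chi u * chi v.
Proof. by rewrite !chiE -rmorphM monomialM mulr1. Qed.
Lemma chi_neq0 u : chi u != 0.
Proof.
apply/negP => /eqP u0; have := chiD u (- u).
by rewrite subrr chi0 u0 mul0r => /eqP; rewrite oner_eq0.
Qed.
Lemma chiN u : chi (- u) = (chi u)^-1.
Proof. by apply: (mulfI (chi_neq0 u)); rewrite -chiD subrr chi0 divff ?chi_neq0. Qed.
Lemma chiB u v : chi (u - v) = chi u / chi v.
Proof. by rewrite chiD chiN. Qed.
Lemma chiMn u j : chi (u *+ j) = chi u ^+ j.
Proof. by elim: j => [|j IH]; rewrite ?mulr0n ?chi0 // mulrS chiD IH exprS. Qed.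
Lemma kap0 : kap 0 = 0. Proof. by rewrite kapE monomial0 rmorph0. Qed.
Lemma kap1 : kap 1 = 1. Proof. rewrite kapE; exact: rmorph1. Qed.
Lemma kapD c c' : kap (c + c') = kap c + kap c'.
Proof. by rewrite !kapE monomialD rmorphD. Qed.
Lemma kapN c : kap (- c) = - kap c.
Proof. by rewrite !kapE monomialN rmorphN. Qed.
Lemma kapM c c' : kap (c * c') = kap c * kap c'.
Proof. by rewrite !kapE -rmorphM monomialM addr0. Qed.
Lemma kapV c : c != 0 -> kap c^-1 * kap c = 1.
Proof. by move=> c0; rewrite -kapM mulVf ?kap1. Qed.
Lemma kap_neq0 c : c != 0 -> kap c != 0.
Proof.
by move=> c0; apply/eqP => e; have := kapV c0; rewrite e mulr0 => /esym/eqP; rewrite oner_eq0.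
Qed.
Lemma phiE f : phi f = \sum_(u <- supp f) kap (coef f u) * chi u.
Proof.
by rewrite [in LHS](galgE f) rmorph_sum; apply: eq_bigr => u _; rewrite phi_monomial.
Qed.

(** Exponents of the monomials in the coordinates indexed by [Q]. *)
Definition lattice_on (Q : {set 'I_n}) : set 'rV[int]_n :=
  [set u | forall j, j \notin Q -> u 0 j = 0]%classic.

Lemma lattice_on0 Q : lattice_on Q 0.
Proof. by move=> j _; rewrite mxE. Qed.
Lemma lattice_onD Q u v : lattice_on Q u -> lattice_on Q v -> lattice_on Q (u + v).
Proof. by move=> hu hv j jQ; rewrite mxE hu ?hv ?addr0. Qed.
Lemma lattice_onN Q u : lattice_on Q u -> lattice_on Q (- u).
Proof. by move=> hu j jQ; rewrite mxE hu ?oppr0. Qed.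
Lemma lattice_onB Q u v : lattice_on Q u -> lattice_on Q v -> lattice_on Q (u - v).
Proof. by move=> hu hv; apply: lattice_onD => //; apply: lattice_onN. Qed.
Lemma lattice_onZ Q u z : lattice_on Q u -> lattice_on Q (z *: u).
Proof. by move=> hu j jQ; rewrite mxE hu ?mulr0. Qed.
Lemma lattice_onMn Q u N : lattice_on Q u -> lattice_on Q (u *+ N).
Proof. by rewrite -scaler_nat; apply: lattice_onZ. Qed.
Lemma lattice_on_delta (Q : {set 'I_n}) j : j \in Q -> lattice_on Q (delta_mx 0 j).
Proof.
by move=> jQ i iQ; rewrite mxE eqxx /=; case: eqP => // e; rewrite e jQ in iQ.
Qed.

Lemma int_nat_cases (z : int) : exists m : nat, z = m%:Z \/ z = - m%:Z.
Proof. by case: z => m; [exists m; left | exists m.+1; right]. Qed.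

(** A valuation ring over the monomial valuation of weight [v] on the field generated
    by the coordinates in [Q] has a real center, although its value group need not be
    archimedean, provided that the remaining coordinates are algebraic over that field:
    two terms of an algebraic relation of y_j have the same value, so that a power of
    y_j is a unit times a monomial in the coordinates of [Q]. *)
Lemma valring_center (R : realType) (V : set F) (Q : {set 'I_n}) (v : 'rV[R]_n) :
  valring V -> (forall c, V (kap c)) ->
  (forall u, lattice_on Q u -> 0 < pairing u v -> vmax V (chi u)) ->
  (forall u, lattice_on Q u -> pairing u v = 0 -> u = 0) ->
  (forall j, j \notin Q ->
     exists f, [/\ f != 0, suppin (lattice_on (j |: Q)) f & phi f = 0]) ->
  exists w : 'rV[R]_n, [/\ forall j, j \in Q -> w 0 j = v 0 j,
    forall u, 0 <= pairing u w -> V (chi u) &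
    forall u, 0 < pairing u w -> vmax V (chi u)].
Proof.
move=> vV Vk Vm Qind Qalg.
have coord j : exists Nb : nat * 'rV[int]_n, [/\ (0 < Nb.1)%N, lattice_on Q Nb.2,
    vunit V (chi (delta_mx 0 j *+ Nb.1 - Nb.2)) & j \in Q -> Nb = (1%N, delta_mx 0 j)].
  have [jQ|jQ] := boolP (j \in Q).
    exists (1%N, delta_mx 0 j); split=> //=; first exact: lattice_on_delta.
    by rewrite mulr1n subrr chi0; apply: vunit1.
  have [f [f0 fQ phif]] := Qalg j jQ.
  have [||||l [l' [lf l'f ll' ul]]] :=
      min_attained_twice vV (s := supp f) (t := fun u => kap (coef f u) * chi u).
  - exact: fset_uniq.
  - apply: contraNneq f0 => s0; apply/eqP/galgP => u; rewrite gcoef0; apply/eqP.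
    by have := mem_supp f u; rewrite -[u \in supp f]/(u \in (supp f : seq _)) s0 => /esym/negbFE.
  - move=> u us; apply: mulf_neq0; last exact: chi_neq0.
    by apply: kap_neq0; rewrite -mem_supp; exact: us.
  - by rewrite -[RHS]phif phiE.
  have kunit c : c != 0 -> vunit V (kap c).
    move=> c0; split; rewrite ?kap_neq0 // -[_^-1]mul1r -(kapV c0) mulfK ?kap_neq0 //.
  have {}lf : coef f l != 0 by rewrite -mem_supp; exact: lf.
  have {}l'f : coef f l' != 0 by rewrite -mem_supp; exact: l'f.
  have {}ul : vunit V (chi (l - l')).
    have -> : chi (l - l') = (kap (coef f l))^-1 * kap (coef f l') *
        (kap (coef f l) * chi l / (kap (coef f l') * chi l')).
      rewrite chiB; move: (kap_neq0 lf) (kap_neq0 l'f) (chi_neq0 l').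
      move: (kap _) (kap _) (chi l) (chi l') => a a' x y a0 a'0 y0.
      by field; rewrite a0 a'0 y0.
    by do !apply: vunitM => //; [apply: vunitV|]; apply: kunit.
  have [e0|e0] := eqVneq ((l - l') 0 j) 0.
    have lQ : lattice_on Q (l - l').
      move=> i iQ; have [->//|ij] := eqVneq i j.
      by apply: (lattice_onB (fQ l lf) (fQ l' l'f)); rewrite finset.in_setU1 negb_or ij.
    have notmax u : vunit V (chi u) -> lattice_on Q u -> ~~ (0 < pairing u v).
      by move=> uu Qu; apply/negP => /(Vm _ Qu); apply: vunit_notmax.
    have := notmax _ ul lQ; have := notmax (- (l - l')).
    rewrite chiN pairingN oppr_gt0 => /(_ (vunitV ul) (lattice_onN lQ)).
    rewrite -!leNgt => h1 h2; move: ll'; rewrite -subr_eq0.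
    by rewrite (Qind _ lQ) ?eqxx //; apply/eqP; rewrite eq_le h1 h2.
  have mk u (N : nat) : vunit V (chi u) -> lattice_on (j |: Q) u -> u 0 j = N%:Z ->
      (0 < N)%N -> exists Nb : nat * 'rV[int]_n, [/\ (0 < Nb.1)%N, lattice_on Q Nb.2,
    vunit V (chi (delta_mx 0 j *+ Nb.1 - Nb.2)) & false -> Nb = (1%N, delta_mx 0 j)].
    move=> uu uQ uj N0; exists (N, delta_mx 0 j *+ N - u).
    split=> [|i iQ||jQ'].
    - exact: N0.
    - rewrite !mxE mulmxnE mxE eqxx /=; have [->|ij] := eqVneq i j.
        by rewrite uj -natz subrr.
      by rewrite mul0rn uQ ?subr0 // finset.in_setU1 negb_or ij.
    - by rewrite opprB [_.1]/= addrC subrK.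
    - by [].
  have lQ : lattice_on (j |: Q) (l - l') by apply: lattice_onB; apply: fQ.
  have [N [eN|eN]] := int_nat_cases ((l - l') 0 j).
    apply: (mk _ N ul lQ eN); rewrite lt0n; apply: contraNneq e0 => N0.
    by rewrite eN N0.
  apply: (mk (- (l - l')) N).
  - by rewrite chiN; apply: vunitV.
  - exact: lattice_onN.
  - by rewrite mxE eN opprK.
  by rewrite lt0n; apply: contraNneq e0 => N0; rewrite eN N0 oppr0.
(* The power of y_j and the monomial determine the weight of y_j. *)
have [Nb NbP] := choice coord.
pose w : 'rV[R]_n := \row_j (pairing (Nb j).2 v / (Nb j).1%:R).
pose good u := exists (N : nat) (be : 'rV[int]_n), [/\ (0 < N)%N, lattice_on Q be,
  vunit V (chi (u *+ N - be)) & pairing be v = N%:R * pairing u w].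
have good0 : good 0.
  exists 1%N, 0; split=> //; first exact: lattice_on0.
    by rewrite mulr1n subrr chi0; apply: vunit1.
  by rewrite !pairing0 mulr0.
have goodD u u' : good u -> good u' -> good (u + u').
  move=> [N [be [N0 bQ uu bE]]] [N' [be' [N0' bQ' uu' bE']]].
  exists (N * N')%N, (be *+ N' + be' *+ N); split.
  - by rewrite muln_gt0 N0.
  - by apply: lattice_onD; apply: lattice_onMn.
  - have -> : (u + u') *+ (N * N') - (be *+ N' + be' *+ N) =
        (u *+ N - be) *+ N' + (u' *+ N' - be') *+ N.
      by rewrite mulrnDl !mulrnBl opprD addrACA -!mulrnA [(N' * N)%N]mulnC.
    by rewrite chiD !chiMn; apply: vunitM => //; apply: vunitX.
  - by rewrite !pairingD !pairingMn bE bE' natrM; ring.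
have goodN u : good u -> good (- u).
  move=> [N [be [N0 bQ uu bE]]]; exists N, (- be); split.
  - exact: N0.
  - exact: lattice_onN.
  - by rewrite mulNrn -opprD chiN; apply: vunitV.
  - by rewrite !pairingN bE mulrN.
have good_delta j : good (delta_mx 0 j).
  have [N0 bQ uu _] := NbP j; exists (Nb j).1, (Nb j).2; split=> //.
  by rewrite pairing_delta mxE mulrC divfK // pnatr_eq0 -lt0n.
have goodP u : good u.
  rewrite (row_sum_delta u); apply: (big_ind good) => // j _.
  have goodMn N u' : good u' -> good (u' *+ N).
    by move=> gu'; elim: N => [|N IH]; rewrite ?mulr0n // mulrS; apply: goodD.
  have [N [->|->]] := int_nat_cases (u 0 j).
    by rewrite -natz scaler_nat; apply: goodMn.
  by rewrite scaleNr -natz scaler_nat; apply/goodN/goodMn.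
have pos u : 0 < pairing u w -> vmax V (chi u).
  move=> u0; have [N [be [N0 bQ uu bE]]] := goodP u.
  apply: (vmaxX vV (j := N)); rewrite -chiMn -[_ *+ _](subrK be) chiD.
  apply: (vmaxM vV); first by case: uu.
  by apply: Vm => //; rewrite bE mulr_gt0 // ltr0n.
exists w; split; last exact: pos.
- move=> j jQ; rewrite mxE; have [_ _ _ /(_ jQ) ->] := NbP j.
  by rewrite [_.1]/= [_.2]/= divr1 pairing_delta.
- move=> u; rewrite le_eqVlt => /orP[/eqP u0|/pos/(vmax_sub vV)//].
  have [N [be [N0 bQ uu bE]]] := goodP u.
  have be0 : be = 0 by apply: Qind; rewrite // bE -u0 mulr0.
  have uN : vunit V (chi u ^+ N) by rewrite -chiMn -[_ *+ _]subr0 -be0.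
  have nm : ~ vmax V (chi u)^-1.
    move=> mu; case: uN => _ VN _; suff : vmax V 1 by exact: vmax1.
    rewrite -(mulfV (expf_neq0 N (chi_neq0 u))) -exprVn; apply: (vmaxM vV) => //.
    rewrite -(prednK N0) exprS mulrC; apply: (vmaxM vV) => //.
    exact: subring_setX (val_subring vV) (vmax_sub vV mu).
  by have [_] := not_vmax nm; rewrite invrK.
Qed.

End Characters.

(** * Generic weights *)

Section Generic.
Variables (R : realType) (n : nat).
Local Open Scope classical_set_scope.
Implicit Types (v w : 'rV[R]_n) (u : 'rV[int]_n).

Lemma coord_cont (j : 'I_n) : continuous (fun v : 'rV[R]_n => v 0 j).
Proof. by move=> v; apply: coord_continuous. Qed.

Lemma sum_cont (T : topologicalType) (I : Type) (s : seq I) (f : I -> T -> R) :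
  (forall i, continuous (f i)) -> continuous (fun x => \sum_(i <- s) f i x).
Proof.
move=> fc; elim: s => [|i s IH] x.
  rewrite (_ : (fun _ => _) = (fun=> 0)); first exact: cst_continuous.
  by apply/funext => y; rewrite big_nil.
rewrite (_ : (fun _ => _) = (fun y => f i y + \sum_(i <- s) f i y)); last first.
  by apply/funext => y; rewrite big_cons.
by apply: (@continuousD _ _ _ (f i) (fun y => \sum_(i <- s) f i y)); [exact: fc|exact: IH].
Qed.

Lemma pairing_cont u : continuous (fun v : 'rV[R]_n => pairing u v).
Proof.
apply: (@sum_cont _ _ _ (fun j (v : 'rV[R]_n) => (u 0 j)%:~R * v 0 j)) => j v.
apply: (@continuousM _ _ (fun=> (u 0 j)%:~R) (fun v : 'rV[R]_n => v 0 j)).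
  exact: cst_continuous.
exact: coord_cont.
Qed.

Lemma hat_cont i : continuous (fun v : 'rV[R]_n => hat v i).
Proof.
have [[j ->]|->] : (exists j, i = lift ord0 j) \/ i = ord0.
    by case: (unliftP ord0 i) => [j ->|->]; [left; exists j|right].
  rewrite (_ : (fun _ => _) = (fun v => v 0 j)); first exact: coord_cont.
  by apply/funext => v; rewrite hat_lift.
rewrite (_ : (fun _ => _) = (fun=> 0)); first exact: cst_continuous.
by apply/funext => v; rewrite hat0.
Qed.

Lemma nonzero_pairing_open u : open [set v : 'rV[R]_n | pairing u v != 0].
Proof.
rewrite (_ : [set v | _] = (pairing u) @^-1` [set x : R | x != 0]) //.
apply: open_comp; first by move=> v _; exact: pairing_cont.
exact: open_neq.
Qed.

(** A line in a suitable coordinate direction crosses the hyperplane only once. *)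
Lemma nonzero_pairing_dense u : u != 0 -> dense [set v : 'rV[R]_n | pairing u v != 0].
Proof.
move=> u0 U [v Uv] oU.
have [j uj] : exists j, u 0 j != 0.
  apply: contra_neqP u0 => nex; apply/rowP => j; rewrite mxE; apply/eqP.
  by apply: contra_notT nex => uj; exists j.
have [pv|] := eqVneq (pairing u v) 0; last by exists v.
pose line (t : R) : 'rV[R]_n := v + t *: delta_mx 0 j.
have line_cont : continuous line.
  move=> t; apply: (@continuousD R 'rV[R]_n R (fun=> v)
    (fun t : R => t *: (delta_mx 0 j : 'rV[R]_n)) t).
    exact: cst_continuous.
  exact: scalel_continuous.
have oL : open (line @^-1` U) by apply: open_comp => // t _; exact: line_cont.
have [|t [Ut /eqP t0]] := @dense_set1C R 0 (line @^-1` U) _ oL.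
  by exists 0; rewrite /= /line scale0r addr0.
exists (line t); split=> //=; rewrite /line.
have -> : pairing u (v + t *: delta_mx 0 j) = pairing u v + t * (u 0 j)%:~R.
  rewrite /pairing [X in _ = _ + X](_ : _ = \sum_i (u 0 i)%:~R * (t *: delta_mx 0 j : 'rV[R]_n) 0 i).
    by rewrite -big_split /=; apply: eq_bigr => i _; rewrite mxE mulrDr.
  rewrite (bigD1 j) //= !mxE !eqxx mulr1 mulrC big1 ?addr0 // => i ij.
  by rewrite !mxE eqxx (negbTE ij) !mulr0.
by rewrite pv add0r mulf_neq0 // intr_eq0.
Qed.

HB.instance Definition _ := Complete.on 'rV[R]_n.

(** Baire's theorem: rational independence excludes countably many hyperplanes. *)
Lemma independent_dense (U : set 'rV[R]_n) : open U -> U !=set0 ->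
  exists2 v, U v & forall u, pairing u v = 0 -> u = 0.
Proof.
move=> oU U0.
pose S (i : nat) : set 'rV[R]_n :=
  if choice.unpickle i is Some u then
    if (u : 'rV[int]_n) == 0 then setT else [set v | pairing u v != 0] else setT.
have /Baire dS : forall i, open (S i) /\ dense (S i).
  move=> i; rewrite /S; case: choice.unpickle => [u|].
    case: eqVneq => [_|u0]; first by split; [exact: openT | by move=> O [x Ox] _; exists x].
    by split; [exact: nonzero_pairing_open | exact: nonzero_pairing_dense].
  by split; [exact: openT | by move=> O [x Ox] _; exists x].
have [v [Uv Sv]] := dS U U0 oU; exists v => // u uv.
have := Sv (choice.pickle u) I; rewrite /S choice.pickleK; case: eqVneq => //= _.
by rewrite uv eqxx.
Qed.
End Generic.

(** * Discrete valuations of a field of rational functions *)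

Section Subfield.
Variables (F : fieldType) (S : set F).
Hypothesis SB : forall x y, S x -> S y -> S (x - y).
Hypothesis SM : forall x y, S x -> S y -> S (x / y).
Hypothesis S1 : S 1.

Definition subfield_pred : {pred F} := fun x => `[< S x >].

Fact subfield_pred_closed : divring_closed subfield_pred.
Proof.
split; first by apply/asboolP.
- by move=> x y /asboolP Sx /asboolP Sy; apply/asboolP/SB.
- by move=> x y /asboolP Sx /asboolP Sy; apply/asboolP/SM.
Qed.

HB.instance Definition _ := GRing.isDivringClosed.Build F subfield_pred subfield_pred_closed.

Definition subfield_type : Type := {x : F | x \in subfield_pred}.
HB.instance Definition _ := SubChoice.on subfield_type.
HB.instance Definition _ := [SubChoice_isSubIntegralDomain of subfield_type by <:].
HB.instance Definition _ := [SubIntegralDomain_isSubField of subfield_type by <:].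

Lemma subfieldP : exists (K : fieldType) (iota : {rmorphism K -> F}),
  forall x, S x <-> exists y, iota y = x.
Proof.
exists subfield_type, (\val : {rmorphism subfield_type -> F}) => x; split.
  by move=> /asboolP xS; exists (exist _ x xS).
by move=> [y <-]; have /asboolP := valP y.
Qed.
End Subfield.

Section PolyVal.
Variable K : fieldType.
Implicit Types (p q a b : {poly K}).

(** The value of 0, which would be infinite, is left out. *)
Definition poly_valuation (nu : {poly K} -> int) :=
  [/\ forall a b, a != 0 -> b != 0 -> nu (a * b) = nu a + nu b,
      forall c, c != 0 -> nu c%:P = 0 &
      forall a b, a != 0 -> b != 0 -> a + b != 0 -> Num.min (nu a) (nu b) <= nu (a + b)].

Lemma degree_valuation : poly_valuation (fun a => - (size a).-1%:Z).
Proof.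
split.
- move=> a b a0 b0; rewrite size_mul //.
  have := a0; have := b0; rewrite -!size_poly_gt0.
  by move: (size a) (size b) => x y; lia.
- by move=> c c0; rewrite size_polyC c0.
- move=> a b a0 b0 ab0; have := size_polyD a b.
  have := a0; have := b0; have := ab0; rewrite -!size_poly_gt0.
  by move: (size a) (size b) (size (a + b)) => x y z; lia.
Qed.

Lemma irreducible_factor p : (1 < size p)%N -> exists2 q, irreducible_poly q & q %| p.
Proof.
move: {2}(size p) (leqnn (size p)) => N; elim: N p => [|N IH] p; first by case: (size p).
move=> sN s1; have [irr|nirr] := pselect (irreducible_poly p); first by exists p.
have [q [q1 qp nqp]] : exists q, [/\ size q != 1%N, q %| p & ~~ (q %= p)].
  apply: contra_notP nirr => nex; split=> // q q1 qp; apply: contraT => nqp.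
  by case: nex; exists q.
have p0 : p != 0 by rewrite -size_poly_gt0; apply: ltnW.
have q0 : q != 0 by apply: contraNneq p0 => e; move: qp; rewrite e dvd0p.
have [||r irr rq] := IH q.
- rewrite -ltnS (leq_trans _ sN) // ltn_neqAle dvdp_leq // andbT.
  by apply: contra nqp => /eqP e; rewrite -dvdp_size_eqp // e.
- by rewrite ltn_neqAle eq_sym q1 size_poly_gt0.
by exists r => //; apply: dvdp_trans qp.
Qed.

Section OrdQ.
Variable q : {poly K}.
Hypothesis irr : irreducible_poly q.

Let q1 : (1 < size q)%N. Proof. by case: irr. Qed.
Let q0 : q != 0. Proof. by rewrite -size_poly_gt0 ltnW. Qed.

Lemma irreducible_dvdM a b : (q %| a * b) = (q %| a) || (q %| b).
Proof.
apply/idP/orP => [qab|[qa|qb]]; [|exact: dvdp_mulr|exact: dvdp_mull].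
have [qa|nqa] := boolP (q %| a); [by left|right].
by rewrite -(Gauss_dvdpr b (_ : coprimep q a)) // irreducible_poly_coprime.
Qed.

(** The exponent of [q] in [a]; the size of [a] bounds it as [q] is not constant. *)
Definition ordq a : nat := \max_(e < size a | q ^+ e %| a) e.

Lemma ordq_dvd a : q ^+ ordq a %| a.
Proof.
rewrite /ordq; have [s0|s0] := posnP (size a).
  rewrite big_pred0 ?expr0 ?dvd1p // => e; have := ltn_ord e.
  by rewrite {2}s0.
rewrite (bigop.bigmax_eq_arg (Ordinal s0)) ?expr0 ?dvd1p //.
by case: arg_maxnP; rewrite ?expr0 ?dvd1p.
Qed.

Lemma ordq_max a e : a != 0 -> q ^+ e %| a -> (e <= ordq a)%N.
Proof.
move=> a0 qe; have ea : (e < size a)%N.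
  apply: leq_trans (dvdp_leq a0 qe).
  have := size_exp q e; have : (0 < size (q ^+ e))%N by rewrite size_poly_gt0 expf_neq0.
  have : (0 < (size q).-1)%N by rewrite -subn1 subn_gt0.
  by move: (size (q ^+ e)) (size q).-1 => x y; nia.
exact: (leq_bigmax_cond (Ordinal ea)).
Qed.

Lemma ordqE a e a' : a != 0 -> a = q ^+ e * a' -> ~~ (q %| a') -> ordq a = e.
Proof.
move=> a0 aE na'; apply/eqP; rewrite eqn_leq andbC ordq_max //=; last first.
  by rewrite aE dvdp_mulr.
rewrite leqNgt; apply: contra na' => lt; have := ordq_dvd a.
move=> /(dvdp_trans (dvdp_exp2l q lt)); rewrite {1}aE exprSr dvdp_mul2l //.
by rewrite expf_neq0.
Qed.

Lemma ordq_decomp a : a != 0 -> exists2 a', a = q ^+ ordq a * a' & ~~ (q %| a').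
Proof.
move=> a0; have /dvdpP[a' aE] := ordq_dvd a; exists a'; first by rewrite mulrC.
apply/negP => /dvdpP[c cE]; have : q ^+ (ordq a).+1 %| a.
  by rewrite [X in _ %| X]aE cE -mulrA -exprS dvdp_mull.
by move=> /(ordq_max a0); rewrite ltnn.
Qed.

Lemma ord_valuation : poly_valuation (fun a => (ordq a)%:Z).
Proof.
split.
- move=> a b a0 b0; have [a' aE na] := ordq_decomp a0; have [b' bE nb] := ordq_decomp b0.
  rewrite -PoszD; congr Posz; apply: (@ordqE _ _ (a' * b')); first by rewrite mulf_neq0.
    by rewrite {1}aE {1}bE exprD mulrACA.
  by rewrite irreducible_dvdM negb_or na.
- move=> c c0; congr Posz; apply: (@ordqE _ _ c%:P); rewrite ?polyC_eq0 ?expr0 ?mul1r //.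
  by apply/negP => /dvdp_leq; rewrite polyC_eq0 size_polyC c0 leqNgt q1 => /(_ isT).
- move=> a b a0 b0 ab0; rewrite ge_min !lez_nat.
  have [le|/ltnW le] := leqP (ordq a) (ordq b); apply/orP; [left|right].
    by apply: ordq_max => //; apply: dvdp_add; rewrite ?ordq_dvd // (dvdp_trans _ (ordq_dvd b)) // dvdp_exp2l.
  by apply: ordq_max => //; apply: dvdp_add; rewrite ?ordq_dvd // (dvdp_trans _ (ordq_dvd a)) // dvdp_exp2l.
Qed.

Lemma ordq_gt0 a : a != 0 -> q %| a -> (0 < ordq a)%N.
Proof. by move=> a0 qa; apply: ordq_max; rewrite ?expr1. Qed.

Lemma ordq_eq0 a : a != 0 -> ~~ (q %| a) -> ordq a = 0%N.
Proof. by move=> a0 qa; apply: (@ordqE _ _ a); rewrite ?expr0 ?mul1r. Qed.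
End OrdQ.
End PolyVal.

(** * The field of functions of a realization *)

(** If the weights separate the exponents, the term of least weight is a single
    monomial. *)
Lemma lead_exists (k : fieldType) (U : zmodType) (R : realType) (lam : U -> R)
    (P : set U) (f : group_algebra k U) :
  (forall u v, P u -> P v -> lam u = lam v -> u = v) -> suppin P f -> f != 0 ->
  exists2 u, coef f u != 0 &
    suppin [set v | P v /\ lam u < lam v]%classic (f - monomial (coef f u) u).
Proof.
move=> linj fP f0; have [u fu umin] := supp_min lam f0; exists u => // v.
rewrite gcoefB coef_monomial; have [<-|uv] := eqVneq u v; first by rewrite subrr eqxx.
rewrite subr0 => fv; split; first exact: fP.
rewrite lt_neqAle umin // andbT; apply: contraNneq uv => e.
by apply/eqP/linj => //; apply: fP.
Qed.

(** Identities between fractions, with equations for the numerators and denominators: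
   the latter are images of products of Laurent polynomials, which are costly to
   rewrite. *)
Lemma addf_div_eq (F : fieldType) (a a' c c' p q : F) : c != 0 -> c' != 0 ->
  p = a * c' + a' * c -> q = c * c' -> a / c + a' / c' = p / q.
Proof. by move=> c0 c'0 -> ->; field; rewrite c0 c'0. Qed.
Lemma mulf_div_eq (F : fieldType) (a a' c c' p q : F) :
  p = a * a' -> q = c * c' -> (a / c) * (a' / c') = p / q.
Proof. by move=> -> ->; rewrite invfM mulrACA. Qed.

Lemma subr_via (V : zmodType) (a b x p : V) : p = b - x -> a - b = a - x - p.
Proof. by move=> ->; rewrite opprB addrA subrK. Qed.

Lemma weight_partE (k : fieldType) (n d : nat) (B : 'M[int]_(d, n)) w (f : laurent k n) :
  weight_part B w f = restrict [set u | u *m B^T = w]%classic f.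
Proof.
rewrite unlock /weight_part; apply: eq_bigl => u; apply/eqP/asboolP => //.
Qed.

Lemma galg_scale (k : fieldType) (U : zmodType) a (f : group_algebra k U) :
  a *: f = monomial a 0 * f.
Proof. by apply: galgP => u; rewrite coef_monomialM subr0; apply: mcoeffZ. Qed.

Lemma div_mul_eq (F : fieldType) (a b c p q : F) : c != 0 ->
  p = b * c -> q = a * b -> a / c * p = q.
Proof. by move=> c0 -> ->; field. Qed.
Lemma cancel_mul_eq (F : fieldType) (a b y z : F) : a * b = 1 -> y = b * z -> z = a * y.
Proof. by move=> e ->; rewrite mulrA e mul1r. Qed.
Lemma mul_mul_eq (F : fieldType) (y a b c p q : F) :
  y * a = b -> p = a * c -> q = b * c -> y * p = q.
Proof. by move=> <- -> ->; rewrite mulrA. Qed.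

(** Additive functions on the lattice of exponents come from points of N_R. *)
Lemma additive_pairing (R : realType) (n : nat) (g : 'rV[int]_n -> int) u :
  (forall u v, g (u + v) = g u + g v) ->
  (g u)%:~R = pairing u (\row_j (g (delta_mx 0 j))%:~R : 'rV[R]_n).
Proof.
move=> gD; have g0 : g 0 = 0 by have := gD 0 0; rewrite addr0 => /eqP; rewrite -subr_eq0 opprD addrA subrr sub0r oppr_eq0 => /eqP.
have gMn v j : g (v *+ j) = g v *+ j.
  by elim: j => [|j IH]; rewrite ?mulr0n // !mulrS gD IH.
have gN v : g (- v) = - g v by apply/eqP; rewrite -addr_eq0 -gD addNr g0.
have gZ v (z : int) : g (z *: v) = z * g v.
  have [N [->|->]] := int_nat_cases z; rewrite -natz ?scaleNr scaler_nat.
    by rewrite gMn mulr_natl.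
  by rewrite gN gMn mulNr mulr_natl.
rewrite [in LHS](row_sum_delta u) (big_morph g gD g0) rmorph_sum /pairing.
by apply: eq_bigr => j _; rewrite gZ rmorphM mxE.
Qed.

Lemma eps_inj n : injective (@eps n).
Proof.
move=> i i'; case: (unliftP ord0 i) => [l ->|->]; case: (unliftP ord0 i') => [l' ->|->] //.
- rewrite !eps_lift => /rowP/(_ l); rewrite !mxE !eqxx /=; case: eqP => [->//|_ /eqP].
  by rewrite oner_eq0.
- by rewrite eps_lift eps0 => /rowP/(_ l); rewrite !mxE !eqxx => /eqP; rewrite oner_eq0.
- by rewrite eps_lift eps0 => /rowP/(_ l'); rewrite !mxE !eqxx => /esym/eqP; rewrite oner_eq0.
Qed.

(** In this section Y is a tropical realization of the fan with function field F, and
    [w0] is a point of the open cone of a maximal flag whose weights on the basis are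
    those of a vector [x] with rationally independent coordinates. *)
Section Forward.
Local Open Scope classical_set_scope.
Variables (R : realType) (k : fieldType) (n : nat) (M : matroid 'I_n.+1).
Hypothesis lf : loop_free M.
Notation E := 'I_n.+1.
Notation d := (mdim M).
Variables (Y : prime_idealr (laurent k n)) (F : fieldType).
Variable phi : {rmorphism laurent k n -> F}.
Hypothesis kerphi : forall f, (f \in Y) <-> phi f = 0.
Hypothesis TropY : @Trop k R n Y = matroid_fan_support M.
Variables (beta : E -> 'I_d.+1) (b : 'I_d.+1 -> E).
Hypothesis ad : adapted beta b.
Variables (x w0 : 'rV[R]_n).
Hypothesis xind : forall u, pairing u x = 0 -> u = 0.
Hypothesis w0x : forall i, hat w0 i = hat x (b (beta i)).
Hypothesis w0ord : ordered b w0.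
Hypothesis w0mult : generic_multiplicity d Y w0 1.
Notation chi := (chi phi).
Notation kap := (kap phi).
Implicit Types (u v : 'rV[int]_n) (f g : laurent k n) (w : 'rV[R]_n).

Let betab := adapted_section ad.

Let w0block : blockwise beta b w0.
Proof. by move=> i; rewrite !w0x betab. Qed.

Let w0trop : Trop Y w0.
Proof. by rewrite TropY; apply: (ordered_fan ad). Qed.

(** Each coordinate is replaced by that of the element of the basis in its block. This
    does not change the weight at [w0], and the independence of [x] makes [rho u] the
    only exponent on the basis with the weight of [u]. *)
Definition rho u : 'rV[int]_n := \sum_j u 0 j *: eps (b (beta (lift ord0 j))).

Lemma rhoD u v : rho (u + v) = rho u + rho v.
Proof. by rewrite /rho -big_split /=; apply: eq_bigr => j _; rewrite mxE scalerDl. Qed.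
Lemma rho0 : rho 0 = 0.
Proof. by rewrite /rho big1 // => j _; rewrite mxE scale0r. Qed.
Lemma rhoN u : rho (- u) = - rho u.
Proof. by apply/eqP; rewrite -addr_eq0 -rhoD addNr rho0. Qed.
Lemma rhoB u v : rho (u - v) = rho u - rho v.
Proof. by rewrite rhoD rhoN. Qed.

Lemma rho_eps i : rho (eps i) = eps (b (beta i)).
Proof.
case: (unliftP ord0 i) => [j ->|->]; last by rewrite eps0 rho0 (adapted0 ad) eps0.
rewrite eps_lift /rho (bigD1 j) //= mxE !eqxx scale1r big1 ?addr0 // => l lj.
by rewrite mxE eqxx (negbTE lj) scale0r.
Qed.

Lemma chi_split u : chi (rho u) * chi (u - rho u) = chi u.
Proof. by rewrite -chiD [rho u + _]addrC subrK. Qed.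

Lemma pairing_rho u : pairing u w0 = pairing (rho u) x.
Proof.
rewrite {1}(sum_eps u) /rho !pairing_sum; apply: eq_bigr => j _.
by rewrite !pairingZ !pairing_eps w0x.
Qed.

Lemma pairing_w0_eq0 u : pairing u w0 = 0 -> rho u = 0.
Proof. by rewrite pairing_rho => /xind. Qed.

(** The coordinates of the elements of the basis [b], other than e_0. *)
Definition basis_coords : {set 'I_n} := [set j | b (beta (lift ord0 j)) == lift ord0 j]%SET.
Notation S := basis_coords.

Lemma eps_b_in j : lattice_on S (eps (b j)).
Proof.
move=> i iS; rewrite /eps; case: unliftP => [l e|_]; last by rewrite mxE.
rewrite mxE eqxx /=; case: eqP => // il; move: iS.
by rewrite inE il -e betab eqxx.
Qed.

Lemma rho_in u : lattice_on S (rho u).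
Proof.
apply: (big_ind (lattice_on S)); first exact: lattice_on0.
- by move=> v v'; exact: lattice_onD.
- by move=> j _; apply: lattice_onZ; apply: eps_b_in.
Qed.

Lemma rho_id u : lattice_on S u -> rho u = u.
Proof.
move=> uS; rewrite [RHS](sum_eps u); apply: eq_bigr => j _.
have [|/uS ->] := boolP (j \in S); last by rewrite !scale0r.
by rewrite inE => /eqP ->.
Qed.

Lemma pairing_S u : lattice_on S u -> pairing u w0 = pairing u x.
Proof. by move=> uS; rewrite pairing_rho rho_id. Qed.

Lemma S_ind u : lattice_on S u -> pairing u w0 = 0 -> u = 0.
Proof. by move=> uS; rewrite pairing_S // => /xind. Qed.

Lemma S_inj u v : lattice_on S u -> lattice_on S v -> pairing u w0 = pairing v w0 -> u = v.
Proof.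
move=> uS vS e; apply/eqP; rewrite -subr_eq0; apply/eqP/S_ind.
  exact: lattice_onB.
by rewrite pairingB e subrr.
Qed.

Definition algind (Q : {set 'I_n}) := forall f, suppin (lattice_on Q) f -> phi f = 0 -> f = 0.

(** Exponents on the basis have distinct weights at [w0], so that a relation would have
    a monomial as its leading part. *)
Lemma S_algind : algind S.
Proof.
move=> f fS /kerphi fY; apply/eqP; apply: contraT => f0.
have [u fu uP] := lead_exists (lam := fun u => pairing u w0) S_inj fS f0.
have : coef f u = 0.
  by apply: (Trop_lead w0trop fY (u := u)); apply: suppinS uP => v [].
by move/eqP; rewrite (negbTE fu).
Qed.

(** The center of a valuation ring is a tropical point, hence in the fan. *)
Lemma center_trop (V : set F) w : valring V -> (forall c, V (kap c)) ->
  (forall u, 0 < pairing u w -> vmax V (chi u)) -> levels M w.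
Proof.
move=> vV Vk Vm; apply: (fan_levels lf); rewrite -TropY.
apply: (@Trop_place k R n Y F phi (vmax V)).
- by move=> f /kerphi.
- exact: vmax0.
- exact: vmax1.
- exact: vmaxD.
- by move=> c u u0; rewrite phi_monomial; apply: vmaxM => //; apply: Vm.
Qed.

(** The subring of the combinations of the characters in [Q] of nonnegative
    weight, and its ideal of the combinations of positive weight. *)
Definition nonneg (Q : {set 'I_n}) (v : 'rV[R]_n) : set 'rV[int]_n :=
  [set u | lattice_on Q u /\ 0 <= pairing u v].
Definition positive (Q : {set 'I_n}) (v : 'rV[R]_n) : set 'rV[int]_n :=
  [set u | lattice_on Q u /\ 0 < pairing u v].
Definition image_of (P : set 'rV[int]_n) : set F := [set z | exists2 f, suppin P f & z = phi f].

Lemma positive_sub Q (v : 'rV[R]_n) : positive Q v `<=` nonneg Q v.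
Proof. by move=> u [uQ /ltW]. Qed.
Lemma nonneg0 Q (v : 'rV[R]_n) : nonneg Q v 0.
Proof. by split; [exact: lattice_on0 | rewrite pairing0]. Qed.
Lemma nonnegD Q (v : 'rV[R]_n) u u' : nonneg Q v u -> nonneg Q v u' -> nonneg Q v (u + u').
Proof.
by move=> [uQ u0] [uQ' u0']; split; [exact: lattice_onD|rewrite pairingD addr_ge0].
Qed.
Lemma positiveD Q (v : 'rV[R]_n) u u' : nonneg Q v u -> positive Q v u' -> positive Q v (u + u').
Proof.
by move=> [uQ u0] [uQ' u0']; split; [exact: lattice_onD|rewrite pairingD ltr_wpDl].
Qed.

Lemma image_ring Q (v : 'rV[R]_n) : subring_set (image_of (nonneg Q v)).
Proof.
split.
- by exists 1; rewrite ?rmorph1 //; apply: suppin1; apply: nonneg0.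
- move=> _ _ [f fP ->] [g gP ->]; exists (f - g); last by rewrite rmorphB.
  exact: suppinB.
- move=> _ _ [f fP ->] [g gP ->]; exists (f * g); last by rewrite rmorphM.
  exact: (suppinM (@nonnegD Q v) fP gP).
Qed.
Lemma image_ideal Q (v : 'rV[R]_n) : ideal_set (image_of (nonneg Q v)) (image_of (positive Q v)).
Proof.
split.
- by exists 0; rewrite ?rmorph0 //; apply: suppin0.
- move=> _ _ [f fP ->] [g gP ->]; exists (f + g); last by rewrite rmorphD.
  exact: suppinD.
- move=> _ _ [f fP ->] [g gP ->]; exists (f * g); last by rewrite rmorphM.
  exact: (suppinM (@positiveD Q v) fP gP).
Qed.
Lemma image_sub P P' : P `<=` P' -> image_of P `<=` image_of P'.
Proof. by move=> PP' z [f fP ->]; exists f => //; apply: suppinS fP. Qed.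
Lemma image_kap Q (v : 'rV[R]_n) c : image_of (nonneg Q v) (kap c).
Proof. by rewrite kapE; exists (monomial c 0) => //; apply: suppin_monomial; apply: nonneg0. Qed.
Lemma image_chi P u : P u -> image_of P (chi u).
Proof. by move=> Pu; rewrite chiE; exists (monomial 1 u) => //; apply: suppin_monomial. Qed.

Lemma card_S : (#|S| = d)%N.
Proof.
have [e _] : #|[set b j | j : 'I_d.+1]%SET| = #|S|.+1 /\ True.
  split=> //; suff -> : [set b j | j : 'I_d.+1]%SET = (ord0 |: [set lift ord0 j | j in S])%SET.
    rewrite cardsU1 card_imset; last exact: lift_inj.
    by case: imsetP => // -[j _ /eqP]; rewrite (negbTE (neq_lift _ _)).
  apply/setP => i; rewrite finset.in_setU1; apply/imsetP/orP => [[j _ ->]|].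
    case: (unliftP ord0 (b j)) => [l e|->]; [right|by left].
    by apply/imsetP; exists l => //; rewrite inE -e betab.
  case=> [/eqP ->|/imsetP[j]]; first by exists (beta ord0); rewrite ?(adapted0 ad).
  by rewrite inE => /eqP e ->; exists (beta (lift ord0 j)).
by move: e; rewrite (basis_card ad) => -[].
Qed.

(** A maximal algebraically independent set [Q] that contains [j] and the basis would
    have more than d elements. The monomial valuation of weight [x] on [Q] extends to a
    valuation ring of F, whose center has #|Q| + 1 distinct weights, counting that of
    y_0: more than a point of the fan has. *)
Lemma coords_algebraic j : j \notin S ->
  exists f, [/\ f != 0, suppin (lattice_on (j |: S)%SET) f & phi f = 0].
Proof.
have dep Q : ~ algind Q -> exists f, [/\ f != 0, suppin (lattice_on Q) f & phi f = 0].
  apply: contra_notP => nex f fQ phif; apply/eqP; apply: contra_notT nex => f0.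
  by exists f.
move=> jS; apply: (dep _) => ajS.
have [Q maxQ SQ] := @maxset_exists _ (fun Q => `[< algind Q >]) (j |: S)%SET (asboolT ajS).
have aQ : algind Q by apply/asboolP; exact: maxsetp maxQ.
have QZ i : i \notin Q -> exists f, [/\ f != 0, suppin (lattice_on (i |: Q)%SET) f & phi f = 0].
  move=> iQ; apply: (dep _) => aiQ; move/maxsetP: maxQ => [_ /(_ (i |: Q)%SET)].
  move=> /(_ (asboolT aiQ) (finset.subsetU1 _ _)) e.
  by move: iQ; rewrite -e finset.setU11.
have [|[V [vV V0 Vp _]]|[p [_ [f fp pf] p1]]] :=
  @chevalley_adjoin F _ _ 0 (image_ring Q x) (image_ideal Q x).
- by apply: image_sub; apply: positive_sub.
- have Vk c : V (kap c) by apply: V0; apply: image_kap.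
  have [|||w [wQ _ wm]] := @valring_center k n F phi R V Q x vV Vk.
  + by move=> u uQ u0; apply: Vp; apply: image_chi; split.
  + by move=> u _; apply: xind.
  + exact: QZ.
  have lw := center_trop vV Vk wm.
  have := @levels_card R n M lf w (ord0 |: [set lift ord0 i | i in Q])%SET lw _.
  rewrite cardsU1 card_imset; last exact: lift_inj.
  have -> : ord0 \notin [set lift ord0 i | i in Q]%SET.
    by apply/imsetP => -[i _ /eqP]; rewrite (negbTE (neq_lift _ _)).
  have Qd : (d < #|Q|)%N.
    by rewrite -card_S; apply: leq_trans (subset_leq_card SQ); rewrite cardsU1 jS.
  rewrite add1n ltnS leqNgt Qd => h; apply/notF/h => i i' iT i'T e.
  have eT l : l \in (ord0 |: [set lift ord0 i | i in Q])%SET -> hat w l = pairing (eps l) x.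
    rewrite pairing_eps finset.in_setU1 => /orP[/eqP ->|/imsetP[m mQ ->]].
      by rewrite !hat0.
    by rewrite !hat_lift wQ.
  have : eps i - eps i' = 0 by apply: xind; rewrite pairingB -!eT // e subrr.
  by move/eqP; rewrite subr_eq0 => /eqP/eps_inj.
move: p1; rewrite horner_coef0 pf => f1.
have : 1 - f = 0.
  apply: aQ; last by rewrite rmorphB rmorph1 f1 subrr.
  by apply: suppinB; [apply: suppin1; exact: lattice_on0 | apply: suppinS fp => u []].
move/eqP; rewrite subr_eq0 => /eqP f1E; have := fp 0; rewrite -f1E.
rewrite galg_oneE coef_monomial eqxx oner_eq0 => /(_ isT)[_].
by rewrite pairing0 ltxx.
Qed.

(** * The function field is generated by the coordinates of the basis *)

(** The fractions with denominators that are 1 modulo terms of positive weight. Those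
    with numerators of nonnegative weight form a local ring [O], on the field generated
    by the coordinates of the basis; it is the one that Nakayama's lemma needs. *)
Definition denom : set (laurent k n) := [set g | suppin (positive S w0) (g - 1)].
Definition frac_of (P : set 'rV[int]_n) : set F :=
  [set z | exists f g, [/\ suppin P f, denom g & z = phi f / phi g]].
Notation O := (frac_of (nonneg S w0)).
Notation m := (frac_of (positive S w0)).

Lemma denom_nonneg g : denom g -> suppin (nonneg S w0) g.
Proof.
move=> dg; rewrite -[g](subrK 1); apply: suppinD; last by apply: suppin1; apply: nonneg0.
by apply: suppinS dg; apply: positive_sub.
Qed.

Lemma denom_neq0 g : denom g -> phi g != 0.
Proof.
move=> dg; apply/eqP => /S_algind g0; have : suppin (positive S w0) (g - 1) by [].
rewrite g0; last by apply: suppinS (denom_nonneg dg) => u [].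
move/(_ 0); rewrite gcoefB gcoef0 galg_oneE coef_monomial eqxx sub0r oppr_eq0 oner_eq0.
by move=> /(_ isT)[_]; rewrite pairing0 ltxx.
Qed.

Lemma denom1 : denom 1.
Proof. by rewrite /denom /= subrr; apply: suppin0. Qed.

Lemma denomM g g' : denom g -> denom g' -> denom (g * g').
Proof.
move=> dg dg'; rewrite /denom /=.
have -> : g * g' - 1 = g * (g' - 1) + (g - 1) by rewrite mulrBr mulr1 addrA subrK.
apply: suppinD => //; exact: (suppinM (@positiveD S w0) (denom_nonneg dg) dg').
Qed.

Lemma frac_sub P P' : P `<=` P' -> frac_of P `<=` frac_of P'.
Proof. by move=> PP' z [f [g [fP dg ->]]]; exists f, g; split=> //; apply: suppinS fP. Qed.

Lemma frac_in P f : suppin P f -> frac_of P (phi f).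
Proof. by move=> fP; exists f, 1; split; [|exact: denom1|rewrite rmorph1 divr1]. Qed.

Lemma fracD P z z' : (forall u v, P u -> nonneg S w0 v -> P (u + v)) ->
  frac_of P z -> frac_of P z' -> frac_of P (z + z').
Proof.
move=> PA [f [g [fP dg ->]]] [f' [g' [fP' dg' ->]]].
exists (f * g' + f' * g), (g * g'); split.
- by apply: suppinD; [apply: (suppinM PA fP); exact: denom_nonneg
                     |apply: (suppinM PA fP'); exact: denom_nonneg].
- exact: denomM.
- have e1 := etrans (rmorphD phi _ _) (congr2 +%R (rmorphM phi f g') (rmorphM phi f' g)).
  exact: (addf_div_eq (denom_neq0 dg) (denom_neq0 dg') e1 (rmorphM phi g g')).
Qed.

Lemma fracM P z z' : (forall u v, nonneg S w0 u -> P v -> P (u + v)) ->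
  O z -> frac_of P z' -> frac_of P (z * z').
Proof.
move=> PA [f [g [fP dg ->]]] [f' [g' [fP' dg' ->]]].
exists (f * f'), (g * g'); split; first exact: (suppinM PA fP fP').
  exact: denomM.
exact: (mulf_div_eq (rmorphM phi f f') (rmorphM phi g g')).
Qed.

Lemma O_ring : subring_set O.
Proof.
have ON z : O z -> O (- z).
  move=> [f [g [fP dg ->]]]; exists (- f), g; split=> //; first exact: suppinN.
  by rewrite rmorphN mulNr.
split.
- by rewrite -(rmorph1 phi); apply: frac_in; apply: suppin1; apply: nonneg0.
- by move=> z z' Oz Oz'; apply: fracD => //; [exact: nonnegD|exact: ON].
- by move=> z z'; apply: fracM; exact: nonnegD.
Qed.

Lemma m_ideal : ideal_set O m.
Proof.
split.
- by rewrite -(rmorph0 phi); apply: frac_in; apply: suppin0.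
- by move=> z z'; apply: fracD => u v uP vP; rewrite addrC; apply: positiveD.
- by move=> z z'; apply: fracM; exact: positiveD.
Qed.

Lemma m_sub : m `<=` O.
Proof. by apply: frac_sub; exact: positive_sub. Qed.

Lemma O_local a : m a -> 1 - a != 0 /\ O (1 - a)^-1.
Proof.
move=> [f [g [fP dg ->]]]; have dgf : denom (g - f).
  by rewrite /denom /= addrAC; apply: suppinB.
have -> : 1 - phi f / phi g = phi (g - f) / phi g.
  by rewrite rmorphB mulrBl divff // denom_neq0.
split; first by rewrite mulf_neq0 ?invr_eq0 // denom_neq0.
exists g, (g - f); split=> //; first exact: denom_nonneg.
by rewrite invfM invrK mulrC.
Qed.

(** If the inverse of the character [u] were in the maximal ideal of a valuation ring
    above the monomial valuation, then its center, which lies in the fan and agrees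
    with [w0] on the basis, would be [w0], at which [u] has weight 0. The relation
    provided by [chevalley_adjoin] instead is an equation of integral dependence. *)
Lemma weight0_integral u : rho u = 0 -> integral_over O (chi u).
Proof.
move=> u0; set z := chi u; have z0 : z != 0 := chi_neq0 phi u.
have [|[V [vV V0 Vp Vz]]|[p [Sp p0 p1]]] :=
  @chevalley_adjoin F _ _ z^-1 (image_ring S w0) (image_ideal S w0).
- by apply: image_sub; apply: positive_sub.
- exfalso; have Vk c : V (kap c) by apply: V0; apply: image_kap.
  have [|||w [wQ wV wm]] := @valring_center k n F phi R V S w0 vV Vk.
  + by move=> v vS v0; apply: Vp; apply: image_chi; split.
  + exact: S_ind.
  + exact: coords_algebraic.
  have lw := center_trop vV Vk wm.
  have wb j : hat w (b j) = hat w0 (b j).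
    have [[l e]|e] : (exists l, b j = lift ord0 l) \/ b j = ord0.
      by case: (unliftP ord0 (b j)) => [l ->|->]; [left; exists l|right].
      by rewrite e !hat_lift wQ // inE -e betab.
    by rewrite e !hat0.
  have wE : w = w0.
    apply: hat_inj => i; rewrite (ordered_blockwise lf ad lw) ?wb -?w0block //.
    by move=> j l jl; rewrite !wb; apply: w0ord.
  case: Vz => [/eqP|]; first by rewrite invr_eq0 (negbTE z0).
  by rewrite invrK; apply; apply: wV; rewrite wE pairing_rho u0 pairing0.
have [f0 f0P f0E] := p0.
have m0 : m p`_0 by rewrite f0E; apply: frac_in.
have [c0 Oc] := O_local m0.
have Op i : O p`_i by have [f fP ->] := Sp i; apply: frac_in.
(* The equation of the inverse, reversed and divided by the leading coefficient. *)
set N := size p; pose o i := if (i == 0)%N then 0 else p`_(N - i) / (1 - p`_0).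
exists N, o; split.
  move=> l; rewrite /o; case: eqP => _; first exact: (subring_set0 O_ring).
  by have [_ _ OM] := O_ring; apply: OM.
have N0 : (0 < N)%N.
  rewrite lt0n size_poly_eq0; apply: contra_eqN p1 => /eqP ->.
  by rewrite horner0 eq_sym oner_eq0.
have e : \sum_(l < N) p`_l * z ^+ (N - l) = z ^+ N.
  rewrite -[RHS]mulr1 -p1 horner_coef mulr_sumr; apply: eq_bigr => l _.
  rewrite exprVn mulrCA; congr (_ * _).
  exact: expfB (ltn_ord l).
have oE i : o i = if (i == 0)%N then 0 else p`_(N - i) / (1 - p`_0) by [].
clearbody o; clearbody N; case: N N0 e oE => // K _ e oE.
rewrite big_ord_recl [nat_of_ord _]/= subn0 in e.
rewrite big_ord_recl oE eqxx mul0r add0r; apply: (mulfI c0).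
rewrite mulrBl mul1r -{1}e addrC addKr mulr_sumr (reindex_inj rev_ord_inj) /=.
apply: eq_bigr => l _; rewrite oE /bump /= !add1n !subSS subnSK ?ltn_ord //.
rewrite subKn // mulrA; congr (_ * _).
by rewrite mulrCA divff // mulr1.
Qed.

Section Multiplicity.
Variable (B : 'M[int]_(d, n)).
Hypotheses (subB : subtorus B) (qlB : quotient_length B (initial_ideal Y w0) 1).
Notation J := (initial_ideal Y w0).

(** The quotient of the initial degeneration by the torus is a point over k: the
    invariant characters are constant on it. *)
Let invariant_char u : u *m B^T = 0 -> exists c, J (monomial 1 u - monomial c 0).
Proof.
have [b0 b0P qP] := qlB; move=> uB.
have mono0 v : v *m B^T = 0 -> exists c, J (monomial 1 v - monomial c 0 * b0 ord0).
  move=> vB; have [|c [Jc _]] := qP (monomial 1 v).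
    by rewrite weight_partE restrict_id //; apply: suppin_monomial.
  by exists (c 0 ord0); rewrite -galg_scale; move: Jc; rewrite big_ord1.
have [cu Ju] := mono0 u uB; have [c1 J1] := mono0 0 (mul0mx _ _).
have c10 : c1 != 0.
  apply/eqP => c10; apply: w0trop.
  by move: J1; rewrite c10 monomial0 mul0r subr0.
exists (cu / c1).
pose b1 := b0 ord0; pose mc : laurent k n := monomial (cu / c1) 0.
have a1 : mc * monomial c1 0 = monomial cu 0.
  exact: etrans (monomialM _ _ _ _) (congr2 (@monomial k 'rV_n) (divfK c10 cu) (addr0 0)).
have a2 : mc * (monomial c1 0 * b1) = monomial cu 0 * b1.
  exact: etrans (mulrA _ _ _) (congr1 (fun z => z * b1) a1).
have e1 : mc * (monomial 1 0 - monomial c1 0 * b1) = mc - monomial cu 0 * b1.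
  exact: etrans (mulrBr _ _ _) (congr2 (fun z z' => z - z') (mulr1 _) a2).
rewrite (subr_via (monomial 1 u) e1).
apply: initial_idealD; first exact Ju.
by apply: initial_idealN; apply: initial_idealM; exact J1.
Qed.

(** A character that is constant on the initial degeneration has weight 0, as no
    monomial is an initial form. *)
Let invariant_weight u : u *m B^T = 0 -> rho u = 0.
Proof.
move=> uB; have [c Jc] := invariant_char uB; apply: pairing_w0_eq0; apply/eqP.
apply: contraT => t0; have [f fY fP] := initial_ideal_lift (pairing u w0) Jc.
have : (1 : k) = 0.
  apply: (Trop_lead w0trop fY (u := u)); move: fP; rewrite restrictD restrict_id.
    rewrite restrict_out ?addr0 //; apply: suppinN; apply: suppin_monomial => /=.
    by rewrite pairing0 => /esym/eqP; rewrite (negbTE t0).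
  exact: suppin_monomial.
by move/eqP; rewrite oner_eq0.
Qed.

Let p0 := beta ord0.
Let D : 'M[int]_(d, n) := \matrix_(l, j) eps (b (lift p0 l)) 0 j.
Let G : 'M[int]_(n, d) := \matrix_(j, l) (beta (lift ord0 j) == lift p0 l)%:R.

Let epsG j : eps (b (lift p0 j)) *m G = delta_mx 0 j.
Proof.
case: (unliftP ord0 (b (lift p0 j))) => [i e|e].
  rewrite e eps_lift -rowE; apply/rowP => l; rewrite !mxE -e betab eqxx /=.
  by rewrite (inj_eq lift_inj) eq_sym.
have := betab (lift p0 j); rewrite e -(adapted0 ad) betab => /eqP.
by rewrite -/p0 (negbTE (neq_lift _ _)).
Qed.

Let DG : D *m G = 1%:M.
Proof.
apply/row_matrixP => l; rewrite row_mul (_ : row l D = eps (b (lift p0 l))); last first.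
  by apply/rowP => j; rewrite !mxE.
by rewrite epsG rowE mulmx1.
Qed.

Let rhoE u : rho u = u *m G *m D.
Proof.
rewrite /rho {2}(sum_eps u) !mulmx_suml; apply: eq_bigr => j _.
rewrite -!scalemxAl eps_lift; congr (_ *: _); rewrite -rowE.
have -> : row j G = \row_l (beta (lift ord0 j) == lift p0 l)%:R.
  by apply/rowP => l; rewrite !mxE.
case: (unliftP p0 (beta (lift ord0 j))) => [l e|e].
  rewrite e (_ : \row_l0 _ = delta_mx 0 l); last first.
    by apply/rowP => l'; rewrite !mxE eqxx (inj_eq lift_inj) eq_sym.
  by rewrite -rowE; apply/rowP => i; rewrite !mxE.
rewrite e (_ : \row_l0 _ = 0); first by rewrite mul0mx /p0 (adapted0 ad) eps0.
by apply/rowP => l'; rewrite !mxE (negbTE (neq_lift _ _)).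
Qed.

(** The subtorus acting on the initial degeneration is the one spanned by the cone of
    [w0]: both have dimension d, and [invariant_weight] is one inclusion. The cocharacter
    lattices are saturated, whence an argument with one-sided inverses of square integer
    matrices. *)
Let weight0_invariant u : rho u = 0 -> u *m B^T = 0.
Proof.
have [C BC] := subB; move=> u0.
have uG v : v *m G = v *m (B^T *m (C^T *m G)).
  apply/eqP; rewrite -subr_eq0 !mulmxA -mulmxBl; apply/eqP.
  have /invariant_weight r0 : (v - v *m B^T *m C^T) *m B^T = 0.
    by rewrite mulmxBl -!mulmxA -trmx_mul BC trmx1 mulmx1 subrr.
  by rewrite -[X in X *m _ = _]subr0 -[LHS]mulmx1 -DG !mulmxA -rhoE subr0 r0 mul0mx.
have HD : (C^T *m G) *m (D *m B^T) = 1%:M.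
  apply: mulmx1C; rewrite -[LHS]mulmxA -DG; apply/row_matrixP => l.
  by rewrite !row_mul -uG.
have uG0 : u *m G = 0 by rewrite -[LHS]mulmx1 -DG !mulmxA -rhoE u0 mul0mx.
by rewrite -[LHS]mulmx1 -HD !mulmxA -[u *m _ *m _ *m _]mulmxA -[u *m _ *m _]mulmxA -uG uG0 !mul0mx.
Qed.

Lemma weight0_residue_sub u : rho u = 0 ->
  exists c g, suppin [set v | 0 < pairing v w0] g /\ chi u = kap c + phi g.
Proof.
move=> u0; have [c Jc] := invariant_char (weight0_invariant u0).
have [f fY fP] := initial_ideal_lift 0 Jc; move: fP; rewrite restrict_id; last first.
  apply: suppinB; apply: suppin_monomial; rewrite /= ?pairing0 //.
  by rewrite pairing_rho u0 pairing0.
set h := monomial 1 u - _ => fP; exists c, (- (f - h)); split; first exact: suppinN.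
by rewrite rmorphN rmorphB (kerphi f).1 // sub0r opprK rmorphB chiE kapE addrC subrK.
Qed.

End Multiplicity.

(** This is where multiplicity 1 enters. *)
Lemma weight0_residue u : rho u = 0 ->
  exists c g, suppin [set v | 0 < pairing v w0] g /\ chi u = kap c + phi g.
Proof. by have [B [subB _ qlB]] := w0mult; exact: weight0_residue_sub subB qlB u. Qed.

(** Nakayama's lemma for the algebra of the characters of weight 0: they are integral,
    and constant modulo functions of positive weight, whose terms are products of a
    monomial of positive weight on the basis and a character of weight 0. *)
Lemma weight0_local u : rho u = 0 -> O (chi u).
Proof.
move=> u0; pose P : set F := [set y | exists2 v, rho v = 0 & y = chi v].
pose gen (j : 'I_n) : 'rV[int]_n := delta_mx 0 j - rho (delta_mx 0 j).
have rho_idem v : rho (rho v) = rho v by apply/rho_id/rho_in.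
have gen0 j : rho (gen j) = 0 by rewrite rhoB rho_idem subrr.
pose zs := [seq chi (gen j) | j <- enum 'I_n] ++ [seq chi (- gen j) | j <- enum 'I_n].
have zsP z : z \in zs -> exists j, z = chi (gen j) \/ z = chi (- gen j).
  by rewrite mem_cat => /orP[] /mapP[j _ ->]; exists j; [left|right].
have zs_in j : chi (gen j) \in zs /\ chi (- gen j) \in zs.
  split; rewrite mem_cat; apply/orP; [left|right]; apply/mapP; exists j => //;
    by rewrite mem_enum.
apply: (nakayama O_ring m_ideal m_sub O_local (zs := zs) (P := P)); last by exists u.
- move=> z /zsP[j [->|->]]; apply: weight0_integral; first exact: gen0.
  by rewrite rhoN gen0 oppr0.
- by exists 0; rewrite ?rho0 // chi0.
- move=> _ _ [v v0 ->] [v' v'0 ->]; exists (v + v'); last by rewrite chiD.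
  by rewrite rhoD v0 v'0 addr0.
- by move=> z /zsP[j [->|->]]; [exists (gen j)|exists (- gen j)]; rewrite // rhoN gen0 oppr0.
- move=> Q Q1 Qz _ [v v0 ->].
  pose Q' v := forall y, Q y -> Q (chi v * y).
  have Q'0 : Q' 0 by move=> y; rewrite chi0 mul1r.
  have Q'D v1 v2 : Q' v1 -> Q' v2 -> Q' (v1 + v2).
    by move=> h1 h2 y Qy; rewrite chiD -mulrA; apply/h1/h2.
  have Q'Mn v1 N : Q' v1 -> Q' (v1 *+ N).
    move=> h; elim: N => [|N IH]; first by rewrite mulr0n; exact: Q'0.
    by rewrite mulrS; exact: Q'D.
  suff : Q' v by move=> /(_ 1 Q1); rewrite mulr1.
  have -> : v = \sum_j v 0 j *: gen j.
    transitivity (v - rho v); first by rewrite v0 subr0.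
    rewrite [X in X - _](row_sum_delta v) {1}/rho -sumrB.
    by apply: eq_bigr => j _; rewrite /gen scalerBr -eps_lift rho_eps.
  apply: (big_ind Q' Q'0 Q'D) => j _; have [g1 g2] := zs_in j.
  have [N [->|->]] := int_nat_cases (v 0 j).
    by rewrite -natz scaler_nat; apply: Q'Mn => y; exact: Qz _ _ g1.
  by rewrite scaleNr -natz scaler_nat -mulNrn; apply: Q'Mn => y; exact: Qz _ _ g2.
move=> _ [v v0 ->]; have [c [g [gP ->]]] := weight0_residue v0.
exists (kap c), [seq (kap (coef g v') * chi (rho v'), chi (v' - rho v')) | v' <- supp g].
split.
- by have [f fP ->] := image_kap S w0 c; apply: frac_in.
- move=> _ /mapP[v' v'g ->] /=; split; last first.
    by exists (v' - rho v'); rewrite // rhoB rho_idem subrr.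
  rewrite -phi_monomial; apply: frac_in; apply: suppin_monomial; split; first exact: rho_in.
  rewrite (pairing_rho (rho v')) rho_idem -pairing_rho; apply: gP.
  by rewrite -mem_supp; exact: v'g.
rewrite big_map phiE; apply: congr1; apply: eq_bigr => v' _.
exact: etrans (congr1 _ (esym (chi_split v'))) (mulrA _ _ _).
Qed.

(** The field generated by the characters in a subgroup of exponents. *)
Definition Kfrac (P : set 'rV[int]_n) : set F :=
  [set z | exists f g, [/\ suppin P f, suppin P g, phi g != 0 & z = phi f / phi g]].

Definition subgroup (P : set 'rV[int]_n) := P 0 /\ forall u v, P u -> P v -> P (u - v).

Lemma subgroupN P u : subgroup P -> P u -> P (- u).
Proof. by move=> [P0 PB] Pu; rewrite -sub0r; apply: PB. Qed.
Lemma subgroupD P u v : subgroup P -> P u -> P v -> P (u + v).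
Proof. by move=> sP Pu Pv; rewrite -[v]opprK; apply: sP.2 => //; apply: subgroupN. Qed.

Lemma phi_neq0M f g : phi f != 0 -> phi g != 0 -> phi (f * g) != 0.
Proof. by move=> f0 g0; rewrite (rmorphM phi f g) mulf_neq0. Qed.

Lemma KfracD P z z' : subgroup P -> Kfrac P z -> Kfrac P z' -> Kfrac P (z + z').
Proof.
move=> sP [f [g [fP gP g0 ->]]] [f' [g' [fP' gP' g0' ->]]].
have PA u v := @subgroupD P u v sP.
exists (f * g' + f' * g), (g * g'); split.
- by apply: suppinD; [exact: (suppinM PA fP gP')|exact: (suppinM PA fP' gP)].
- exact: (suppinM PA gP gP').
- exact: phi_neq0M.
- have e1 := etrans (rmorphD phi _ _) (congr2 +%R (rmorphM phi f g') (rmorphM phi f' g)).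
  exact: (addf_div_eq g0 g0' e1 (rmorphM phi g g')).
Qed.
Lemma KfracM P z z' : subgroup P -> Kfrac P z -> Kfrac P z' -> Kfrac P (z * z').
Proof.
move=> sP [f [g [fP gP g0 ->]]] [f' [g' [fP' gP' g0' ->]]].
have PA u v := @subgroupD P u v sP.
exists (f * f'), (g * g'); split; first exact: (suppinM PA fP fP').
- exact: (suppinM PA gP gP').
- exact: phi_neq0M.
- exact: (mulf_div_eq (rmorphM phi f f') (rmorphM phi g g')).
Qed.
Lemma KfracN P z : Kfrac P z -> Kfrac P (- z).
Proof.
move=> [f [g [fP gP g0 ->]]]; exists (- f), g; split=> //; first exact: suppinN.
by rewrite rmorphN mulNr.
Qed.
Lemma Kfrac_phi P f : subgroup P -> suppin P f -> Kfrac P (phi f).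
Proof.
move=> sP fP; exists f, 1; split=> //; first by apply: suppin1; case: sP.
  by rewrite rmorph1 oner_neq0.
by rewrite rmorph1 divr1.
Qed.
Lemma KfracV P z : subgroup P -> Kfrac P z -> Kfrac P z^-1.
Proof.
move=> sP [f [g [fP gP g0 ->]]]; have [f0|f0] := eqVneq (phi f) 0.
  by rewrite f0 mul0r invr0 -(rmorph0 phi); apply: Kfrac_phi => //; apply: suppin0.
by exists g, f; split; rewrite // invfM invrK mulrC.
Qed.
Lemma Kfrac_chi P u : subgroup P -> P u -> Kfrac P (chi u).
Proof. by move=> sP Pu; rewrite chiE; apply: Kfrac_phi => //; apply: suppin_monomial. Qed.
Lemma Kfrac_kap P c : subgroup P -> Kfrac P (kap c).
Proof. by move=> sP; rewrite kapE; apply: Kfrac_phi => //; apply: suppin_monomial; case: sP. Qed.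

Lemma lattice_on_subgroup Q : subgroup (lattice_on Q).
Proof. by split; [exact: lattice_on0|move=> u v; exact: lattice_onB]. Qed.

(** Every character is the product of one on the basis and one of weight 0. *)
Lemma chi_frac u : Kfrac (lattice_on S) (chi u).
Proof.
have sS := lattice_on_subgroup S.
rewrite -chi_split; apply: KfracM => //; first by apply: Kfrac_chi => //; apply: rho_in.
have [|f [g [fP dg ->]]] := @weight0_local (u - rho u).
  by rewrite rhoB (rho_id (rho_in u)) subrr.
exists f, g; split=> //; [by apply: suppinS fP => v []| |exact: denom_neq0].
by apply: suppinS (denom_nonneg dg) => v [].
Qed.

(** * The coordinates are affine functions on the coordinates of the basis *)

(** A grading of the characters on the basis by degrees 0 and 1, with at least one
    coordinate [s] of degree 1: F is the field of rational functions in y_s over the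
    field generated by the characters of degree 0. Two kinds of gradings are used, by
    the degree in one coordinate of the basis and by the total degree. *)
Section Affine.
Variables (h : 'I_n -> int) (s : 'I_n).
Hypotheses (h01 : forall j, j \in S -> h j = 0 \/ h j = 1) (sS : s \in S) (hs : h s = 1).

Definition level u : int := \sum_j u 0 j * h j.
Definition level0 : set 'rV[int]_n := [set u | lattice_on S u /\ level u = 0].

Lemma levelD u v : level (u + v) = level u + level v.
Proof. by rewrite /level -big_split; apply: eq_bigr => j _; rewrite mxE mulrDl. Qed.
Lemma levelN u : level (- u) = - level u.
Proof. by rewrite /level -sumrN; apply: eq_bigr => j _; rewrite mxE mulNr. Qed.
Lemma levelZ z u : level (z *: u) = z * level u.
Proof. by rewrite /level mulr_sumr; apply: eq_bigr => j _; rewrite mxE mulrA. Qed.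
Lemma level_zero : level 0 = 0.
Proof. by rewrite /level big1 // => j _; rewrite mxE mul0r. Qed.
Lemma level_delta j : level (delta_mx 0 j) = h j.
Proof.
rewrite /level (bigD1 j) //= mxE !eqxx mul1r big1 ?addr0 // => i ij.
by rewrite mxE eqxx (negbTE ij) mul0r.
Qed.
Lemma level0_subgroup : subgroup level0.
Proof.
split; first by split; [exact: lattice_on0|exact: level_zero].
move=> u v [uS u0] [vS v0]; split; first exact: lattice_onB.
by rewrite levelD levelN u0 v0 subrr.
Qed.
Let dl : 'rV[int]_n := delta_mx 0 s.
Let level_dl : level dl = 1. Proof. by rewrite level_delta hs. Qed.
Let dlS : lattice_on S dl. Proof. exact: lattice_on_delta. Qed.

Variables (K : fieldType) (iota : {rmorphism K -> F}).
Hypothesis iotaP : forall z, Kfrac level0 z <-> exists y, iota y = z.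
Definition eval (p : {poly K}) : F := (map_poly iota p).[chi dl].

Lemma evalD p q : eval (p + q) = eval p + eval q.
Proof. by rewrite /eval rmorphD hornerD. Qed.
Lemma evalM p q : eval (p * q) = eval p * eval q.
Proof. by rewrite /eval rmorphM hornerM. Qed.
Lemma evalC c : eval c%:P = iota c.
Proof. by rewrite /eval map_polyC hornerC. Qed.
Lemma evalX : eval 'X = chi dl.
Proof. by rewrite /eval map_polyX hornerX. Qed.
Lemma evalXn j : eval 'X^j = chi dl ^+ j.
Proof. by rewrite /eval map_polyXn hornerXn. Qed.
Lemma evalE p : eval p = \sum_(l < size p) iota p`_l * chi dl ^+ l.
Proof.
rewrite /eval horner_coef size_map_poly; apply: eq_bigr => l _.
by rewrite coef_map.
Qed.

(** The coordinate of degree 1 is transcendental over the characters of degree 0. *)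
Lemma level_indep_sum N (f : nat -> laurent k n) : (forall l, suppin level0 (f l)) ->
  \sum_(l < N) phi (f l) * chi dl ^+ l = 0 -> forall l : 'I_N, f l = 0.
Proof.
move=> fP; pose g := \sum_(l < N) monomial 1 (dl *+ l) * f l.
have -> : \sum_(l < N) phi (f l) * chi dl ^+ l = phi g.
  rewrite rmorph_sum; apply: eq_bigr => l _; rewrite mulrC -chiMn chiE.
  exact: esym (rmorphM phi _ _).
move=> /S_algind g0 l; have {}g0 : g = 0.
  apply: g0; apply: suppin_sum => j _ _.
  apply: (suppinM (@lattice_onD _ S) (P := lattice_on S)).
    by apply: suppin_monomial; apply: lattice_onMn.
  by apply: suppinS (fP j) => u [].
apply: galgP => u; rewrite gcoef0.
have [u0|/eqP u0] := eqVneq (level u) 0; last first.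
  by apply/eqP; apply: contra_notT u0 => /fP[].
have el : coef (monomial 1 (dl *+ l) * f l) (u + dl *+ l) = coef (f l) u.
  by rewrite coef_monomialM mul1r addrK.
have er (j : 'I_N) : j != l -> coef (monomial 1 (dl *+ j) * f j) (u + dl *+ l) = 0.
  move=> jl; rewrite coef_monomialM mul1r; apply/eqP.
  apply: contraTT isT => /fP[_]; rewrite levelD levelN levelD u0 add0r.
  rewrite -!scaler_nat !levelZ level_dl !mulr1 => /eqP.
  by rewrite subr_eq0 !natz eqz_nat eq_sym => /eqP/val_inj e; rewrite e eqxx in jl.
have g0u : coef g (u + dl *+ l) = 0 by rewrite g0 gcoef0.
rewrite -[RHS]g0u gcoef_sum (bigD1 l) //=.
exact: esym (etrans (congr2 +%R el (big1 _ _ _ er)) (addr0 _)).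
Qed.

Lemma common_denominator (p : {poly K}) N : exists g (f : nat -> laurent k n),
  [/\ suppin level0 g, phi g != 0, forall l, suppin level0 (f l) &
      forall l, (l < N)%N -> iota p`_l * phi g = phi (f l)].
Proof.
have PA u v := @subgroupD _ u v level0_subgroup.
elim: N => [|N [g [f [gP g0 fP fE]]]].
  exists 1, (fun=> 0); split=> // [||l]; last exact: suppin0.
    by apply: suppin1; case: level0_subgroup.
  by rewrite rmorph1 oner_neq0.
have [f' [g' [fP' gP' g0' e]]] : Kfrac level0 (iota p`_N) by apply/iotaP; exists p`_N.
exists (g * g'), (fun l => if (l == N)%N then f' * g else f l * g'); split.
- exact: (suppinM PA gP gP').
- exact: phi_neq0M.
- by move=> l; case: eqP => _; [exact: (suppinM PA fP' gP)|exact: (suppinM PA (fP l) gP')].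
move=> l; rewrite ltnS leq_eqVlt => /orP[/eqP ->|lN].
  rewrite eqxx e; exact: (div_mul_eq g0' (rmorphM phi g g') (rmorphM phi f' g)).
rewrite ltn_eqF //; exact: (mul_mul_eq (fE l lN) (rmorphM phi g g') (rmorphM phi (f l) g')).
Qed.

Lemma eval_inj0 p : eval p = 0 -> p = 0.
Proof.
have [g [f [gP g0 fP fE]]] := common_denominator p (size p).
move=> p0; have f0 : forall l : 'I_(size p), f l = 0.
  apply: level_indep_sum => //; transitivity (eval p * phi g); last by rewrite p0 mul0r.
  rewrite evalE mulr_suml; apply: eq_bigr => l _.
  by rewrite -fE // mulrAC.
apply/polyP => l; rewrite coef0; have [lp|/leq_sizeP->//] := ltnP l (size p).
have := fE l lp; rewrite (f0 (Ordinal lp)) rmorph0 => /eqP.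
by rewrite mulf_eq0 (negbTE g0) orbF fmorph_eq0 => /eqP.
Qed.

Lemma eval_neq0 p : p != 0 -> eval p != 0.
Proof. by apply: contraNneq => /eval_inj0 ->. Qed.

Lemma eval_inj p q : eval p = eval q -> p = q.
Proof.
move=> e; apply/eqP; rewrite -subr_eq0; apply/eqP/eval_inj0.
by rewrite /eval rmorphB hornerD hornerN -/(eval p) -/(eval q) e subrr.
Qed.

Definition ratio_of : set F := [set z | exists p q : {poly K}, q != 0 /\ z = eval p / eval q].

Lemma ratio_ofD z z' : ratio_of z -> ratio_of z' -> ratio_of (z + z').
Proof.
move=> [p [q [q0 ->]]] [p' [q' [q0' ->]]]; exists (p * q' + p' * q), (q * q').
split; first by rewrite mulf_neq0.
by rewrite evalD !evalM; move: (eval_neq0 q0) (eval_neq0 q0') => c c'; field; rewrite c c'.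
Qed.
Lemma ratio_ofM z z' : ratio_of z -> ratio_of z' -> ratio_of (z * z').
Proof.
move=> [p [q [q0 ->]]] [p' [q' [q0' ->]]]; exists (p * p'), (q * q').
split; first by rewrite mulf_neq0.
by rewrite !evalM invfM mulrACA.
Qed.
Lemma ratio_ofV z : ratio_of z -> ratio_of z^-1.
Proof.
move=> [p [q [q0 ->]]]; have [->|p0] := eqVneq p 0.
  exists 0, 1; split; first exact: oner_neq0.
  by rewrite /eval !rmorph0 horner0 !mul0r invr0.
by exists q, p; split; rewrite // invfM invrK mulrC.
Qed.
Lemma ratio_of_eval p : ratio_of (eval p).
Proof. by exists p, 1; rewrite oner_neq0 /eval rmorph1 hornerC divr1. Qed.
Lemma ratio_of_level0 z : Kfrac level0 z -> ratio_of z.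
Proof. by move=> /iotaP[y <-]; rewrite -evalC; apply: ratio_of_eval. Qed.

Lemma ratio_of_chiS u : lattice_on S u -> ratio_of (chi u).
Proof.
move=> uS; rewrite -[u](subrK (level u *: dl)) chiD; apply: ratio_ofM.
  apply: ratio_of_level0; apply: Kfrac_chi; first exact: level0_subgroup.
  split; first by apply: lattice_onB => //; apply: lattice_onZ.
  by rewrite levelD levelN levelZ level_dl mulr1 subrr.
have [N [->|->]] := int_nat_cases (level u); rewrite -natz ?scaleNr scaler_nat.
  by rewrite chiMn -evalXn; apply: ratio_of_eval.
by rewrite chiN chiMn -evalXn; apply/ratio_ofV/ratio_of_eval.
Qed.

Lemma ratio_of_all : Kfrac (lattice_on S) `<=` ratio_of.
Proof.
have phi_ratio f : suppin (lattice_on S) f -> ratio_of (phi f).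
  move=> fS; rewrite phiE big_seq; apply: (big_ind ratio_of).
  - by rewrite -(rmorph0 iota) -evalC; apply: ratio_of_eval.
  - exact: ratio_ofD.
  move=> u; rewrite mem_supp => fu; apply: ratio_ofM; last by apply: ratio_of_chiS; apply: fS.
  by apply: ratio_of_level0; exact: Kfrac_kap level0_subgroup.
move=> z [f [g [fS gS g0 ->]]]; apply: ratio_ofM; first exact: phi_ratio.
by apply/ratio_ofV/phi_ratio.
Qed.

Lemma chi_ratio u : exists pq : {poly K} * {poly K},
  [/\ pq.1 != 0, pq.2 != 0 & chi u = eval pq.1 / eval pq.2].
Proof.
have [p [q [q0 e]]] := ratio_of_all (chi_frac u); exists (p, q); split=> //=.
apply: contraTneq (chi_neq0 phi u) => p0; rewrite e p0 /eval rmorph0 horner0 mul0r.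
by rewrite eqxx.
Qed.

Lemma eval_ratio_eq p q p' q' : q != 0 -> q' != 0 ->
  eval p / eval q = eval p' / eval q' -> p * q' = p' * q.
Proof.
move=> q0 q0' e; apply: eval_inj; rewrite !evalM; apply/eqP.
by rewrite -eqr_div ?eval_neq0 //; apply/eqP.
Qed.

(** The values of the characters at a discrete valuation, trivial on the characters of
    level 0, define a point of N_R; it is tropical since the functions of positive value
    have the properties required by [Trop_place]. *)
Lemma valuation_center nu : poly_valuation nu -> exists w, levels M w /\
  forall u p q, p != 0 -> q != 0 -> chi u = eval p / eval q ->
    pairing u w = (nu p - nu q)%:~R.
Proof.
move=> [nuM nuC nuD]; have [pq pqP] := choice chi_ratio.
pose V u := nu (pq u).1 - nu (pq u).2.
have VE u p q : p != 0 -> q != 0 -> chi u = eval p / eval q -> V u = nu p - nu q.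
  move=> p0 q0; have [p0' q0' ->] := pqP u => /(eval_ratio_eq q0' q0) e.
  have := congr1 nu e; rewrite !nuM // /V.
  by move: (nu _) (nu q) (nu p) (nu _) => *; lia.
have VD u v : V (u + v) = V u + V v.
  have [p0 q0 e] := pqP u; have [p0' q0' e'] := pqP v.
  rewrite (VE _ ((pq u).1 * (pq v).1) ((pq u).2 * (pq v).2)) ?mulf_neq0 //.
    by rewrite !nuM // /V opprD addrACA.
  by rewrite chiD e e' !evalM invfM mulrACA.
pose w : 'rV[R]_n := \row_j (V (delta_mx 0 j))%:~R.
have wV u : pairing u w = (V u)%:~R by rewrite (additive_pairing R u VD).
exists w; split; last by move=> u p q p0 q0 e; rewrite wV (VE u p q).
apply: (fan_levels lf); rewrite -TropY.
pose mv : set F := [set z | exists p q : {poly K},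
  [/\ q != 0, p = 0 \/ nu q < nu p & z = eval p / eval q]].
have mv0 : mv 0.
  by exists 0, 1; split; rewrite ?oner_neq0 //; [left|rewrite /eval rmorph0 horner0 mul0r].
have eval0 : eval 0 = 0 by rewrite /eval rmorph0 horner0.
apply: (@Trop_place k R n Y F phi mv) => //.
- by move=> f /kerphi.
- move=> [p [q [q0 hp e]]].
  have [p0|p0] := eqVneq p 0.
    by move/eqP: e; rewrite p0 eval0 mul0r oner_eq0.
  have pq1 : p = q.
    by apply: eval_inj; apply: (divIf (eval_neq0 q0)); rewrite divff ?eval_neq0.
  by case: hp => [/eqP|]; [rewrite (negbTE p0)|rewrite pq1 ltxx].
- move=> _ _ [p [q [q0 hp ->]]] [p' [q' [q0' hp' ->]]].
  have [->|p0] := eqVneq p 0; first by rewrite eval0 mul0r add0r; exists p', q'.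
  have [->|p0'] := eqVneq p' 0; first by rewrite eval0 mul0r addr0; exists p, q.
  exists (p * q' + p' * q), (q * q'); split; first by rewrite mulf_neq0.
    have [->|s0] := eqVneq (p * q' + p' * q) 0; [by left|right].
    case: hp hp' => [/eqP|hp]; [by rewrite (negbTE p0)|].
    case=> [/eqP|hp']; first by rewrite (negbTE p0').
    have := nuD _ _ (mulf_neq0 p0 q0') (mulf_neq0 p0' q0) s0; rewrite !nuM //.
    apply: lt_le_trans; move: hp hp'.
    by move: (nu q) (nu p) (nu q') (nu p') => x1 x2 x3 x4; lia.
  rewrite evalD !evalM; move: (eval_neq0 q0) (eval_neq0 q0') => c c'.
  by field; rewrite c c'.
move=> c u u0; rewrite phi_monomial; have [->|c0] := eqVneq c 0.
  by rewrite kap0 mul0r.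
have [y yE] : exists y, iota y = kap c.
  by apply/iotaP; apply: Kfrac_kap level0_subgroup.
have y0 : y != 0 by rewrite -(fmorph_eq0 iota) yE kap_neq0.
have [p0 q0 e] := pqP u; exists (y%:P * (pq u).1), (pq u).2; split=> //.
  right; rewrite nuM ?polyC_eq0 // nuC // add0r -subr_gt0 -/(V u).
  by move: u0; rewrite wV ltr0z.
by rewrite e evalM evalC yE mulrA.
Qed.

(** The characters of the basis are those of level 0 or their products with y_s, so
    that at the center they have weight 0 or that of y_s; the least weight is attained
    on the basis. *)
Lemma center_min nu w i : poly_valuation nu -> levels M w ->
  (forall u p q, p != 0 -> q != 0 -> chi u = eval p / eval q ->
    pairing u w = (nu p - nu q)%:~R) ->
  Num.min 0 (nu 'X)%:~R <= hat w i.
Proof.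
move=> [nuM nuC nuD] lw wE; apply: (levels_min lf ad lw) => l.
have X0 : ('X : {poly K}) != 0 by rewrite polyX_eq0.
have nu1 : nu 1 = 0 by rewrite nuC ?oner_neq0.
have eval1 : eval 1 = 1 by rewrite /eval rmorph1 hornerC.
have unit_level0 u : level0 u -> exists2 y, y != 0 & chi u = iota y.
  move=> u0; have [y yE] := (iotaP _).1 (Kfrac_chi level0_subgroup u0).
  by exists y => //; rewrite -(fmorph_eq0 iota) yE chi_neq0.
have [lev|lev] : level (eps (b l)) = 0 \/ level (eps (b l)) = 1.
  case: (unliftP ord0 (b l)) => [j e|->]; last by rewrite eps0 level_zero; left.
  by rewrite e eps_lift level_delta; apply: h01; rewrite inE -e betab.
  have [y y0 yE] : exists2 y, y != 0 & chi (eps (b l)) = iota y.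
    by apply: unit_level0; split=> //; exact: eps_b_in.
  rewrite -pairing_eps (wE _ y%:P 1) ?polyC_eq0 ?oner_neq0 //.
    by rewrite nuC // nu1 subrr mulr0z ge_min lexx.
  by rewrite evalC eval1 divr1.
have [y y0 yE] : exists2 y, y != 0 & chi (eps (b l) - dl) = iota y.
  apply: unit_level0; split; last by rewrite levelD levelN lev level_dl subrr.
  by apply: lattice_onB => //; exact: eps_b_in.
rewrite -pairing_eps (wE _ (y%:P * 'X) 1) ?mulf_neq0 ?polyC_eq0 ?oner_neq0 //.
  by rewrite nuM ?polyC_eq0 // nuC // nu1 add0r subr0 ge_min lexx orbT.
by rewrite evalM evalC evalX eval1 divr1 -yE -chiD subrK.
Qed.

(** By [center_min] the value of y_i is nonnegative at the valuation of an irreducible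
    polynomial, and at least -1 at infinity: an irreducible factor of the denominator,
    or a numerator of larger degree, would contradict it. *)
Lemma chi_affine i : exists a0 a1, chi (eps i) = iota a0 + iota a1 * chi dl.
Proof.
have [[p1 q1] /= [p10 q10 e1]] := chi_ratio (eps i).
have [p [q [p0 q0 cpq e]]] : exists p q, [/\ p != 0, q != 0, coprimep p q &
    chi (eps i) = eval p / eval q].
  have g0 : gcdp p1 q1 != 0 by rewrite gcdp_eq0 negb_and p10.
  have pE : p1 = p1 %/ gcdp p1 q1 * gcdp p1 q1 by rewrite divpK // dvdp_gcdl.
  have qE : q1 = q1 %/ gcdp p1 q1 * gcdp p1 q1 by rewrite divpK // dvdp_gcdr.
  exists (p1 %/ gcdp p1 q1), (q1 %/ gcdp p1 q1); split.
  - by apply: contraNneq p10 => z; rewrite pE z mul0r.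
  - by apply: contraNneq q10 => z; rewrite qE z mul0r.
  - by apply: coprimep_div_gcd; rewrite p10.
  have ep := congr1 eval pE; have eq := congr1 eval qE; rewrite !evalM in ep eq.
  by rewrite e1 ep eq -mulf_div divff ?mulr1 // eval_neq0.
have q1s : size q = 1%N.
  apply/eqP; apply: contraT => sq.
  have [|r irr rq] := @irreducible_factor K q.
    by rewrite ltn_neqAle eq_sym sq size_poly_gt0.
  have rp : ~~ (r %| p).
    apply/negP => rp; have /coprimepP/(_ r rp rq) := cpq.
    by rewrite -size_poly_eq1; case: irr => + _; case: (size r) => [|[]].
  have [w [lw wE]] := valuation_center (ord_valuation irr).
  have /= := center_min i (ord_valuation irr) lw wE; rewrite -pairing_eps (wE _ p q) //.
  have oq := ordq_gt0 irr q0 rq; rewrite (ordq_eq0 irr p0 rp) sub0r.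
  by rewrite min_l ler0z // oppr_ge0 lez_nat leqNgt oq.
have /size_poly1P[c c0 qc] : size q == 1%N by rewrite q1s.
have sp : (size p <= 2)%N.
  have [w [lw wE]] := valuation_center (degree_valuation K).
  have /= := center_min i (degree_valuation K) lw wE; rewrite -pairing_eps (wE _ p q) //.
  rewrite q1s size_polyX /= subr0 min_r; last by rewrite lerz0.
  rewrite ler_int lerN2 lez_nat.
  by case: (size p) => [|[|[|]]].
exists (p`_0 / c), (p`_1 / c); rewrite e qc evalC.
have -> : eval p = iota p`_0 + iota p`_1 * chi dl.
  rewrite /eval (horner_coef_wide _ (_ : _ <= 2)%N); last by rewrite size_map_poly.
  by rewrite !big_ord_recl big_ord0 /= !coef_map expr0 expr1 mulr1 addr0.
by rewrite !fmorph_div mulrDl mulrAC.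
Qed.
End Affine.

Definition affine_wrt (h : 'I_n -> int) (s : 'I_n) : set F :=
  [set z | exists a0 a1, [/\ Kfrac (level0 h) a0, Kfrac (level0 h) a1 &
                              z = a0 + a1 * chi (delta_mx 0 s)]].
Definition zero_one (h : 'I_n -> int) (s : 'I_n) :=
  [/\ forall j, j \in S -> h j = 0 \/ h j = 1, s \in S & h s = 1].

Lemma chi_affine_wrt h s i : zero_one h s -> affine_wrt h s (chi (eps i)).
Proof.
move=> [h01 sS hs]; have sG := level0_subgroup h.
have [|||K [iota iotaP]] := @subfieldP F (Kfrac (level0 h)).
- by move=> y z Ky Kz; apply: KfracD => //; apply: KfracN.
- by move=> y z Ky Kz; apply: KfracM => //; apply: KfracV.
- by rewrite -(rmorph1 phi); apply: Kfrac_phi => //; apply: suppin1; case: sG.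
have [a0 [a1 e]] := chi_affine h01 sS hs iotaP i.
by exists (iota a0), (iota a1); split=> //; apply/iotaP; [exists a0|exists a1].
Qed.

Lemma affine_wrtB h s z z' : affine_wrt h s z -> affine_wrt h s z' -> affine_wrt h s (z - z').
Proof.
have sG := level0_subgroup h.
move=> [a0 [a1 [K0 K1 ->]]] [c0 [c1 [L0 L1 ->]]]; exists (a0 - c0), (a1 - c1).
split; first by apply: KfracD => //; apply: KfracN.
  by apply: KfracD => //; apply: KfracN.
by rewrite mulrBl opprD addrACA.
Qed.

Lemma affine_wrt_basis h s c l : zero_one h s -> affine_wrt h s (kap c * chi (eps (b l))).
Proof.
move=> [h01 sS hs]; have sG := level0_subgroup h.
have Kk : Kfrac (level0 h) (kap c).
  exact: Kfrac_kap.
have K0 : Kfrac (level0 h) 0.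
  by rewrite -(rmorph0 phi); apply: Kfrac_phi => //; apply: suppin0.
have [lev|lev] : level h (eps (b l)) = 0 \/ level h (eps (b l)) = 1.
  case: (unliftP ord0 (b l)) => [j e|->]; last by rewrite eps0 level_zero; left.
  by rewrite e eps_lift level_delta; apply: h01; rewrite inE -e betab.
  have Kb : Kfrac (level0 h) (chi (eps (b l))).
    by apply: (Kfrac_chi sG); split; [exact: eps_b_in|].
  exists (kap c * chi (eps (b l))), 0.
  by split; [exact: (KfracM sG Kk Kb)|exact: K0|by rewrite (mul0r (chi (delta_mx 0 s))) addr0].
have Kb : Kfrac (level0 h) (chi (eps (b l) - delta_mx 0 s)).
  apply: (Kfrac_chi sG); split; last by rewrite levelD levelN lev level_delta hs subrr.
  by apply: lattice_onB; [exact: eps_b_in|exact: lattice_on_delta].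
have e : chi (eps (b l)) = chi (eps (b l) - delta_mx 0 s) * chi (delta_mx 0 s).
  by rewrite -chiD subrK.
exists 0, (kap c * chi (eps (b l) - delta_mx 0 s)).
split; [exact: K0|exact: (KfracM sG Kk Kb)|].
by rewrite e mulrA (add0r (_ * _ * _)).
Qed.

(** * Leading terms and linear dependence *)

(** The leading term of [z] for the monomial valuation of weight [w0] is [c] times the
    character [u]. *)
Definition has_lead z c u := [/\ c != 0, lattice_on S u & m (z / chi u - kap c)].

Lemma O_kap c : O (kap c).
Proof. by rewrite kapE; apply: frac_in; apply: suppin_monomial; apply: nonneg0. Qed.
Lemma mD z z' : m z -> m z' -> m (z + z').
Proof. by have [_ mD _] := m_ideal; apply: mD. Qed.
Lemma mM z z' : O z -> m z' -> m (z * z').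
Proof. by have [_ _ mM] := m_ideal; apply: mM. Qed.
Lemma mN z : m z -> m (- z).
Proof. by rewrite -mulN1r; apply: mM; apply: subring_setN O_ring _; case: O_ring. Qed.
Lemma m1 : ~ m 1.
Proof. by move=> /O_local[]; rewrite subrr eqxx. Qed.
Lemma m_kap c : m (kap c) -> c = 0.
Proof.
move=> mk; apply/eqP; apply: contraT => c0; exfalso; apply: m1.
by have := mM (O_kap c^-1) mk; rewrite kapV.
Qed.

Lemma lead_O z c u : has_lead z c u -> O (z / chi u).
Proof.
move=> [_ _ mz]; rewrite -[_ / _](subrK (kap c)); apply: (subring_setD O_ring); last exact: O_kap.
exact: m_sub.
Qed.

Lemma chi_m u : lattice_on S u -> 0 < pairing u w0 -> m (chi u).
Proof. by move=> uS u0; rewrite chiE; apply: frac_in; apply: suppin_monomial; split. Qed.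

Lemma lead_div_m z c u v : has_lead z c u -> lattice_on S v -> pairing v w0 < pairing u w0 ->
  m (z / chi v).
Proof.
move=> lz vS lt; have -> : z / chi v = (z / chi u) * chi (u - v).
  by rewrite chiB; move: (chi_neq0 phi u) (chi_neq0 phi v) => c1 c2; field; rewrite c1 c2.
apply: mM; first exact: lead_O lz.
apply: chi_m; last by rewrite pairingB subr_gt0.
by apply: lattice_onB => //; case: lz.
Qed.

Lemma has_lead_uniq z c u c' u' : has_lead z c u -> has_lead z c' u' -> u = u'.
Proof.
have half d1 v1 d2 v2 : has_lead z d1 v1 -> has_lead z d2 v2 -> ~ pairing v1 w0 < pairing v2 w0.
  move=> [d10 v1S mz] l2 lt; move/eqP: d10; apply; apply: m_kap.
  have -> : kap d1 = z / chi v1 - (z / chi v1 - kap d1) by rewrite subKr.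
  by apply: mD; [exact: (lead_div_m l2)|exact: mN].
move=> l l'; case: (l) (l') => _ uS _ [_ u'S _]; apply: S_inj => //.
by apply/eqP; rewrite eq_le !leNgt; apply/andP; split; apply/negP;
  [exact: half l' l|exact: half l l'].
Qed.

Lemma has_leadD z c u z' c' u' : has_lead z c u -> has_lead z' c' u' ->
  pairing u w0 < pairing u' w0 -> has_lead (z + z') c u.
Proof.
move=> [c0 uS mz] l' lt; split=> //.
by rewrite mulrDl addrAC; apply: mD => //; apply: (lead_div_m l').
Qed.

Lemma has_leadM z c u v : lattice_on S v -> has_lead z c u -> has_lead (z * chi v) c (u + v).
Proof.
move=> vS [c0 uS mz]; split=> //; first exact: lattice_onD.
by rewrite chiD invfM mulrACA divff ?chi_neq0 // mulr1.
Qed.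

Lemma Kfrac_lead P z : subgroup P -> P `<=` lattice_on S -> Kfrac P z -> z != 0 ->
  exists c u, P u /\ has_lead z c u.
Proof.
move=> sP PS [f [g [fP gP g0 zE]]] z0.
have lead1 f1 : suppin P f1 -> phi f1 != 0 -> exists c u g1,
    [/\ c != 0, P u, denom g1 & phi f1 = kap c * chi u * phi g1].
  move=> f1P f10; have f1n : f1 != 0 by apply: contraNneq f10 => ->; rewrite rmorph0.
  have f1S : suppin (lattice_on S) f1 by apply: suppinS f1P.
  have [u fu uP] := lead_exists (lam := fun u => pairing u w0) S_inj f1S f1n.
  set c := coef f1 u in fu uP *.
  exists c, u, (monomial c^-1 (- u) * f1); split; [exact: fu|exact: f1P| |].
    have e : monomial c^-1 (- u) * f1 - 1 =
        monomial c^-1 (- u) * (f1 - monomial c u) :> laurent k n.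
      by rewrite mulrBr; congr (_ - _); apply: esym; exact: monomialV.
    rewrite /denom /= e; apply: (suppinM (P := [set - u]) _ _ uP).
      move=> v1 v /= -> [vS uv]; split; first by apply: lattice_onD => //;
        apply: lattice_onN; apply: f1S.
      by rewrite pairingD pairingN addrC subr_gt0.
    exact: suppin_monomial.
  apply: cancel_mul_eq (rmorphM phi (monomial c^-1 (- u)) f1).
  by rewrite phi_monomial chiN mulrACA divff ?chi_neq0 // mulr1 mulrC kapV.
have f0 : phi f != 0 by apply: contraNneq z0 => e; rewrite zE e mul0r.
have [c [u [f1 [c0 uP df fE]]]] := lead1 f fP f0.
have [c' [u' [g1 [c0' uP' dg gE]]]] := lead1 g gP g0.
exists (c / c'), (u - u'); split; first exact: sP.2.
split; first by rewrite mulf_neq0 ?invr_eq0.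
  by apply: PS; apply: sP.2.
have kc : kap (c / c') = kap c / kap c'.
  by apply: (mulIf (kap_neq0 phi c0')); rewrite -kapM !divfK // kap_neq0.
have -> : z / chi (u - u') - kap (c / c') = kap (c / c') * (phi (f1 - g1) / phi g1).
  rewrite zE fE gE kc chiB rmorphB.
  move: (kap_neq0 phi c0) (kap_neq0 phi c0') (chi_neq0 phi u) (chi_neq0 phi u') (denom_neq0 dg).
  move: (kap c) (kap c') (chi u) (chi u') (phi f1) (phi g1) => x1 x2 x3 x4 x5 x6 h1 h2 h3 h4 h5.
  by field; rewrite h2 h3 h4 h5.
apply: mM; first exact: O_kap.
exists (f1 - g1), g1; split=> //.
have -> : f1 - g1 = (f1 - 1) - (g1 - 1) by rewrite opprB addrA subrK.
exact: suppinB.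
Qed.

(** The leading terms of the two summands of an affine function have different degrees,
    hence do not cancel. *)
Lemma affine_lead h s z c u : zero_one h s -> affine_wrt h s z -> z != 0 -> has_lead z c u ->
  level h u = 0 \/ level h u = 1.
Proof.
move=> [h01 sS hs] [a0 [a1 [K0 K1 zE]]] z0 lz; have sG := level0_subgroup h.
have LS : level0 h `<=` lattice_on S by move=> v [].
have dS : lattice_on S (delta_mx 0 s) by apply: lattice_on_delta.
have lev1 v : level h v = 0 -> level h (v + delta_mx 0 s) = 1.
  by move=> v0; rewrite levelD v0 level_delta hs add0r.
have [a00|a00] := eqVneq a0 0.
  have a10 : a1 != 0 by apply: contraNneq z0 => e; rewrite zE a00 e mul0r addr0.
  have [c1 [v [[vS v0] lv]]] := Kfrac_lead sG LS K1 a10.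
  have := has_leadM dS lv; rewrite -[_ * _]add0r -a00 -zE => lz'.
  by right; rewrite (has_lead_uniq lz lz') lev1.
have [c1 [v [[vS v0] lv]]] := Kfrac_lead sG LS K0 a00.
have [a10|a10] := eqVneq a1 0.
  move: lv; rewrite -[a0]addr0 -(mul0r (chi (delta_mx 0 s))) -a10 -zE => lz'.
  by left; rewrite (has_lead_uniq lz lz').
have [c2 [v' [[vS' v0'] lv']]] := Kfrac_lead sG LS K1 a10.
have := has_leadM dS lv'; set v2 := v' + _ => lv2.
have v2S : lattice_on S v2 by apply: lattice_onD.
have [lt|lt|e] := ltgtP (pairing v w0) (pairing v2 w0).
- have := has_leadD lv lv2 lt; rewrite -zE => lz'.
  by left; rewrite (has_lead_uniq lz lz').
- have := has_leadD lv2 lv lt; rewrite addrC -zE => lz'.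
  by right; rewrite (has_lead_uniq lz lz') lev1.
- have := S_inj vS v2S e => ev; have := lev1 _ v0'; rewrite -/v2 -ev v0 => /esym/eqP.
  by rewrite oner_eq0.
Qed.

Definition all_affine : set F :=
  [set z | Kfrac (lattice_on S) z /\ forall h s, zero_one h s -> affine_wrt h s z].

(** An exponent with entries 0 and 1 and total degree 0 or 1 is 0 or a unit vector; 0 is
    the exponent of the element 0. *)
Lemma all_affine_lead z c u : all_affine z -> z != 0 -> has_lead z c u ->
  exists l, u = eps (b l).
Proof.
move=> [_ za] z0 lz; have uS : lattice_on S u by case: lz.
have u01 j : j \in S -> u 0 j = 0 \/ u 0 j = 1.
  move=> jS; pose h i : int := (i == j)%:R.
  have hz : zero_one h j.
    by split; rewrite /h ?eqxx // => i _; case: eqP; [right|left].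
  suff <- : level h u = u 0 j by apply: (affine_lead hz (za _ _ hz) z0 lz).
  rewrite /level (bigD1 j) //= /h eqxx mulr1 big1 ?addr0 // => i /negbTE ->.
  by rewrite mulr0.
have [->|u0] := eqVneq u 0; first by exists (beta ord0); rewrite (adapted0 ad) eps0.
have [j uj] : exists j, u 0 j != 0.
  apply: contra_neqP u0 => nex; apply/rowP => j; rewrite mxE; apply/eqP.
  by apply: contra_notT nex => uj; exists j.
have jS : j \in S by apply: contraNT uj => /uS ->.
have {}uj : u 0 j = 1 by case: (u01 j jS) uj => [->|//]; rewrite eqxx.
have hz : zero_one (fun=> 1) j by split=> //; right.
have lev := affine_lead hz (za _ _ hz) z0 lz.
have ge0 i : 0 <= u 0 i.
  by have [/u01[]->|/uS ->] := boolP (i \in S).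
have rest i : i != j -> u 0 i = 0.
  move=> ij; apply/eqP; rewrite eq_le ge0 andbT.
  have : level (fun=> 1) u <= 1 by case: lev => ->.
  rewrite /level (bigD1 j) //= uj mulr1 gerDl (bigD1 i) //= mulr1.
  by apply: le_trans; rewrite lerDl; apply: sumr_ge0 => l _; rewrite mulr1.
exists (beta (lift ord0 j)); move: jS; rewrite inE => /eqP ->; rewrite eps_lift.
by apply/rowP => i; rewrite mxE eqxx /=; case: eqVneq => [->//|/rest].
Qed.

(** Subtracting the leading term, which is a constant times a coordinate of the basis,
    keeps the function affine and increases the weight; only d + 1 weights can occur. *)
Lemma all_affine_linear z : all_affine z ->
  exists A : 'I_d.+1 -> k, z = \sum_l kap (A l) * chi (eps (b l)).
Proof.
pose count u := #|[pred l | pairing u w0 <= pairing (eps (b l)) w0]|.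
suff main N y : all_affine y -> (y = 0 \/ exists c u, has_lead y c u /\ (count u <= N)%N) ->
    exists A : 'I_d.+1 -> k, y = \sum_l kap (A l) * chi (eps (b l)).
  move=> za; apply: (main d.+1 z za); have [->|z0] := eqVneq z 0; [by left|right].
  have [c [u [_ lz]]] := Kfrac_lead (lattice_on_subgroup S) (@subset_refl _ _) za.1 z0.
  by exists c, u; split=> //; rewrite -[X in (_ <= X)%N]card_ord max_card.
elim: N y => [|N IH] y ya.
  case=> [->|[c [u [ly]]]].
    by exists (fun=> 0); rewrite big1 // => l _; rewrite kap0 mul0r.
  have [->|y0] := eqVneq y 0.
    by exists (fun=> 0); rewrite big1 // => l _; rewrite kap0 mul0r.
  have [l ul] := all_affine_lead ya y0 ly.
  rewrite leqn0 => /eqP/card0_eq/(_ l).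
  by rewrite inE ul lexx.
case=> [->|[c [u [ly cu]]]].
  by exists (fun=> 0); rewrite big1 // => l _; rewrite kap0 mul0r.
have [->|y0] := eqVneq y 0.
  by exists (fun=> 0); rewrite big1 // => l _; rewrite kap0 mul0r.
have [l ul] := all_affine_lead ya y0 ly.
pose y1 := y - kap c * chi (eps (b l)).
have ya1 : all_affine y1.
  split; last by move=> h s hz; apply: affine_wrtB; [exact: ya.2|exact: affine_wrt_basis].
  have sS := lattice_on_subgroup S.
  apply: KfracD => //; [exact: ya.1|apply: KfracN; rewrite -phi_monomial; apply: Kfrac_phi => //].
  by apply: suppin_monomial; exact: eps_b_in.
have [|A AE] := IH y1 ya1.
  have [->|y10] := eqVneq y1 0; [by left|right].
  have [c1 [u1 [_ l1]]] := Kfrac_lead (lattice_on_subgroup S) (@subset_refl _ _) ya1.1 y10.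
  exists c1, u1; split=> //; rewrite -ltnS (leq_trans _ cu) //.
  have lt : pairing u w0 < pairing u1 w0.
    rewrite ltNge; apply/negP => le; case: (l1) => c10 u1S my1.
    have uS : lattice_on S u by case: ly.
    move/eqP: c10; apply; apply: m_kap.
    have -> : kap c1 = y1 / chi u1 - (y1 / chi u1 - kap c1) by rewrite subKr.
    apply: mD; last exact: mN.
    have -> : y1 / chi u1 = chi (u - u1) * (y / chi u - kap c).
      rewrite /y1 -ul chiB; move: (chi_neq0 phi u) (chi_neq0 phi u1) => h1 h2.
      by field; rewrite h1 h2.
    apply: mM; last by case: ly.
    rewrite chiE; apply: frac_in; apply: suppin_monomial; split; first exact: lattice_onB.
    by rewrite pairingB subr_ge0.
  apply: proper_card; apply/properP; split.
    by apply/fintype.subsetP => j; rewrite !inE; apply: le_trans; exact: ltW.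
  by exists l; rewrite !inE -ul ?lexx // -ltNge.
exists (fun j => A j + (j == l)%:R * c).
rewrite -[LHS](subrK (kap c * chi (eps (b l)))) -/y1 AE [in RHS](bigD1 l) //=.
rewrite [X in X + _](bigD1 l) //= eqxx mul1r kapD mulrDl addrAC; congr (_ + _).
by apply: eq_bigr => j /negbTE ->; rewrite mul0r addr0.
Qed.

Lemma chi_linear i : exists A : 'I_d.+1 -> k,
  chi (eps i) = \sum_l kap (A l) * chi (eps (b l)).
Proof.
apply: all_affine_linear; split; first exact: chi_frac.
by move=> h s; apply: chi_affine_wrt.
Qed.

End Forward.

(** * Orthogonality and realizations by vectors *)

Section Orthogonal.
Variables (k : fieldType) (N : nat).
Implicit Types (U : {vspace 'rV[k]_N}) (x u : 'rV[k]_N).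

(** The values of the linear form [u], as matrices of size 1. *)
Definition dot u x : 'rV[k]_1 := x *m u^T.

Let basis_mx U : 'M[k]_(\dim U, N) := \matrix_i tnth (vbasis U) i.
Let dots U x : 'rV[k]_(\dim U) := x *m (basis_mx U)^T.
Let dots_linear U : linear (dots U).
Proof. by move=> c x y; rewrite /dots mulmxDl scalemxAl. Qed.
HB.instance Definition _ U := GRing.isLinear.Build k _ _ _ (dots U) (dots_linear U).

(** The orthogonal, as the kernel of the map given by a basis of [U]. *)
Definition orth U : {vspace 'rV[k]_N} := lker (linfun (dots U)).

Let dotsE U x j : dots U x 0 j = dot (tnth (vbasis U) j) x 0 0.
Proof. by rewrite !mxE; apply: eq_bigr => l _; rewrite !mxE. Qed.

Lemma mem_orth U x : reflect (forall u, u \in U -> dot u x = 0) (x \in orth U).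
Proof.
rewrite memv_ker lfunE /=; apply: (iffP eqP) => [x0 u uU|xU].
  rewrite (coord_vbasis uU) /dot linear_sum mulmx_sumr big1 // => j _.
  rewrite linearZ -scalemxAr; apply/rowP => l; rewrite ord1 [RHS]mxE mxE.
  have e : dot (vbasis U)`_j x 0 0 = 0 by rewrite -tnth_nth -dotsE x0 mxE.
  by rewrite [X in _ * X](_ : _ = 0) ?mulr0 //; exact: e.
by apply/rowP => j; rewrite dotsE xU ?mxE //; apply: vbasis_mem; exact: mem_tnth.
Qed.

Lemma dim_orth U : \dim (orth U) = (N - \dim U)%N.
Proof.
have free_basis : row_free (basis_mx U).
  apply: inj_row_free => v v0; apply/rowP => j; rewrite mxE.
  have /freeP/(_ (v 0)) := basis_free (vbasisP U); apply.
  rewrite -[RHS]v0; apply/rowP => l; rewrite summxE !mxE; apply: eq_bigr => i _.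
  by rewrite !mxE (tnth_nth 0).
have [C BC] := row_freeP free_basis.
have im : limg (linfun (dots U)) = fullv.
  apply/eqP; rewrite eqEsubv subvf; apply/subvP => y _.
  rewrite -[y](_ : linfun (dots U) (y *m C^T) = y) ?memv_img ?memvf //.
  by rewrite lfunE /= /dots -mulmxA -trmx_mul BC trmx1 mulmx1.
have := limg_ker_dim (linfun (dots U)) fullv.
by rewrite capfv im !dimvf /dim /= !mul1n => e; have := congr1 (subn^~ (\dim U)) e; rewrite /= addnK.
Qed.

Lemma orth_sum (I : finType) (P : pred I) (U : I -> {vspace 'rV[k]_N}) :
  orth (\sum_(i | P i) U i)%VS = (\bigcap_(i | P i) orth (U i))%VS.
Proof.
apply/eqP; rewrite eqEsubv; apply/andP; split.
  apply/subv_bigcapP => i Pi; apply/subvP => x /mem_orth xU; apply/mem_orth => u uU.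
  by apply: xU; apply: subvP uU; apply: (sumv_sup i).
apply/subvP => x xU; apply/mem_orth => _ /memv_sumP[u uU ->].
rewrite /dot linear_sum mulmx_sumr big1 // => i Pi.
have /mem_orth : x \in orth (U i) by apply: subvP xU; apply: (bigcapv_inf i).
by apply; apply: uU.
Qed.

Lemma hyperplane_orth U : (\dim U).+1 = N -> exists u, U = orth <[u]>%VS.
Proof.
move=> dU; have : (\dim (orth U) != 0)%N by have := dim_orth U; lia.
rewrite dimv_eq0 => U0; exists (vpick (orth U)); apply/eqP.
have v0 : vpick (orth U) != 0 by rewrite vpick0.
have := dim_orth <[vpick (orth U)]>; rewrite dim_vline v0 /= => dv.
rewrite eqEdim; apply/andP; split; last first.
  by rewrite dv; move: (\dim U) dU => D <-; rewrite subn1.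
apply/subvP => x xU.
apply/mem_orth => _ /vlineP[c ->].
have /mem_orth/(_ _ xU) := memv_pick (orth U); rewrite /dot => /(congr1 trmx).
by rewrite trmx_mul trmxK trmx0 linearZ -scalemxAr => ->; rewrite scaler0.
Qed.
End Orthogonal.

Section Ranks.
Variables (k : fieldType) (n : nat) (M : matroid 'I_n.+1).
Hypothesis lf : loop_free M.
Notation E := 'I_n.+1.
Notation d := (mdim M).
Implicit Types (r : E -> 'rV[k]_d.+1) (A S F : {set E}).

Definition span_of r S := (\sum_(i in S) <[r i]>)%VS.
Definition represents r := forall S, \dim (span_of r S) = mrank M S.

(** The hyperplanes are the orthogonals of the vectors, and intersections of
    orthogonals are orthogonals of sums. *)
Lemma represents_realizable r : represents r -> realizable k M.
Proof.
move=> rM; exists (fun i => orth <[r i]>%VS) => [i|S _].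
  have := rM [set i]%SET; rewrite /span_of big_set1 => e.
  by rewrite dim_orth e mrank_indep ?lf // cards1 subn1.
by rewrite -orth_sum dim_orth mrank_flat_span rM subKn // mrank_le_dim.
Qed.

Lemma realizable_represents : realizable k M -> exists r, represents r.
Proof.
move=> [H Hd HM]; have /choice[r rH] i := hyperplane_orth (congr1 S (Hd i)).
exists r => S; have [->|S0] := eqVneq S finset.set0.
  by rewrite /span_of big_set0 dimv0 mrank0.
rewrite -[RHS](mrank_flat_span) -HM //.
rewrite (eq_bigr (fun i => orth <[r i]>%VS)) => [|i _]; last exact: rH.
rewrite -orth_sum dim_orth subKn //.
by have := dimvS (subvf (span_of r S)); rewrite dimvf /dim /= mul1n.
Qed.

(** A criterion in terms of linear relations: no flat contains all but one element of
    the support of a relation. For a relation supported on an independent set, the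
    closure of all but one element of the support would be such a flat; so independent
    sets give free families. An element of the closure of an independent set [D] is a
    combination of a basis that contains [D]; if an element [j] of the basis outside
    [D] occurred, the closure of the other ones would be such a flat. *)
Lemma relations_represent r :
  (forall (a : E -> k) F, \sum_i a i *: r i = 0 -> flat M F ->
     #|[set i | a i != 0] :\: F| != 1%N) -> represents r.
Proof.
move=> rel.
have supp_on (D : {set E}) (a : E -> k) (u : E -> 'rV[k]_d.+1) : (forall i, i \in D -> u i = a i *: r i) ->
    \sum_(i in D) u i = \sum_i (if i \in D then a i else 0) *: r i.
  move=> ua; rewrite big_mkcond; apply: eq_bigr => i _.
  by case: ifP => [/ua//|_]; rewrite scale0r.
have indep_free D : D \in indep M -> \dim (span_of r D) = #|D|.
  move=> DM; have free_rel (a : E -> k) : (forall i, i \notin D -> a i = 0) ->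
      \sum_i a i *: r i = 0 -> forall i, a i = 0.
    move=> aD a0 i; apply/eqP; apply: contraT => ai.
    set C := [set i | a i != 0]%SET; have iC : i \in C by rewrite inE.
    have CD : C \subset D.
      by apply/fintype.subsetP => j; rewrite inE; apply: contraNT => /aD ->.
    have CM : C \in indep M := indepS CD DM.
    have := rel a (mclosure M (C :\ i)) a0 (flat_mclosure _ _); rewrite -/C.
    suff -> : (C :\: mclosure M (C :\ i) = [set i])%SET by rewrite cards1.
    apply/setP => j; rewrite finset.in_setD finset.in_set1; have [->|ji] := eqVneq j i.
      rewrite iC andbT inE finset.setD1K // mrank_indep //.
      rewrite mrank_indep; last by apply: indepS CM; apply: finset.subsetDl.
      by rewrite (cardsD1 i C) iC add1n; apply/eqP => /esym/n_Sn.
    apply/negP => /andP[jF jC]; move/negP: jF; apply.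
    by apply: (fintype.subsetP (sub_mclosure _ _)); rewrite finset.in_setD1 ji jC.
  have -> : #|D| = (\sum_(i in D) \dim <[r i]>)%N.
    rewrite -sum1_card; apply: eq_bigr => i iD; rewrite dim_vline.
    have [r0|//] := eqVneq (r i) 0.
    have := free_rel (fun j => (j == i)%:R).
    move=> /(_ _ _ i); rewrite eqxx => h; exfalso; move: (oner_neq0 k) => /eqP; apply; apply: h.
      by move=> j jD; case: eqP => // e; rewrite e iD in jD.
    by rewrite big1 // => j _; case: eqP => [->|_]; rewrite ?r0 ?scaler0 ?scale0r.
  apply/eqP/directv_sum_independent => u uV u0 i iD.
  have /choice[a ua] j : exists c, j \in D -> u j = c *: r j.
    by have [/uV/vlineP[c ->]|_] := boolP (j \in D); [exists c|exists 0].
  rewrite ua //; move: u0; rewrite (supp_on D a u ua) => /free_rel -/(_ _ i).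
  by rewrite iD => -> => [|j /negbTE -> //]; rewrite scale0r.
have closed D i : D \in indep M -> mrank M (i |: D) = #|D| -> r i \in span_of r D.
  move=> DM iD; have [iiD|iiD] := boolP (i \in D).
    by apply: subvP (memv_line _); apply: (sumv_sup i).
  have [|B [BM DB _ cB]] := @indep_extend _ M D finset.setT d.+1 DM (finset.subsetT _).
    by rewrite (mrankT lf) leqnn andbT -(mrank_indep DM) mrank_le_dim.
  have full : span_of r B = fullv.
    by apply/eqP; rewrite eqEdim subvf indep_free // cB dimvf /dim /= mul1n.
  have /memv_sumP[u uV ri] : r i \in span_of r B by rewrite full memvf.
  have /choice[a ua] j : exists c, j \in B -> u j = c *: r j.
    by have [/uV/vlineP[c ->]|_] := boolP (j \in B); [exists c|exists 0].
  have iB : i \notin B.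
    apply/negP => iB; have : i |: D \in indep M.
      by apply: indepS BM; rewrite finset.subUset finset.sub1set iB.
    by move=> /mrank_indep; rewrite iD cardsU1 iiD => /n_Sn.
  pose c j := if j == i then - 1 else if j \in B then a j else 0.
  have c0 : \sum_j c j *: r j = 0.
    rewrite (bigD1 i) //= {1}/c eqxx scaleN1r ri (supp_on B a u ua).
    rewrite [X in - X + _](bigD1 i) //= (negbTE iB) scale0r add0r addrC.
    by apply/eqP; rewrite subr_eq0; apply/eqP/eq_bigr => j ji; rewrite /c (negbTE ji).
  rewrite ri; apply: memv_suml => j jB; have [jD|jD] := boolP (j \in D).
    by rewrite ua // memvZ //; apply: subvP (memv_line _); apply: (sumv_sup j).
  have [aj|aj] := eqVneq (a j) 0; first by rewrite ua // aj scale0r mem0v.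
  have ji : j != i by apply: contraNneq iB => <-.
  have := rel c (mclosure M (B :\ j)) c0 (flat_mclosure _ _).
  suff -> : ([set i | c i != 0] :\: mclosure M (B :\ j) = [set j])%SET by rewrite cards1.
  have DBj : D \subset B :\ j by rewrite finset.subsetD1 DB jD.
  apply/setP => l; rewrite finset.in_setD finset.in_set1; have [->|lj] := eqVneq l j.
    rewrite !inE /c (negbTE ji) jB aj andbT finset.setD1K // !mrank_indep //.
      by rewrite (cardsD1 j B) jB add1n; apply/eqP => /esym/n_Sn.
    by apply: indepS BM; apply: finset.subsetDl.
  apply/negP => /andP[lF]; rewrite inE /c; have [li|li] := eqVneq l i.
    move/negP: lF => + _; apply; rewrite li.
    apply: (flat_closed (flat_mclosure _ _) (A := D)); last by rewrite iD mrank_indep.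
    exact: fintype.subset_trans DBj (sub_mclosure _ _).
  case: ifP => [lB _|]; last by rewrite eqxx.
  move/negP: lF; apply; apply: (fintype.subsetP (sub_mclosure _ _)).
  by rewrite finset.in_setD1 lj lB.
move=> S; have [B [BM BS cB]] := mrank_witness M S.
rewrite -cB -(indep_free B BM); congr (\dim _); apply/eqP; rewrite eqEsubv; apply/andP; split.
  apply/subv_sumP => i iS; rewrite -memvE; apply: closed => //.
  apply/eqP; rewrite eqn_leq -{2}(mrank_indep BM) (mrankS _ (finset.subsetU1 i B)) andbT.
  by rewrite cB mrankS // finset.subUset finset.sub1set iS.
by apply/subv_sumP => i iB; apply: (sumv_sup i) => //; apply: (fintype.subsetP BS).
Qed.
End Ranks.

(** * Linear relations at a tropical realization *)

Section Relations.
Local Open Scope classical_set_scope.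
Variables (R : realType) (k : fieldType) (n : nat) (M : matroid 'I_n.+1).
Hypothesis lf : loop_free M.
Notation E := 'I_n.+1.

(** The ray of a flat; the formula also covers the empty set and the whole set, for
    which it is the origin. *)
Lemma flat_fan F : flat M F -> matroid_fan_support M (evec_set R F).
Proof.
move=> Ff; apply: (levels_fan lf) => t; pose z : R := (ord0 \in F)%:R.
have e i : (t <= hat (evec_set R F) i) = (t + z <= (i \in F)%:R).
  by rewrite hat_evec_set lerBrDr.
have [t0|t0] := leP (t + z) 0.
  rewrite [X in flat M X](_ : _ = finset.setT) ?flat_setT //.
  by apply/setP => i; rewrite !inE e (le_trans t0).
have [t1|t1] := leP (t + z) 1.
  rewrite [X in flat M X](_ : _ = F) //; apply/setP => i; rewrite !inE e.
  by case: (i \in F); rewrite ?t1 // leNgt t0.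
rewrite [X in flat M X](_ : _ = finset.set0) ?(flat_set0 lf) //.
apply/setP => i; rewrite !inE e leNgt (le_lt_trans _ t1) //.
by case: (i \in F).
Qed.

Variables (Y : prime_idealr (laurent k n)) (F : fieldType).
Variable phi : {rmorphism laurent k n -> F}.
Hypothesis kerphi : forall f, (f \in Y) <-> phi f = 0.
Hypothesis fan_Trop : matroid_fan_support M `<=` @Trop k R n Y.

(** At the point of [G] the coordinates outside [G] have smaller weight than those in
    [G]: a single one of them would be the leading part of the relation. *)
Lemma relation_flat (c : E -> k) (G : {set E}) :
  \sum_i kap phi (c i) * chi phi (eps i) = 0 -> flat M G ->
  #|[set i | c i != 0]%SET :\: G| != 1%N.
Proof.
move=> rel Gf; apply/negP => /cards1P[i0 CG].
pose f : laurent k n := \sum_i monomial (c i) (eps i).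
have fY : f \in Y.
  by apply/kerphi; rewrite rmorph_sum -[RHS]rel; apply: eq_bigr => i _; rewrite phi_monomial.
have : i0 \in ([set i | c i != 0] :\: G)%SET by rewrite CG finset.in_set1.
rewrite finset.in_setD inE => /andP[i0G /eqP]; apply.
apply: (Trop_lead (fan_Trop (flat_fan Gf)) fY (u := eps i0)).
rewrite /f (bigD1 i0) //= addrAC subrr add0r; apply: suppin_sum => i _ ii0.
have [->|ci] := eqVneq (c i) 0; first by rewrite monomial0; apply: suppin0.
apply: suppin_monomial; rewrite /= !pairing_eps !hat_evec_set (negbTE i0G).
suff -> : i \in G by rewrite ltrD2r ltr01.
apply: contraNT ii0 => iG; rewrite -finset.in_set1 -CG finset.in_setD iG inE.
exact: ci.
Qed.
End Relations.

(** * From a tropical realization to a realization *)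

Section ForwardConclusion.
Local Open Scope classical_set_scope.
Variables (R : realType) (k : fieldType) (n : nat) (M : matroid 'I_n.+1).
Hypothesis lf : loop_free M.
Notation E := 'I_n.+1.
Notation d := (mdim M).

Lemma row_cont_at (T : topologicalType) N (f : T -> 'rV[R]_N) (x : T) :
  (forall j, {for x, continuous (fun y => f y 0 j)}) -> {for x, continuous f}.
Proof.
move=> fc; apply/cvg_ballP => e e0.
have H : \forall y \near x, forall j, ball (f x 0 j) e (f y 0 j).
  by apply: filter_forall => j; have /cvg_ballP := fc j; apply.
near=> y; rewrite /ball /= /mx_ball; split=> // i j; rewrite ord1; move: j; near: y; exact: H.
Unshelve. all: end_near. Qed.

Lemma row_cont (T : topologicalType) N (f : T -> 'rV[R]_N) :
  (forall j, continuous (fun x => f x 0 j)) -> continuous f.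
Proof. by move=> fc x; apply: row_cont_at => j; apply: fc. Qed.

Lemma ordered_open (b : 'I_d.+1 -> E) : open [set w : 'rV[R]_n | ordered b w].
Proof.
rewrite openE => w ow; rewrite /interior.
have H : \forall v \near w, forall i j : 'I_d.+1, (i < j)%N -> hat v (b j) < hat v (b i).
  apply: (@filter_forall _ 'I_d.+1 (fun (i : 'I_d.+1) (v : 'rV[R]_n) =>
    forall j : 'I_d.+1, (i < j)%N -> hat v (b j) < hat v (b i)) (nbhs w)) => i.
  apply: (@filter_forall _ 'I_d.+1 (fun (j : 'I_d.+1) (v : 'rV[R]_n) =>
    (i < j)%N -> hat v (b j) < hat v (b i)) (nbhs w)) => j.
  have [ij|ij] := boolP (i < j)%N; last by apply: nearW.
  have := ow i j ij; rewrite -subr_gt0 => w0.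
  have c : continuous (fun v : 'rV[R]_n => hat v (b i) - hat v (b j)).
    move=> v; apply: (@continuousB _ _ _ (fun v : 'rV[R]_n => hat v (b i))); exact: hat_cont.
  near=> v => _; rewrite -subr_gt0; near: v.
  exact: (c w) (open_nbhs_nbhs (conj (@open_gt R 0) w0)).
exact: H.
Unshelve. all: end_near. Qed.

(** Points of the open cone are parametrized by their weights on the basis, through the
    map [T] below: a rationally independent vector is found in the preimage of the open
    set on which the multiplicity is computed. *)
Lemma tropical_realization : tropically_realizable R k M -> realizable k M.
Proof.
move=> [Y TropY mult]; have [F [phi kerphi]] := prime_field Y.
have [P mP] := exists_maximal_flag M.
have [beta [b [ad PE]]] := maximal_flag_adapted lf mP.
pose v0 : 'rV[R]_n := block_point beta (fun j => - (j : nat)%:R).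
have ov0 : ordered b v0.
  by apply: (block_point_ordered ad) => i j ij; rewrite ltrN2 ltr_nat.
have bv0 : blockwise beta b v0 by apply: (block_point_blockwise ad).
have [|_ [V [O [nV oO VO gm]]]] := mult P v0 mP.
  by rewrite PE; apply/(relint_stepsP ad).
have Tv0 : Trop Y v0 by rewrite TropY; apply: (ordered_fan ad).
have [w' [[Tw' Ow'] ow']] := VO v0 (conj Tv0 (nbhs_singleton nV)) _
  (open_nbhs_nbhs (conj (@ordered_open b) ov0)).
have bw' : blockwise beta b w'.
  by apply: (ordered_blockwise lf ad) => //; apply: (fan_levels lf); rewrite -TropY.
pose T (x : 'rV[R]_n) : 'rV[R]_n := block_point beta (fun j => hat x (b j)).
have hatT x i : hat (T x) i = hat x (b (beta i)).
  by rewrite /T hat_block_point (adapted0 ad) hat0 subr0.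
have Tc : continuous T.
  apply: row_cont => j; rewrite (_ : (fun _ => _) = (fun x : 'rV[R]_n => hat x (b (beta (lift ord0 j))))).
    exact: hat_cont.
  by apply/funext => x; rewrite -hatT hat_lift.
have [||x [Ox ox] xind] := @independent_dense R n (T @^-1` O `&` [set w | ordered b w]).
- apply: openI; last exact: ordered_open.
  by apply: open_comp => // x _; apply: Tc.
- exists w'; split=> //=; rewrite (_ : T w' = w') //.
  by apply: hat_inj => i; rewrite hatT -bw'.
have oT : ordered b (T x) by move=> i j ij; rewrite !hatT !(adapted_section ad); exact: ox.
have TT : Trop Y (T x).
  rewrite TropY; apply: (ordered_fan ad) => // i.
  by rewrite !hatT !(adapted_section ad).
have lin i := chi_linear lf kerphi TropY ad xind (hatT x) oT (gm _ (conj TT Ox)) i.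
have [A AE] := choice lin.
apply: (@represents_realizable _ _ _ lf (fun i => \row_l A i l)).
apply: (relations_represent lf) => c G c0 Gf.
apply: (relation_flat lf kerphi (R := R) _ _ Gf); first by rewrite TropY.
rewrite (eq_bigr (fun i => \sum_l kap phi (c i * A i l) * chi phi (eps (b l)))).
  rewrite exchange_big big1 // => l _; rewrite -mulr_suml -(big_morph _ (kapD phi) (kap0 phi)).
  have e : \sum_i c i * A i l = 0.
    have := congr1 (fun v : 'rV_ _ => v 0 l) c0; rewrite mxE summxE => e; rewrite -[RHS]e.
    by apply: eq_bigr => i _; rewrite !mxE.
  by rewrite e kap0 mul0r.
by move=> i _; rewrite AE mulr_sumr; apply: eq_bigr => l _; rewrite kapM mulrA.
Qed.
End ForwardConclusion.

(** * Homomorphisms from group algebras *)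

Section GroupAlgebraHom.
Variables (k : fieldType) (U : zmodType) (B : comNzRingType) (e : k -> U -> B).
Hypothesis eD : forall c c' u, e (c + c') u = e c u + e c' u.
Hypothesis e1 : e 1 0 = 1.
Hypothesis eM : forall c c' u u', e (c * c') (u + u') = e c u * e c' u'.

Definition galg_eval (f : group_algebra k U) : B := \sum_(u <- supp f) e (coef f u) u.

Let e0 u : e 0 u = 0.
Proof. by have := eD 0 0 u; rewrite addr0 => /(congr1 (fun x => x - e 0 u)); rewrite subrr addrK. Qed.

Let evalw (D : {fset U}) f : (supp f `<=` D)%fset ->
  galg_eval f = \sum_(u <- D) e (coef f u) u.
Proof.
move=> fD; rewrite /galg_eval (big_fset_incl _ fD) // => u _.
by rewrite mem_supp negbK => /eqP ->.
Qed.

Let evalD f g : galg_eval (f + g) = galg_eval f + galg_eval g.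
Proof.
pose D := (supp f `|` supp g)%fset.
rewrite (@evalw D (f + g)); last first.
  apply/fsubsetP => u; rewrite mem_supp gcoefD in_fsetU !mem_supp.
  by apply: contraNT; rewrite negb_or !negbK => /andP[/eqP -> /eqP ->]; rewrite addr0.
rewrite (evalw (fsubsetUl (supp f) (supp g))) (evalw (fsubsetUr (supp f) (supp g))).
by rewrite -big_split; apply: eq_bigr => u _; rewrite gcoefD eD.
Qed.

Let eval0 : galg_eval 0 = 0.
Proof. by rewrite /galg_eval [supp 0]msupp0 big_seq_fset0. Qed.

Let eval_sum (J : Type) (s : seq J) (F : J -> group_algebra k U) :
  galg_eval (\sum_(j <- s) F j) = \sum_(j <- s) galg_eval (F j).
Proof. exact: (big_morph galg_eval evalD eval0). Qed.

Let eval_monomial c u : galg_eval (monomial c u) = e c u.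
Proof.
rewrite (@evalw [fset u]%fset) ?big_seq_fset1 ?coef_monomial ?eqxx //.
by apply/fsubsetP => v; rewrite mem_supp coef_monomial in_fset1 [v == u]eq_sym; case: (u == v); rewrite ?eqxx.
Qed.

Let evalM f g : galg_eval (f * g) = galg_eval f * galg_eval g.
Proof.
rewrite galg_mulE eval_sum [RHS]mulr_suml; apply: eq_bigr => u _.
rewrite eval_sum [RHS]mulr_sumr; apply: eq_bigr => v _.
by rewrite eval_monomial eM.
Qed.

Let evalN f : galg_eval (- f) = - galg_eval f.
Proof. by apply/eqP; rewrite -addr_eq0 -evalD addNr eval0. Qed.

Let evalB : zmod_morphism galg_eval.
Proof. by move=> f g; rewrite evalD evalN. Qed.
Let eval1M : monoid_morphism galg_eval.
Proof. by split; [rewrite galg_oneE eval_monomial e1|exact: evalM]. Qed.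

HB.instance Definition _ := GRing.isZmodMorphism.Build _ _ galg_eval evalB.
HB.instance Definition _ := GRing.isMonoidMorphism.Build _ _ galg_eval eval1M.

Lemma exists_galg_hom : exists phi : {rmorphism group_algebra k U -> B},
  forall c u, phi (monomial c u) = e c u.
Proof. by exists galg_eval; exact: eval_monomial. Qed.
End GroupAlgebraHom.

(** * Prime ideals and the field of fractions of the ring of Laurent polynomials *)

(** Bridges the gap between predicates in Prop and boolean ones. *)
Lemma exists_prime_ideal (A : comNzRingType) (P : A -> Prop) :
  P 0 -> ~ P 1 -> (forall a u v, P u -> P v -> P (a * u + v)) ->
  (forall u v, P (u * v) -> P u \/ P v) ->
  exists I : prime_idealr A, forall a, (a \in I) <-> P a.
Proof.
move=> P0 P1 PD PM; pose S : A -> bool := fun a => `[< P a >].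
have cS : idealr_closed S.
  split; rewrite ?unfold_in; [exact/asboolP|exact/asboolP|].
  by move=> a u v /asboolP Pu /asboolP Pv; apply/asboolP/PD.
have pS : prime_idealr_closed S.
  move=> u v /asboolP/PM[h|h]; apply/orP; [left|right]; exact/asboolP.
pose z := isIdealr.Build A S cS.
pose I1 := GRing.isZmodClosed.Build A S (idealr_closedB cS).
pose I2 := isProperIdeal.Build A S (idealr_closed_nontrivial cS).
pose I3 := isPrimeIdealrClosed.Build A S pS.
pose I : prime_idealr A := HB.pack S I1 I2 I3.
by exists I => a; split => [/asboolP|Pa]; last exact/asboolP.
Qed.

Section Fractions.
Variables (R : realType) (k : fieldType) (n : nat).

(** Leading terms for a weight that separates exponents multiply. *)
Lemma laurent_domain (f g : laurent k n) : f * g = 0 -> f = 0 \/ g = 0.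
Proof.
move=> fg; have [f0|f0] := eqVneq f 0; [by left|right]; apply/eqP; apply: contraT => g0.
have [x _ xind] : exists2 x : 'rV[R]_n, setT x & forall u, pairing u x = 0 -> u = 0.
  by apply: independent_dense; [exact: openT|exists 0].
have inj (u v : 'rV[int]_n) : setT u -> setT v -> pairing u x = pairing v x -> u = v.
  move=> _ _ e; apply/eqP; rewrite -subr_eq0; apply/eqP/xind.
  by rewrite pairingB e subrr.
have [u fu uP] := lead_exists inj (fun _ _ => I) f0.
have [v gv vP] := lead_exists inj (fun _ _ => I) g0.
have fE w : coef f w != 0 -> pairing u x <= pairing w x.
  move=> fw; have [->//|wu] := eqVneq w u.
  have [|_ /ltW//] := uP w; rewrite gcoefB coef_monomial [u == w]eq_sym (negbTE wu) subr0 //.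
have gE w : coef g w != 0 -> pairing v x <= pairing w x.
  move=> gw; have [->//|wv] := eqVneq w v.
  have [|_ /ltW//] := vP w; rewrite gcoefB coef_monomial [v == w]eq_sym (negbTE wv) subr0 //.
have c1 : coef (monomial (coef f u) u * g) (u + v) = coef f u * coef g v.
  by rewrite coef_monomialM [u + v]addrC addrK.
have c2 : coef ((f - monomial (coef f u) u) * g) (u + v) = 0.
  apply/eqP; apply: contraT => ne; exfalso.
  have [w1 [w2 [h1 h2 e]]] := gcoefM_neq0 ne.
  have [_ lt] := uP _ h1; have le := gE _ h2.
  have := ltr_leD lt le; rewrite -!pairingD e ltxx //.
have : coef (f * g) (u + v) = coef f u * coef g v.
  have e := etrans (congr1 (fun h => h * g) (esym (subrK (monomial (coef f u) u) f))) (mulrDl _ _ _).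
  exact: etrans (congr1 (fun h => coef h (u + v)) e)
    (etrans (gcoefD _ _ _) (etrans (congr2 +%R c2 c1) (add0r _))).
by rewrite fg gcoef0 => /esym/eqP; rewrite mulf_eq0 (negbTE fu) (negbTE gv).
Qed.

Lemma laurent_field : exists (F : fieldType) (iota : {rmorphism laurent k n -> F}),
  forall f, iota f = 0 -> f = 0.
Proof.
have [||||I IE] := @exists_prime_ideal (laurent k n) (fun f => f = 0).
- by [].
- by apply/eqP; exact: oner_neq0.
- by move=> a u v -> ->; rewrite mulr0 addr0.
- exact: laurent_domain.
have [F [phi phiP]] := prime_field I.
by exists F, phi => f /phiP/IE.
Qed.
End Fractions.

(** * Coordinates of a realization in a basis adapted to a flag *)

Section Triangular.
Variables (k : fieldType) (n : nat) (M : matroid 'I_n.+1).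
Hypothesis lf : loop_free M.
Notation E := 'I_n.+1.
Notation d := (mdim M).
Variable r : E -> 'rV[k]_d.+1.
Hypothesis rM : represents r.

Lemma mem_span (S : {set E}) i : i \in S -> r i \in span_of r S.
Proof. by move=> iS; apply: (subvP (sumv_sup i iS (subvv _))); exact: memv_line. Qed.

Lemma span_ofS (S T : {set E}) : S \subset T -> (span_of r S <= span_of r T)%VS.
Proof.
move=> ST; apply/subv_sumP => i iS; apply: (sumv_sup i) => //.
exact: (fintype.subsetP ST).
Qed.

Lemma mem_span_of (S : {set E}) x : (r x \in span_of r S) = (mrank M (x |: S) == mrank M S).
Proof.
apply/idP/eqP => [xS|e].
  rewrite -!rM; congr (\dim _); apply/eqP; rewrite eqEsubv (span_ofS (finset.subsetU1 _ _)) andbT.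
  apply/subv_sumP => i; rewrite finset.in_setU1 => /orP[/eqP ->|iS]; first by rewrite -memvE.
  exact: (sumv_sup i).
have -> : span_of r S = span_of r (x |: S).
  by apply/eqP; rewrite eqEdim (span_ofS (finset.subsetU1 _ _)) !rM e leqnn.
by apply: mem_span; rewrite finset.setU11.
Qed.

(** In a relation, an element with nonzero coefficient is in the span of the others,
    which has the same rank. *)
Lemma independent_relation (D : {set E}) (a : E -> k) : D \in indep M ->
  (forall i, i \notin D -> a i = 0) -> \sum_i a i *: r i = 0 -> forall i, a i = 0.
Proof.
move=> DM aD a0 i; apply/eqP; apply: contraT => ai.
have iD : i \in D by apply: contraNT ai => /aD ->.
have : r i \in span_of r (D :\ i).
  have -> : r i = \sum_(j | j != i) (- (a i)^-1 * a j) *: r j.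
    move: a0; rewrite (bigD1 i) //= => /eqP; rewrite addr_eq0 => /eqP e.
    rewrite -[LHS]scale1r -(mulVf ai) -scalerA e scalerN scaler_sumr -sumrN.
    by apply: eq_bigr => j _; rewrite scalerA mulNr scaleNr.
  apply: memv_suml => j ji; have [jD|/aD ->] := boolP (j \in D); last first.
    by rewrite mulr0 scale0r mem0v.
  apply: memvZ; apply: mem_span.
  by rewrite finset.in_setD1 ji.
rewrite mem_span_of finset.setD1K // !mrank_indep //.
  by rewrite (cardsD1 i D) iD add1n => /eqP/esym/n_Sn.
by apply: indepS DM; apply: finset.subsetDl.
Qed.

Variables (beta : E -> 'I_d.+1) (b : 'I_d.+1 -> E).
Hypothesis ad : adapted beta b.
Let betab := adapted_section ad.

Let first_basis (q : nat) : {set E} := [set b l | l : 'I_d.+1 & (l < q)%N]%SET.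

Lemma first_basis_indep q : first_basis q \in indep M.
Proof.
apply: (indepS _ (basis_indep ad)); apply/fintype.subsetP => _ /imsetP[l _ ->].
exact: imset_f.
Qed.

Lemma card_first_basis q : (q <= d.+1)%N -> #|first_basis q| = q.
Proof.
move=> qd; rewrite card_imset; last exact: can_inj betab.
have wi : injective (widen_ord qd) by move=> x y /(congr1 val) /= /val_inj.
rewrite -[RHS](card_ord q) -(card_imset _ wi).
apply: eq_card => l; rewrite inE; apply/idP/imsetP => [lq|[x _ ->]]; last exact: (ltn_ord x).
by exists (Ordinal lq) => //; apply: val_inj.
Qed.

(** The ranks of the steps increase strictly up to d + 1. *)
Lemma mrank_step j : (j <= d.+1)%N -> mrank M (step beta j) = j.
Proof.
move=> jd; apply/eqP; rewrite eqn_leq; apply/andP; split; last first.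
  rewrite -{1}(card_first_basis jd); apply: mrank_max; first exact: first_basis_indep.
  by apply/fintype.subsetP => _ /imsetP[l + ->]; rewrite !inE betab.
have main m : (m <= d.+1)%N -> (mrank M (step beta (d.+1 - m)) <= d.+1 - m)%N.
  elim: m => [_|m IH lt].
    by rewrite subn0 -[X in (_ <= X)%N](mrankT lf) mrankS // finset.subsetT.
  have := IH (ltnW lt); have -> : (d.+1 - m = (d.+1 - m.+1).+1)%N by lia.
  set q := (d.+1 - m.+1)%N => le; rewrite -ltnS; apply: leq_trans le.
  apply: (mrank_flat_lt (adapted_flat ad q)); apply/properP; split.
    by apply/fintype.subsetP => i; rewrite !inE => /leqW.
  have qd : (q < d.+1)%N by rewrite /q; lia.
  by exists (b (Ordinal qd)); rewrite !inE betab /= ?ltnn.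
by have := main (d.+1 - j)%N (leq_subr _ _); rewrite subKn.
Qed.

(** The flag makes the coordinates triangular: an element of the block [beta i]
    lies in the span of the elements of the basis in the blocks up to that one,
    and not in the span of those in the smaller blocks. *)
Lemma triangular_coordinates : exists A : E -> 'I_d.+1 -> k,
  [/\ forall i, r i = \sum_l A i l *: r (b l),
      forall i (l : 'I_d.+1), (beta i < l)%N -> A i l = 0,
      forall i, A i (beta i) != 0 & forall j l, A (b j) l = (l == j)%:R].
Proof.
pose good i (a : 'I_d.+1 -> k) := [/\ r i = \sum_l a l *: r (b l),
  forall l : 'I_d.+1, (beta i < l)%N -> a l = 0, a (beta i) != 0 &
  forall j, i = b j -> forall l, a l = (l == j)%:R].
suff /choice[A AP] i : exists a, good i a.
  by exists A; split=> [i|i l|i|j l]; [by have [] := AP i|have [_ h _ _] := AP i; exact: h|by have [] := AP i|have [_ _ _ h] := AP (b j); exact: h].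
have [e|ib] := eqVneq i (b (beta i)).
  exists (fun l => (l == beta i)%:R); split; rewrite ?eqxx ?oner_neq0 //.
  - rewrite (bigD1 (beta i)) //= eqxx scale1r -e big1 ?addr0 // => l /negbTE ->.
    by rewrite scale0r.
  - by move=> l lt; case: eqP lt => // ->; rewrite ltnn.
  - by move=> j ij l; rewrite ij betab.
have sp (q : nat) : (q <= d.+1)%N ->
    span_of r (step beta q) = span_of r (first_basis q).
  move=> qd; apply/esym/eqP; rewrite eqEdim; apply/andP; split.
    by apply: span_ofS; apply/fintype.subsetP => _ /imsetP[l + ->]; rewrite !inE betab.
  by rewrite !rM mrank_step // mrank_indep ?first_basis_indep // card_first_basis.
have : r i \in span_of r (step beta (beta i).+1).
  by apply: mem_span; rewrite inE.
rewrite sp ?ltn_ord // => /memv_sumP[u uV ri].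
have /choice[a ua] j : exists c, j \in first_basis (beta i).+1 -> u j = c *: r j.
  by case: (boolP (j \in _)) => [/uV/vlineP[c ->]|_]; [exists c|exists 0].
pose a' (l : 'I_d.+1) := if (l <= beta i)%N then a (b l) else 0.
have ra : r i = \sum_l a' l *: r (b l).
  rewrite ri big_imset /=; last by move=> ? ? _ _; apply: can_inj betab _ _.
  rewrite big_mkcond; apply: eq_bigr => l _; rewrite inE ltnS /a'.
  case: ifP => [li|_]; last by rewrite scale0r.
  by rewrite ua //; apply: imset_f; rewrite inE ltnS.
exists a'; split=> //.
- by move=> l lt; rewrite /a' leqNgt lt.
- apply: contraT; rewrite negbK => /eqP a0.
  have : r i \in span_of r (step beta (beta i)).
    rewrite ra; apply: memv_suml => l _; have [->|ne] := eqVneq l (beta i).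
      by rewrite a0 scale0r mem0v.
    rewrite /a'; case: ifP => [le|_]; last by rewrite scale0r mem0v.
    apply: memvZ; apply: mem_span.
    by rewrite inE betab ltn_neqAle le andbT.
  rewrite mem_span_of => /eqP/(flat_closed (adapted_flat ad (beta i)) (fintype.subxx _)).
  by rewrite inE ltnn.
- by move=> j ij; move: ib; rewrite ij betab eqxx.
Qed.

(** The vectors of the basis are linearly independent. *)
Lemma relation_coordinates (J : finType) (g : J -> E) (A : E -> 'I_d.+1 -> k) (c : J -> k) :
  (forall i, r i = \sum_l A i l *: r (b l)) ->
  \sum_j c j *: r (g j) = 0 -> forall l, \sum_j c j * A (g j) l = 0.
Proof.
move=> rA c0 l; pose D := [set b j | j : 'I_d.+1]%SET.
pose a i := if i \in D then \sum_j c j * A (g j) (beta i) else 0.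
have := @independent_relation D a (basis_indep ad) _ _ (b l).
rewrite /a imset_f // betab; apply.
  by move=> i /negbTE ->.
rewrite -[RHS]c0 (eq_bigr (fun i => if i \in D then (\sum_j c j * A (g j) (beta i)) *: r i else 0)).
  rewrite -big_mkcond big_imset /=; last by move=> ? ? _ _; apply: can_inj betab _ _.
  rewrite [RHS](eq_bigr (fun j => \sum_l (c j * A (g j) l) *: r (b l))).
    by rewrite exchange_big; apply: eq_bigr => j _; rewrite betab scaler_suml.
  by move=> j _; rewrite {1}rA scaler_sumr; apply: eq_bigr => m _; rewrite scalerA.
by move=> i _; case: ifP; rewrite ?scale0r.
Qed.
End Triangular.

Lemma sum_option (V : zmodType) (J : finType) (G : option J -> V) :
  \sum_o G o = G None + \sum_j G (Some j).
Proof.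
rewrite (bigD1 None) //=; congr (_ + _).
rewrite (reindex_omap (@Some J) id) => [|[j|//]] //=.
by apply: eq_bigl => j; rewrite eqxx.
Qed.

(** Identities between fractions as above, in forms without division. *)
Lemma rmorphDM (A : comNzRingType) (F : fieldType) (h : {rmorphism A -> F}) a b c e :
  h (a * b + c * e) = h a * h b + h c * h e.
Proof. by rewrite rmorphD !(rmorphM h). Qed.

Lemma add_denom_eq (F : fieldType) (z z' a a' c c' p q : F) : z * c = a -> z' * c' = a' ->
  p = a * c' + a' * c -> q = c * c' -> (z + z') * q = p.
Proof. by move=> <- <- -> ->; ring. Qed.

Lemma mul_denom_eq (F : fieldType) (z z' a a' c c' p q : F) : z * c = a -> z' * c' = a' ->
  p = a * a' -> q = c * c' -> (z * z') * q = p.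
Proof. by move=> <- <- -> ->; ring. Qed.

(** Induction on exponents as elements of the group generated by the [eps i]. *)
Lemma lattice_ind n (G : 'rV[int]_n -> Prop) : G 0 -> (forall u v, G u -> G v -> G (u - v)) ->
  (forall i, G (eps i)) -> forall u, G u.
Proof.
move=> G0 GB Ge u; have GN v : G v -> G (- v) by move=> Gv; rewrite -sub0r; apply: GB.
have GD v v' : G v -> G v' -> G (v + v') by move=> Gv /GN Gv'; rewrite -[v']opprK; apply: GB.
rewrite (sum_eps u); apply: (big_ind G) => // j _.
have Gn N : G (N%:Z *: eps (lift ord0 j)).
  elim: N => [|N IH]; first by rewrite scale0r.
  by rewrite intS scalerDl scale1r; apply: GD.
by have [N [->|->]] := int_nat_cases (u 0 j); rewrite ?scaleNr; [|apply: GN]; apply: Gn.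
Qed.

Lemma exists_character_hom (k : fieldType) (n : nat) (F : fieldType) (h : k -> F) (y : 'I_n -> F) :
  (forall c c', h (c + c') = h c + h c') -> h 1 = 1 -> (forall c c', h (c * c') = h c * h c') ->
  (forall j, y j != 0) ->
  exists phi : {rmorphism laurent k n -> F},
    (forall c, kap phi c = h c) /\ (forall j, chi phi (delta_mx 0 j) = y j).
Proof.
move=> hD h1 hM y0; pose m (u : 'rV[int]_n) := \prod_j y j ^ (u 0 j).
have m0 : m 0 = 1 by rewrite /m big1 // => j _; rewrite mxE expr0z.
have mD u v : m (u + v) = m u * m v.
  by rewrite /m -big_split; apply: eq_bigr => j _; rewrite mxE expfzDr.
have [|||phi phiE] := @exists_galg_hom k 'rV[int]_n F (fun c u => h c * m u).
- by move=> c c' u; rewrite hD mulrDl.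
- by rewrite h1 m0 mulr1.
- by move=> c c' u u'; rewrite hM mD mulrACA.
exists phi; split=> [c|j]; first by rewrite kapE phiE m0 mulr1.
rewrite chiE phiE h1 mul1r /m (bigD1 j) //= mxE !eqxx expr1z big1 ?mulr1 // => l lj.
by rewrite mxE eqxx (negbTE lj) expr0z.
Qed.

(** * Generic points of the complement of an arrangement *)

Section FlagHom.
Variables (k : fieldType) (n : nat) (M : matroid 'I_n.+1).
Hypothesis lf : loop_free M.
Notation E := 'I_n.+1.
Notation d := (mdim M).
Variable r : E -> 'rV[k]_d.+1.
Hypothesis rM : represents r.
Variables (F : fieldType) (iota : {rmorphism laurent k n -> F}).
Hypothesis iota_inj : forall f, iota f = 0 -> f = 0.
Implicit Types (u v : 'rV[int]_n) (f g : laurent k n).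

(** The linear form of the element [i], in the coordinates given by the basis [b]:
    the coordinate of [b l] is the monomial of exponent [eps (b l)], which is 1
    for the element 0. *)
Definition linear_form (b : 'I_d.+1 -> E) (A : E -> 'I_d.+1 -> k) i : laurent k n :=
  \sum_l monomial (A i l) (eps (b l)).

(** The generic point of the complement of the hyperplane arrangement given by [r], in
    coordinates adapted to a complete flag. The same field, of fractions of Laurent
    polynomials in n variables, serves for all flags. *)
Record generic_point (beta : E -> 'I_d.+1) (b : 'I_d.+1 -> E) (A : E -> 'I_d.+1 -> k)
    (phi : {rmorphism laurent k n -> F}) : Prop := GenericPoint {
  gp_adapted : adapted beta b;
  gp_expand : forall i, r i = \sum_l A i l *: r (b l);
  gp_lower : forall i (l : 'I_d.+1), (beta i < l)%N -> A i l = 0;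
  gp_diag : forall i, A i (beta i) != 0;
  gp_row : forall j l, A (b j) l = (l == j)%:R;
  gp_kap : forall c, kap phi c = iota (monomial c 0);
  gp_chi : forall i, chi phi (eps i) = iota (linear_form b A i) }.

Lemma exists_generic_point beta b : adapted beta b -> exists A phi, generic_point beta b A phi.
Proof.
move=> ad; have [A [A1 A2 A3 A4]] := triangular_coordinates lf rM ad.
have betab := adapted_section ad.
have coefL i l : coef (linear_form b A i) (eps (b l)) = A i l.
  rewrite gcoef_sum (bigD1 l) //= coef_monomial eqxx big1 ?addr0 // => j jl.
  by rewrite coef_monomial; case: eqP => // /eps_inj/(can_inj betab) e; rewrite e eqxx in jl.
have L0 i : iota (linear_form b A i) != 0.
  apply/eqP => /iota_inj e; have := A3 i.
  by rewrite -coefL e gcoef0 eqxx.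
have [||||phi [phik phic]] := @exists_character_hom k n F (fun c => iota (monomial c 0))
    (fun j => iota (linear_form b A (lift ord0 j))).
- by move=> c c'; rewrite monomialD rmorphD.
- exact: rmorph1.
- by move=> c c'; rewrite -rmorphM monomialM addr0.
- by move=> j; apply: L0.
exists A, phi; split=> // i; case: (unliftP ord0 i) => [j ->|->].
  by rewrite eps_lift phic.
rewrite eps0 chi0 -(rmorph1 iota); congr (iota _).
have A0 l : A ord0 l = (l == beta ord0)%:R by rewrite -{1}(adapted0 ad) A4.
rewrite /linear_form (bigD1 (beta ord0)) //= A0 eqxx (adapted0 ad) eps0.
rewrite big1 ?addr0 // => l /negbTE lj; rewrite A0 lj.
exact: monomial0.
Qed.

Lemma generic_relation beta b A phi (J : finType) (g : J -> E) (c : J -> k) :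
  generic_point beta b A phi -> \sum_j c j *: r (g j) = 0 ->
  \sum_j kap phi (c j) * chi phi (eps (g j)) = 0.
Proof.
move=> gp c0; have cA := relation_coordinates rM (gp_adapted gp) (gp_expand gp) c0.
rewrite (eq_bigr (fun j => iota (\sum_l monomial (c j * A (g j) l) (eps (b l))))).
  rewrite -rmorph_sum exchange_big big1 ?rmorph0 // => l _.
  rewrite -(big_morph (fun c => monomial c _) (fun a a' => monomialD a a' _) (monomial0 _ _)).
  by rewrite cA; exact: monomial0.
move=> j _; rewrite (gp_kap gp) (gp_chi gp) -rmorphM; congr (iota _).
rewrite mulr_sumr; apply: eq_bigr => l _.
by rewrite monomialM add0r.
Qed.

(** The relation with an additional term for [i], indexed by [None]. *)
Lemma generic_combination beta b A phi (J : finType) (g : J -> E) (c : J -> k) i :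
  generic_point beta b A phi -> r i = \sum_j c j *: r (g j) ->
  chi phi (eps i) = \sum_j kap phi (c j) * chi phi (eps (g j)).
Proof.
move=> gp e; pose g' (o : option J) := if o is Some j then g j else i.
pose c' (o : option J) := if o is Some j then c j else - 1.
have := @generic_relation beta b A phi _ g' c' gp.
rewrite !sum_option /= scaleN1r -e addNr => /(_ erefl)/eqP.
by rewrite addrC addr_eq0 kapN kap1 mulN1r opprK => /eqP.
Qed.

(** The ideal of a generic point does not depend on the flag: the relation [spec]
    between fractions [iota a / iota c] and their values [phi' a / phi' c] is a
    specialization that takes the coordinates of the first generic point to those of
    the second one, since both satisfy the same linear relations. *)
Lemma generic_kernel_sub beta b A phi beta' b' A' phi' f :
  generic_point beta b A phi -> generic_point beta' b' A' phi' ->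
  phi f = 0 -> phi' f = 0.
Proof.
move=> gp gp'; pose spec (z y : F) := exists a c : laurent k n,
  [/\ phi' c != 0, z * iota c = iota a & y * phi' c = phi' a].
have spec0 y : spec 0 y -> y = 0.
  move=> [a [c [c0 e e']]]; move: e; rewrite mul0r => /esym/iota_inj a0.
  by move: e'; rewrite a0 rmorph0 => /eqP; rewrite mulf_eq0 (negbTE c0) orbF => /eqP.
have specD z y z' y' : spec z y -> spec z' y' -> spec (z + z') (y + y').
  move=> [a [c [c0 e1 e2]]] [a' [c' [c0' e1' e2']]]; exists (a * c' + a' * c), (c * c').
  split; first by have -> := rmorphM phi' c c'; rewrite mulf_neq0.
    exact: (add_denom_eq e1 e1' (rmorphDM iota a c' a' c) (rmorphM iota c c')).
  exact: (add_denom_eq e2 e2' (rmorphDM phi' a c' a' c) (rmorphM phi' c c')).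
have specM z y z' y' : spec z y -> spec z' y' -> spec (z * z') (y * y').
  move=> [a [c [c0 e1 e2]]] [a' [c' [c0' e1' e2']]]; exists (a * a'), (c * c').
  split; first by have -> := rmorphM phi' c c'; rewrite mulf_neq0.
    exact: (mul_denom_eq e1 e1' (rmorphM iota a a') (rmorphM iota c c')).
  exact: (mul_denom_eq e2 e2' (rmorphM phi' a a') (rmorphM phi' c c')).
have specV z y : y != 0 -> spec z y -> spec z^-1 y^-1.
  move=> y0 [a [c [c0 e1 e2]]].
  have a0 : phi' a != 0 by rewrite -e2 mulf_neq0.
  have z0 : z != 0.
    apply: contraNneq a0 => z0; move: e1; rewrite z0 mul0r => /esym/iota_inj ->.
    by rewrite rmorph0.
  by exists c, a; split=> //; [rewrite -e1|rewrite -e2]; rewrite mulKf.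
have spec_iota a : spec (iota a) (phi' a).
  by exists a, 1; rewrite !rmorph1 !mulr1 oner_neq0.
have spec_kap c : spec (kap phi c) (kap phi' c).
  by rewrite (gp_kap gp) (kapE phi'); apply: spec_iota.
have spec_chi : forall u, spec (chi phi u) (chi phi' u).
  apply: lattice_ind => [|u v|i].
  - by have := spec_iota 1; rewrite !rmorph1 !chi0.
  - by move=> su sv; rewrite !chiB; apply: (specM _ _ _ _ su); apply: specV => //; exact: chi_neq0.
  - rewrite (gp_chi gp) (_ : chi phi' _ = phi' (linear_form b A i)); first exact: spec_iota.
    rewrite (generic_combination gp' (gp_expand gp i)) rmorph_sum.
    by apply: eq_bigr => l _; rewrite phi_monomial.
move=> f0; apply: spec0; rewrite -f0 !phiE.
apply: (big_ind2 spec) => [|z y z' y'|u _]; first by have := spec_iota 0; rewrite !rmorph0.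
  exact: specD.
exact: specM.
Qed.
End FlagHom.

Lemma lead_sum_eq (V : comNzRingType) (p q p' q' s t : V) :
  p * q' + p' * q - (s + t) = p * (q' - 1) + (p - s) + (p' * (q - 1) + (p' - t)).
Proof. by ring. Qed.

Lemma inv_denom_eq (F : fieldType) (z a c m p q : F) : z != 0 -> z * c = a ->
  p = m * c -> q = m * a -> z^-1 * q = p.
Proof. by move=> z0 <- -> ->; rewrite mulrCA mulKf. Qed.

Lemma binomial_eq (V : comNzRingType) (m1 m2 x1 y1 x2 y2 p q : V) :
  p = m1 * x1 -> q = m2 * x2 -> m1 * y1 = m2 * y2 ->
  p - q = m1 * (x1 - y1) + - (m2 * (x2 - y2)).
Proof. by move=> -> ->; rewrite !mulrBr => ->; rewrite opprB addrA subrK. Qed.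

(** * Degeneration of a generic point *)

(** The point [w] is in the open cone of the flag to which the coordinates of the
    generic point [phi] of Y are adapted. *)
Section Degeneration.
Local Open Scope classical_set_scope.
Variables (R : realType) (k : fieldType) (n : nat) (M : matroid 'I_n.+1).
Hypothesis lf : loop_free M.
Notation E := 'I_n.+1.
Notation d := (mdim M).
Variable r : E -> 'rV[k]_d.+1.
Hypothesis rM : represents r.
Variables (F : fieldType) (iota : {rmorphism laurent k n -> F}).
Hypothesis iota_inj : forall f, iota f = 0 -> f = 0.
Variables (beta : E -> 'I_d.+1) (b : 'I_d.+1 -> E) (A : E -> 'I_d.+1 -> k).
Variable phi : {rmorphism laurent k n -> F}.
Hypothesis gp : generic_point r iota beta b A phi.
Variable Y : prime_idealr (laurent k n).
Hypothesis kerphi : forall f, (f \in Y) <-> phi f = 0.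
Variable w : 'rV[R]_n.
Hypotheses (w_ordered : ordered b w) (w_blockwise : blockwise beta b w).
Implicit Types (u v : 'rV[int]_n) (f g : laurent k n) (a : R).
Notation rho := (rho beta b).
Let ad := gp_adapted gp.
Let betab := adapted_section ad.

(** Since the coordinates are triangular and the weights decrease along the blocks, the
    linear form of [i] degenerates to its term in the block of [i], with coefficient
    [A i (beta i)]. *)
Definition lead_coefficient u : k :=
  \prod_j A (lift ord0 j) (beta (lift ord0 j)) ^ (u 0 j).
Notation cst := lead_coefficient.

Lemma cst0 : cst 0 = 1.
Proof. by rewrite /cst big1 // => j _; rewrite mxE expr0z. Qed.
Lemma cstD u v : cst (u + v) = cst u * cst v.
Proof.
rewrite /cst -big_split; apply: eq_bigr => j _; rewrite mxE expfzDr //.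
exact: gp_diag gp _.
Qed.
Lemma cst_neq0 u : cst u != 0.
Proof. by apply/prodf_neq0 => j _; rewrite expfz_neq0 // (gp_diag gp). Qed.
Lemma cstN u : cst (- u) = (cst u)^-1.
Proof. by apply: (mulfI (cst_neq0 u)); rewrite -cstD subrr cst0 divff ?cst_neq0. Qed.
Lemma cst_eps i : cst (eps i) = A i (beta i).
Proof.
case: (unliftP ord0 i) => [j ->|->].
  rewrite eps_lift /cst (bigD1 j) //= mxE !eqxx expr1z big1 ?mulr1 // => l lj.
  by rewrite mxE eqxx (negbTE lj) expr0z.
by rewrite eps0 cst0 -{1}(adapted0 ad) (gp_row gp) eqxx.
Qed.


(** The coordinates of the degenerate point define a homomorphism [theta], which will
    turn out to have the initial ideal as its kernel. *)
Lemma exists_degeneration : exists theta : {rmorphism laurent k n -> laurent k n},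
  forall c u, theta (monomial c u) = monomial (c * cst u) (rho u).
Proof.
apply: exists_galg_hom.
- by move=> c c' u; rewrite mulrDl monomialD.
- by rewrite mul1r cst0 rho0.
- by move=> c c' u u'; rewrite monomialM rhoD cstD mulrACA.
Qed.

Variable theta : {rmorphism laurent k n -> laurent k n}.
Hypothesis thetaE : forall c u, theta (monomial c u) = monomial (c * cst u) (rho u).

(** The function [z] is congruent, modulo functions of weight greater than [a], to
    the homogeneous Laurent polynomial [g] in the coordinates of the basis. *)
Definition leads a z g := suppin [set u | pairing u w = a] g /\
  exists f1 f2, [/\ z * iota f2 = iota f1,
    suppin [set u | a < pairing u w] (f1 - g) & suppin [set u | 0 < pairing u w] (f2 - 1)].

Let tail_ge a f g : suppin [set u | pairing u w = a] g ->
  suppin [set u | a < pairing u w] (f - g) -> suppin [set u | a <= pairing u w] f.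
Proof.
move=> ga fga; rewrite -[f](subrK g); apply: suppinD.
  by apply: suppinS fga => u /= /ltW.
by apply: suppinS ga => u /= ->.
Qed.

Let unit_ge f : suppin [set u | 0 < pairing u w] (f - 1) -> suppin [set u | 0 <= pairing u w] f.
Proof. by apply: tail_ge; apply: suppin1; rewrite /= pairing0. Qed.

(** Leading forms are determined, because Laurent polynomials inject into the field. *)
Lemma leads0_eq a g : leads a 0 g -> g = 0.
Proof.
move=> [ga [f1 [f2 [+ fg _]]]]; rewrite mul0r => /esym/iota_inj f10.
apply: galgP => u; rewrite gcoef0; apply/eqP; apply: contraT => gu.
have e := ga u gu; have := fg u; rewrite f10 sub0r gcoefN oppr_eq0 => /(_ gu) /=.
by rewrite e ltxx.
Qed.

Lemma leads_higher a a' z g : a < a' -> leads a' z g -> leads a z 0.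
Proof.
move=> lt [ga [f1 [f2 [e fg f2P]]]]; split; first exact: suppin0.
exists f1, f2; split=> //; rewrite subr0.
by apply: suppinS (tail_ge ga fg) => u /=; apply: lt_le_trans.
Qed.

Lemma leadsD a z z' g g' : leads a z g -> leads a z' g' -> leads a (z + z') (g + g').
Proof.
move=> [ga [f1 [f2 [e fg f2P]]]] [ga' [f1' [f2' [e' fg' f2P']]]].
split; first exact: suppinD.
exists (f1 * f2' + f1' * f2), (f2 * f2'); split.
- exact: (add_denom_eq e e' (rmorphDM iota f1 f2' f1' f2) (rmorphM iota f2 f2')).
- have -> : f1 * f2' + f1' * f2 - (g + g') =
      f1 * (f2' - 1) + (f1 - g) + (f1' * (f2 - 1) + (f1' - g')).
    exact: lead_sum_eq.
  have ht (p q : laurent k n) : suppin [set u | a <= pairing u w] p ->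
      suppin [set u | 0 < pairing u w] (q - 1) -> suppin [set u | a < pairing u w] (p * (q - 1)).
    move=> pa q1; apply: (suppinM _ pa q1); move=> u v /= sa t0.
    by rewrite pairingD -[a]addr0 ler_ltD.
  exact: suppinD (suppinD (ht _ _ (tail_ge ga fg) f2P') fg)
    (suppinD (ht _ _ (tail_ge ga' fg') f2P) fg').
- have -> : f2 * f2' - 1 = f2 * (f2' - 1) + (f2 - 1).
    by rewrite mulrBr mulr1 addrA subrK.
  apply: suppinD => //; apply: (suppinM _ (unit_ge f2P) f2P'); move=> u v /= s0 t0.
  by rewrite pairingD ltr_wpDl.
Qed.

Lemma leadsM a a' z z' g g' : leads a z g -> leads a' z' g' -> leads (a + a') (z * z') (g * g').
Proof.
move=> [ga [f1 [f2 [e fg f2P]]]] [ga' [f1' [f2' [e' fg' f2P']]]]; split.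
  by apply: (suppinM _ ga ga'); move=> u v /= <- <-; rewrite pairingD.
exists (f1 * f1'), (f2 * f2'); split.
- exact: (mul_denom_eq e e' (rmorphM iota f1 f1') (rmorphM iota f2 f2')).
- have -> : f1 * f1' - g * g' = f1 * (f1' - g') + (f1 - g) * g'.
    by rewrite mulrBr mulrBl addrA subrK.
  apply: suppinD.
    apply: (suppinM _ (tail_ge ga fg) fg'); move=> u v /= sa ta.
    by rewrite pairingD ler_ltD.
  by apply: (suppinM _ fg ga'); move=> u v /= sa va; rewrite pairingD va ltrD2r.
- have -> : f2 * f2' - 1 = f2 * (f2' - 1) + (f2 - 1).
    by rewrite mulrBr mulr1 addrA subrK.
  apply: suppinD => //; apply: (suppinM _ (unit_ge f2P) f2P'); move=> u v /= s0 t0.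
  by rewrite pairingD ltr_wpDl.
Qed.

Lemma leadsV a z c u : c != 0 -> leads a z (monomial c u) ->
  leads (- a) z^-1 (monomial c^-1 (- u)).
Proof.
move=> c0 lz; have z0 : z != 0.
  apply: contraNneq c0 => z0; move: lz; rewrite z0 => /leads0_eq e.
  by have := congr1 (fun h => coef h u) e; rewrite /= coef_monomial eqxx gcoef0 => ->.
case: lz => [ga [f1 [f2 [e fg f2P]]]].
have ua : pairing u w = a by apply: ga; rewrite coef_monomial eqxx.
have mu : suppin [set v | pairing v w = - a] (monomial c^-1 (- u) : laurent k n).
  by apply: suppin_monomial; rewrite /= pairingN ua.
split=> //; exists (monomial c^-1 (- u) * f2), (monomial c^-1 (- u) * f1); split.
- exact: (inv_denom_eq z0 e (rmorphM iota _ f2) (rmorphM iota _ f1)).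
- have -> : monomial c^-1 (- u) * f2 - monomial c^-1 (- u) = monomial c^-1 (- u) * (f2 - 1).
    by rewrite mulrBr mulr1.
  by apply: (suppinM _ mu f2P); move=> v v' /= va v0; rewrite pairingD va ltrDl.
- have -> : monomial c^-1 (- u) * f1 - 1 = monomial c^-1 (- u) * (f1 - monomial c u).
    by rewrite mulrBr; congr (_ - _); apply: esym; exact: monomialV.
  by apply: (suppinM _ mu fg); move=> v v' /= va v0; rewrite pairingD va addrC subr_gt0.
Qed.

Lemma leads_iota a f g : suppin [set u | pairing u w = a] g ->
  suppin [set u | a < pairing u w] (f - g) -> leads a (iota f) g.
Proof.
move=> ga fg; split=> //; exists f, 1; split=> //; first by rewrite rmorph1 mulr1.
by rewrite subrr; apply: suppin0.
Qed.

Lemma leads_chi u : leads (pairing u w) (chi phi u) (theta (monomial 1 u)).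
Proof.
rewrite thetaE mul1r; move: u; apply: lattice_ind => [|u v lu lv|i].
- rewrite pairing0 chi0 cst0 rho0 -galg_oneE -(rmorph1 iota); apply: leads_iota.
    by apply: suppin1; rewrite /= pairing0.
  by rewrite subrr; apply: suppin0.
- have := leadsM lu (leadsV (cst_neq0 v) lv).
  by rewrite chiB pairingB rhoB cstD cstN monomialM.
- rewrite (gp_chi gp) cst_eps (rho_eps ad); apply: leads_iota.
    by apply: suppin_monomial; rewrite /= !pairing_eps -w_blockwise.
  rewrite /linear_form (bigD1 (beta i)) //= addrAC subrr add0r.
  apply: suppin_sum => l _ li; have [lt|gt|e] := ltngtP l (beta i).
  + by apply: suppin_monomial; rewrite /= !pairing_eps (w_blockwise i); apply: w_ordered.
  + by rewrite (gp_lower gp) // monomial0; apply: suppin0.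
  + by rewrite (val_inj e) eqxx in li.
Qed.

Lemma leads_term c u : leads (pairing u w) (kap phi c * chi phi u) (theta (monomial c u)).
Proof.
have -> : monomial c u = monomial c 0 * monomial 1 u by rewrite monomialM mulr1 add0r.
have -> := rmorphM theta (monomial c 0) (monomial 1 u).
rewrite -[pairing u w]add0r; apply: leadsM; last exact: leads_chi.
rewrite (gp_kap gp) thetaE cst0 mulr1 rho0; apply: leads_iota.
  by apply: suppin_monomial; rewrite /= pairing0.
by rewrite subrr; apply: suppin0.
Qed.

(** The leading form of the value of [f] at the generic point is the value of the
    leading form of [f] at the degenerate point. *)
Lemma leads_part a f : suppin [set u | a <= pairing u w] f ->
  leads a (phi f) (theta (restrict [set u | pairing u w = a] f)).
Proof.
move=> fa; rewrite phiE restrict.unlock rmorph_sum [X in leads _ _ X]big_mkcond big_seq [X in leads _ _ X]big_seq.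
apply: (big_ind2 (leads a)).
- by rewrite -(rmorph0 iota); apply: leads_iota; rewrite ?subrr; apply: suppin0.
- by move=> z g z' g'; exact: leadsD.
move=> u; rewrite mem_supp => fu; have := fa u fu; rewrite /= le_eqVlt => /orP[/eqP e|lt].
  by rewrite asboolT //= e; exact: leads_term.
rewrite asboolF /=; last by move=> e; rewrite e ltxx in lt.
by apply: (leads_higher lt); apply: leads_term.
Qed.

(** Elements of Y vanish at the generic point, and 0 has leading form 0. *)
Lemma initial_ideal_degeneration f : initial_ideal Y w f -> theta f = 0.
Proof.
move=> [s sY ->]; rewrite rmorph_sum big_seq big1 // => -[g q] /sY /= qY.
have -> := rmorphM theta g (initial_form w q).
suff -> : theta (initial_form w q) = 0 by rewrite mulr0.
have [->|q0] := eqVneq q 0; first by rewrite initial_form0 rmorph0.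
have [u0 [_ qge ->]] := initial_formE w q0.
by apply: (leads0_eq (a := pairing u0 w)); rewrite -(kerphi q).1 //; apply: leads_part.
Qed.

(** For a coordinate function the binomial is the initial form of the linear relation
    that expresses it in the basis; the exponents with this property form a group. *)
Lemma degeneration_binomial u :
  initial_ideal Y w (monomial 1 u - monomial (cst u) (rho u)).
Proof.
move: u; apply: lattice_ind => [|u v lu lv|i].
- by rewrite cst0 rho0 subrr; apply: initial_ideal0.
- have -> : monomial 1 (u - v) - monomial (cst (u - v)) (rho (u - v)) =
      monomial 1 (- v) * (monomial 1 u - monomial (cst u) (rho u)) +
      - (monomial (cst u * (cst v)^-1) (rho u - rho v - v) *
        (monomial 1 v - monomial (cst v) (rho v))).
    have e1 : monomial 1 (u - v) = monomial 1 (- v) * monomial 1 u :> laurent k n.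
      by rewrite monomialM mulr1 addrC.
    have e2 : monomial (cst (u - v)) (rho (u - v)) =
        monomial (cst u * (cst v)^-1) (rho u - rho v - v) * monomial 1 v.
      by rewrite monomialM mulr1 subrK rhoB cstD cstN.
    have e3 : monomial 1 (- v) * monomial (cst u) (rho u) =
        monomial (cst u * (cst v)^-1) (rho u - rho v - v) * monomial (cst v) (rho v).
      have ec : 1 * cst u = cst u * (cst v)^-1 * cst v by rewrite mul1r mulfVK ?cst_neq0.
      have er : - v + rho u = rho u - rho v - v + rho v by rewrite addrAC subrK addrC.
      exact: etrans (monomialM _ _ _ _)
        (etrans (congr2 (fun c x => monomial c x) ec er) (esym (monomialM _ _ _ _))).
    exact: binomial_eq e1 e2 e3.
  exact: (initial_idealD (initial_idealM (monomial 1 (- v)) lu)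
    (initial_idealN (initial_idealM (monomial (cst u * (cst v)^-1) (rho u - rho v - v)) lv))).
pose f : laurent k n := monomial 1 (eps i) - linear_form b A i.
have fY : f \in Y.
  apply/kerphi; rewrite rmorphB -chiE (generic_combination rM gp (gp_expand gp i)).
  rewrite rmorph_sum; apply/eqP; rewrite subr_eq0; apply/eqP/eq_bigr => l _.
  by rewrite phi_monomial.
have ti : suppin [set u | hat w i < pairing u w]
    (linear_form b A i - monomial (A i (beta i)) (eps (b (beta i)))).
  rewrite /linear_form (bigD1 (beta i)) //= addrAC subrr add0r.
  apply: suppin_sum => l _ li; have [lt|gt|e] := ltngtP l (beta i).
  + by apply: suppin_monomial; rewrite /= !pairing_eps (w_blockwise i); apply: w_ordered.
  + by rewrite (gp_lower gp) // monomial0; apply: suppin0.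
  + by rewrite (val_inj e) eqxx in li.
rewrite cst_eps (rho_eps ad); set p := monomial 1 (eps i) - _.
have pw : suppin [set u | pairing u w = hat w i] p.
  by apply: suppinB; apply: suppin_monomial; rewrite /= ?pairing_eps -?w_blockwise.
have fp : suppin [set u | hat w i < pairing u w] (f - p).
  by rewrite /f /p opprB addrC addrA subrK -opprB; apply: suppinN.
have := @mem_initial_ideal k R n Y w f (hat w i) fY (tail_ge pw fp).
rewrite -[f](subrK p) restrictD (restrict_id pw) restrict_out ?add0r //.
by apply: suppinS fp => u /= lt e; rewrite e ltxx in lt.
Qed.

Lemma degeneration_mod f : initial_ideal Y w (f - theta f).
Proof.
rewrite [X in X - theta _](galgE f) [X in _ - theta X](galgE f) rmorph_sum -sumrB.
apply: (big_ind (initial_ideal Y w)); first exact: initial_ideal0.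
  exact: initial_idealD.
move=> u _; rewrite thetaE.
have -> : monomial (coef f u) u - monomial (coef f u * cst u) (rho u) =
    monomial (coef f u) 0 * (monomial 1 u - monomial (cst u) (rho u)).
  by rewrite mulrBr !monomialM !mulr1 !add0r.
by apply: initial_idealM; apply: degeneration_binomial.
Qed.

(** The degeneration is the image of the subtorus of the basis, translated by a point
    of the torus. *)
Lemma initial_idealP f : initial_ideal Y w f <-> theta f = 0.
Proof.
split=> [|f0]; first exact: initial_ideal_degeneration.
by rewrite -[f]subr0 -f0; apply: degeneration_mod.
Qed.

Lemma ordered_trop : Trop Y w.
Proof. by move/initial_idealP; rewrite rmorph1 => /eqP; rewrite oner_eq0. Qed.

(** The subtorus acting on the degeneration scales the coordinates block by block;
    the block of the element 0 is scaled trivially. *)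
Definition block_mx : 'M[int]_(d, n) :=
  \matrix_(l, j) (beta (lift ord0 j) == lift (beta ord0) l)%:R.
Definition section_mx : 'M[int]_(n, d) :=
  \matrix_(j, l) (b (lift (beta ord0) l) == lift ord0 j)%:R.

Lemma eps_block_mx i l : (eps i *m block_mx^T) 0 l = (beta i == lift (beta ord0) l)%:R.
Proof.
case: (unliftP ord0 i) => [j ->|->].
  rewrite eps_lift mxE (bigD1 j) //= !mxE !eqxx mul1r big1 ?addr0 // => m mj.
  by rewrite !mxE (negbTE mj) mul0r.
by rewrite eps0 mul0mx mxE (negbTE (neq_lift _ _)).
Qed.

Lemma block_mx_subtorus : subtorus block_mx.
Proof.
exists section_mx; apply/matrixP => l m; rewrite !mxE.
have bl : b (lift (beta ord0) m) != ord0.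
  by apply/eqP => /(congr1 beta); rewrite betab => /esym/eqP; rewrite (negbTE (neq_lift _ _)).
case: (unliftP ord0 (b (lift (beta ord0) m))) bl => [j e _|-> /eqP//].
rewrite (bigD1 j) //= !mxE -e betab eqxx mulr1 (inj_eq lift_inj) eq_sym big1 ?addr0 // => i ij.
by rewrite !mxE e (inj_eq lift_inj) [j == i]eq_sym (negbTE ij) mulr0.
Qed.

Lemma rho_block_mx u : rho u = u *m block_mx^T *m section_mx^T.
Proof.
move: u; apply: lattice_ind => [|u v hu hv|i]; first by rewrite rho0 !mul0mx.
  by rewrite rhoB hu hv !mulmxBl.
rewrite (rho_eps ad); apply/rowP => j; rewrite mxE.
rewrite (eq_bigr (fun l => (beta i == lift (beta ord0) l)%:R *
    (b (lift (beta ord0) l) == lift ord0 j)%:R)); last first.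
  by move=> l _; rewrite eps_block_mx !mxE.
have epsE l : eps l 0 j = (l == lift ord0 j)%:R.
  case: (unliftP ord0 l) => [m ->|->]; last by rewrite eps0 mxE (negbTE (neq_lift _ _)).
  by rewrite eps_lift mxE eqxx (inj_eq lift_inj) eq_sym.
rewrite epsE; case: (unliftP (beta ord0) (beta i)) => [l ->|->].
  rewrite (bigD1 l) //= eqxx mul1r big1 ?addr0 // => m ml.
  by rewrite (inj_eq lift_inj) [l == m]eq_sym (negbTE ml) mul0r.
rewrite (adapted0 ad) (negbTE (neq_lift _ _)) big1 // => l _.
by rewrite (negbTE (neq_lift _ _)) mul0r.
Qed.

(** Hence [theta] preserves the weights of the action. *)
Lemma block_mx_rho u : rho u *m block_mx^T = u *m block_mx^T.
Proof.
move: u; apply: lattice_ind => [|u v hu hv|i]; first by rewrite rho0.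
  by rewrite rhoB !mulmxBl hu hv.
by apply/rowP => l; rewrite (rho_eps ad) !eps_block_mx betab.
Qed.

Lemma degeneration_suppin (P : set 'rV[int]_n) f : (forall u, P u -> P (rho u)) ->
  suppin P f -> suppin P (theta f).
Proof.
move=> Prho fP; rewrite (galgE f) rmorph_sum; apply: suppin_sum => u.
rewrite mem_supp => fu _; rewrite thetaE; apply: suppin_monomial.
by apply: Prho; apply: fP.
Qed.

Lemma degeneration_weight_part om f :
  theta (weight_part block_mx om f) = weight_part block_mx om (theta f).
Proof.
rewrite !weight_partE; set P := [set u | _]%classic.
have PP u : P u -> P (rho u) by rewrite /P /= block_mx_rho.
have nPP u : (~` P) u -> (~` P) (rho u) by rewrite /P /= block_mx_rho.
have h1 := degeneration_suppin PP (@restrict_in _ _ P f).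
have h2 : suppin (~` P) (f - restrict P f).
  move=> u; rewrite gcoefB coef_restrict; case: asboolP => // _.
  by rewrite subrr eqxx.
have := degeneration_suppin nPP h2; rewrite rmorphB => {}h2.
rewrite -[theta f](subrK (theta (restrict P f))) restrictD (restrict_out h2) add0r.
by apply: esym; exact: restrict_id h1.
Qed.

(** Modulo the kernel of [theta], a function of weight 0 is a constant. *)
Lemma ordered_multiplicity : generic_multiplicity d Y w 1.
Proof.
exists block_mx; split; first exact: block_mx_subtorus.
  by move=> f /initial_idealP f0 om; apply/initial_idealP;
    rewrite degeneration_weight_part f0 weight_partE restrict0.
exists (fun=> 1) => [_|f].
  by rewrite weight_partE restrict_id //; apply: suppin1; rewrite /= mul0mx.
rewrite weight_partE => f0.
have fP : suppin [set u | u *m block_mx^T = 0] f by rewrite -f0; apply: restrict_in.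
have theta_const : theta f = monomial (coef (theta f) 0) 0.
  apply: galgP => u; rewrite coef_monomial; case: eqP => [->//|u0].
  apply/eqP; apply: contraT => tu; exfalso; apply: u0; apply: esym.
  move: tu; rewrite (galgE f) rmorph_sum gcoef_sum big_seq => /eqP ne.
  apply: contra_notP ne => u0; rewrite big1 // => v; rewrite mem_supp => /fP /= v0.
  by rewrite thetaE coef_monomial rho_block_mx v0 mul0mx; case: eqP => // e; rewrite e in u0.
have scale (c : 'rV[k]_1) : theta (f - \sum_i c 0 i *: (1 : laurent k n)) =
    theta f - monomial (c 0 0) 0.
  have e1 : c 0 ord0 *: (1 : laurent k n) = monomial (c 0 ord0) 0.
    exact: etrans (galg_scale _ _) (mulr1 _).
  rewrite big_ord1 (rmorphB theta) e1; congr (_ - _).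
  by have := thetaE (c 0 ord0) 0; rewrite cst0 rho0; move: (c 0 ord0) => a; rewrite (mulr1 a).
exists (const_mx (coef (theta f) 0)); split.
  by apply/initial_idealP; rewrite scale mxE {1}theta_const subrr.
move=> c /initial_idealP; rewrite scale => /eqP; rewrite subr_eq0 => /eqP e.
by apply/rowP => i; rewrite mxE ord1 e coef_monomial eqxx.
Qed.

End Degeneration.

(** * Interiors of maximal cones *)

Section Smooth.
Local Open Scope classical_set_scope.
Variables (R : realType) (n : nat) (M : matroid 'I_n.+1).
Hypothesis lf : loop_free M.
Notation E := 'I_n.+1.
Notation d := (mdim M).
Variables (beta : E -> 'I_d.+1) (b : 'I_d.+1 -> E).
Hypothesis ad : adapted beta b.
Let betab := adapted_section ad.
Implicit Types (w : 'rV[R]_n) (y : 'rV[R]_d).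

(** The interior of a maximal cone is an open orthant, hence homeomorphic to R^d by the
    logarithms of the coordinates along its rays, which are the gaps between the weights
    of consecutive blocks. *)
Definition gap w (l : 'I_d) : R := hat w (b (widen_ord (leqnSn d) l)) - hat w (b (lift ord0 l)).
Definition log_coords w : 'rV[R]_d := \row_l ln (gap w l).
Definition exp_point y : 'rV[R]_n := \sum_l expR (y 0 l) *: evec_set R (step beta l.+1).

Lemma exp_point_relint y : flag_cone_relint (steps beta) (exp_point y).
Proof.
pose c F := \sum_(l < d | step beta l.+1 == F) expR (y 0 l).
have cE (l : 'I_d) : c (step beta l.+1) = expR (y 0 l).
  by rewrite /c (big_pred1 l) // => m /=; apply/eqP/eqP => [/(step_inj ad)|->].
exists c; first by move=> _ /imsetP[l _ ->]; rewrite cE expR_gt0.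
by rewrite (sum_steps ad); apply: eq_bigr => l _; rewrite cE.
Qed.

Lemma gap_exp_point y l : gap (exp_point y) l = expR (y 0 l).
Proof.
rewrite /gap /exp_point !hat_cone !betab /= opprB addrA subrK.
rewrite (bigD1 l) //= [X in _ - X](eq_bigl (fun m : 'I_d => (l <= m)%N && (m != l))).
  by rewrite addrK.
by move=> m; rewrite /= /bump leq0n add1n ltn_neqAle andbC [m == l]eq_sym.
Qed.

Lemma gap_gt0 w l : ordered b w -> 0 < gap w l.
Proof. by move=> ow; rewrite subr_gt0; apply: ow. Qed.

Lemma gap_cont l : continuous (gap ^~ l).
Proof.
move=> v; apply: (@continuousB _ _ _ (fun v : 'rV[R]_n => hat v (b (widen_ord (leqnSn d) l)))).
  exact: hat_cont.
exact: hat_cont.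
Qed.

Lemma exp_point_cont : continuous exp_point.
Proof.
apply: row_cont => j.
rewrite (_ : (fun _ => _) = fun y => \sum_l expR (y 0 l) * evec_set R (step beta l.+1) 0 j).
  apply: sum_cont => l y.
  apply: (@continuousM _ _ (fun y : 'rV[R]_d => expR (y 0 l)) (fun=> evec_set R (step beta l.+1) 0 j)).
    apply: (@continuous_comp _ _ _ (fun y : 'rV[R]_d => y 0 l) expR); first exact: coord_cont.
    exact: continuous_expR.
  exact: cst_continuous.
by apply/funext => y; rewrite summxE; apply: eq_bigr => l _; rewrite mxE.
Qed.

(** The open set of the points ordered on the basis meets the fan in one cone only. *)
Lemma smooth_ordered w : ordered b w -> blockwise beta b w ->
  smooth_point d (@matroid_fan_support R n M) w.
Proof.
move=> ow bw; split; first exact: (ordered_fan ad).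
exists [set v | ordered b v]; first exact: open_nbhs_nbhs (conj (@ordered_open _ _ _ b) ow).
exists log_coords, exp_point; split.
- apply: continuous_in_subspaceT => v /set_mem[_ /= ov]; apply: row_cont_at => l.
  rewrite (_ : (fun _ => _) = (@ln R) \o (gap ^~ l)); last by apply/funext => v'; rewrite mxE.
  apply: continuous_comp; first exact: gap_cont.
  by apply: continuous_ln; apply: gap_gt0.
- exact: exp_point_cont.
- move=> y; have /(relint_stepsP ad)[oy by_] := exp_point_relint y.
  by split=> //; apply: (ordered_fan ad).
- move=> v [fv /= ov]; have bv := ordered_blockwise lf ad (fan_levels lf fv) ov.
  rewrite [RHS](blockwise_decomp bv); apply: eq_bigr => l _.
  by rewrite mxE lnK // posrE; apply: gap_gt0.
- by move=> y; apply/rowP => l; rewrite mxE gap_exp_point expRK.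
Qed.
End Smooth.

(** * The tropicalization is closed *)

Section Closure.
Local Open Scope classical_set_scope.
Variables (R : realType) (k : fieldType) (n : nat).
Implicit Types (u : 'rV[int]_n) (w v : 'rV[R]_n).

Lemma pairingDr u w v : pairing u (w + v) = pairing u w + pairing u v.
Proof. by rewrite /pairing -big_split; apply: eq_bigr => j _; rewrite mxE mulrDr. Qed.
Lemma pairingZr u (c : R) w : pairing u (c *: w) = c * pairing u w.
Proof. by rewrite /pairing mulr_sumr; apply: eq_bigr => j _; rewrite mxE mulrCA. Qed.

Lemma small_perturbation (T : eqType) (s : seq T) (p q : T -> R) :
  (forall x, x \in s -> 0 < p x) ->
  exists2 e : R, 0 < e & forall e', 0 < e' <= e -> forall x, x \in s -> 0 < p x + e' * q x.
Proof.
elim: s => [|x s IH] ps; first by exists 1.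
have [|e e0 he] := IH; first by move=> y ys; apply: ps; rewrite inE ys orbT.
have px : 0 < p x by apply: ps; rewrite inE eqxx.
have q1 : 0 < 1 + `|q x| by rewrite ltr_pwDl.
exists (Num.min e (p x / (1 + `|q x|))); first by rewrite lt_min e0 divr_gt0.
move=> e' /andP[e'0]; rewrite le_min => /andP[e'e e'p] y.
rewrite inE => /orP[/eqP ->|ys]; last by apply: he => //; rewrite e'0.
have lt : e' * `|q x| < p x.
  move: e'p; rewrite ler_pdivlMr // mulrDr mulr1 => le.
  by apply: lt_le_trans le; rewrite ltrDr.
have := ler_wpM2l (ltW e'0) (ler_norm (- q x)); rewrite normrN mulrN => h.
by rewrite -ltrBlDr sub0r (le_lt_trans h lt).
Qed.

(** Only finitely many strict inequalities express that a point is not tropical. *)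
Lemma Trop_perturbation (Y : prime_idealr (laurent k n)) w v :
  (forall e : R, 0 < e -> Trop Y (w + e *: v)) -> Trop Y w.
Proof.
move=> T; apply: contrapT => /notin_Trop[f fY fP].
have [|e e0 he] := @small_perturbation _ (supp (f - 1)) (fun u => pairing u w) (fun u => pairing u v).
  by move=> u; rewrite mem_supp; apply: fP.
have /notin_Trop : exists2 f, f \in Y & suppin [set u | 0 < pairing u (w + e *: v)] (f - 1).
  exists f => // u fu; rewrite /= pairingDr pairingZr.
  by apply: he; rewrite ?e0 ?lexx // mem_supp.
by apply; apply: T.
Qed.
End Closure.

(** * From a realization to a tropical realization *)

Section Backward.
Local Open Scope classical_set_scope.
Variables (R : realType) (k : fieldType) (n : nat) (M : matroid 'I_n.+1).
Hypothesis lf : loop_free M.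
Notation E := 'I_n.+1.
Notation d := (mdim M).

(** Points of a cone are limits of interior points of the larger cone of a maximal flag. *)
Lemma cone_perturbation (P P' : {set {set E}}) (w : 'rV[R]_n) : P \subset P' -> flag_cone P w ->
  exists v : 'rV[R]_n, forall e : R, 0 < e -> flag_cone_relint P' (w + e *: v).
Proof.
move=> PP' [c c0 ->]; exists (\sum_(F in P') evec_set R F) => e e0.
exists (fun F => (if F \in P then c F else 0) + e).
  by move=> F _; case: ifP => [/c0 cF|_]; [rewrite ltr_wpDl|rewrite add0r].
rewrite [RHS](eq_bigr (fun F => (if F \in P then c F *: evec_set R F else 0) + e *: evec_set R F)).
  rewrite big_split /= -[X in _ = _ + X]scaler_sumr; congr (_ + _).
  rewrite -big_mkcondr; apply: eq_bigl => F; apply/idP/andP => [FP|[]//].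
  by rewrite FP (fintype.subsetP PP').
by move=> F _; rewrite scalerDl; case: ifP; rewrite ?scale0r.
Qed.

(** Each maximal flag has its own generic point, of the same ideal Y: this gives the
    interiors of the maximal cones. Conversely, if the indices of weight at least [t] do
    not form a flat, an element [x] of smaller weight in their span gives a relation
    with leading part a monomial. *)
Lemma represents_tropical (r : E -> 'rV[k]_d.+1) :
  represents r -> tropically_realizable R k M.
Proof.
move=> rM; have [F [iota iota_inj]] := laurent_field R k n.
have [P0 mP0] := exists_maximal_flag M.
have [beta0 [b0 [ad0 _]]] := maximal_flag_adapted lf mP0.
have [A0 [phi0 gp0]] := exists_generic_point lf rM iota_inj ad0.
have [||||Y YE] := @exists_prime_ideal (laurent k n) (fun f => phi0 f = 0).
- exact: rmorph0.
- by rewrite rmorph1; apply/eqP; exact: oner_neq0.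
- move=> a u v u0 v0; have -> := rmorphD phi0 (a * u) v.
  by have -> := rmorphM phi0 a u; rewrite u0 v0 mulr0 addr0.
- move=> u v; have -> := rmorphM phi0 u v.
  by move/eqP; rewrite mulf_eq0 => /orP[/eqP|/eqP]; [left|right].
have generic (beta : E -> 'I_d.+1) (b : 'I_d.+1 -> E) : adapted beta b ->
    exists A phi, generic_point r iota beta b A phi /\ forall f, (f \in Y) <-> phi f = 0.
  move=> ad; have [A [phi gp]] := exists_generic_point lf rM iota_inj ad.
  exists A, phi; split=> // f; rewrite YE.
  by split; [exact: (generic_kernel_sub rM iota_inj gp0 gp)|
             exact: (generic_kernel_sub rM iota_inj gp gp0)].
have ordered_Trop (beta : E -> 'I_d.+1) (b : 'I_d.+1 -> E) (w : 'rV[R]_n) : adapted beta b -> ordered b w -> blockwise beta b w ->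
    Trop Y w /\ generic_multiplicity d Y w 1.
  move=> ad ow bw; have [A [phi [gp kerphi]]] := generic _ _ ad.
  have [theta thetaE] := exists_degeneration gp.
  split; first exact: (ordered_trop rM iota_inj gp kerphi ow bw thetaE).
  exact: (ordered_multiplicity rM iota_inj gp kerphi ow bw thetaE).
have TropY : @Trop k R n Y = matroid_fan_support M.
  apply/seteqP; split=> w; last first.
    move=> [P fP cP]; have [P' mP' PP'] := flag_sub_maximal fP.
    have [v vP] := cone_perturbation PP' cP; apply: (Trop_perturbation (v := v)) => e e0.
    have [beta [b [ad PE]]] := maximal_flag_adapted lf mP'.
    have := vP e e0; rewrite PE => /(relint_stepsP ad)[ow bw].
    by have [] := ordered_Trop _ _ _ ad ow bw.
  move=> Tw; apply: (levels_fan lf) => t; set L := [set i | _]%SET.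
  apply/flatP => x xL; rewrite ltn_neqAle mrankS ?finset.subsetU1 // andbT.
  apply/negP => /eqP e.
  have : r x \in span_of r L by rewrite (mem_span_of rM) e.
  move=> /memv_sumP[u uV rx].
  have /choice[a ua] j : exists c, j \in L -> u j = c *: r j.
    by have [/uV/vlineP[c ->]|_] := boolP (j \in L); [exists c|exists 0].
  pose c j := if j \in L then a j else 0.
  have rc : r x = \sum_j c j *: r j.
    rewrite rx big_mkcond; apply: eq_bigr => j _; rewrite /c.
    by case: ifP => [/ua|_]; rewrite ?scale0r.
  have relE := generic_combination rM gp0 rc.
  pose f : laurent k n := monomial 1 (eps x) - \sum_j monomial (c j) (eps j).
  have fY : f \in Y.
    apply/YE; rewrite rmorphB -chiE relE rmorph_sum; apply/eqP; rewrite subr_eq0; apply/eqP.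
    by apply: eq_bigr => j _; rewrite phi_monomial.
  have /eqP : 1 = 0 :> k; last by rewrite oner_eq0.
  apply: (Trop_lead Tw fY (u := eps x)).
  rewrite /f addrAC subrr add0r; apply: suppinN; apply: suppin_sum => j _ _.
  rewrite /c; case: ifP => [jL|_]; last by rewrite monomial0; apply: suppin0.
  apply: suppin_monomial; rewrite /= !pairing_eps.
  move: jL xL; rewrite !inE -ltNge => jt xt; exact: lt_le_trans xt jt.
exists Y => // P v mP; have [beta [b [ad ->]]] := maximal_flag_adapted lf mP.
move=> /(relint_stepsP ad)[ov bv]; split; first by rewrite TropY; apply: (smooth_ordered lf ad).
exists [set w : 'rV[R]_n | ordered b w], [set w : 'rV[R]_n | ordered b w]; split.
- exact: open_nbhs_nbhs (conj (@ordered_open _ _ _ b) ov).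
- exact: ordered_open.
- exact: subset_closure.
move=> w [Tw /= ow]; have bw : blockwise beta b w.
  by apply: (ordered_blockwise lf ad) => //; apply: (fan_levels lf); rewrite -TropY.
by have [] := ordered_Trop _ _ _ ad ow bw.
Qed.
End Backward.

Theorem corollary1p5 (R : realType) (k : fieldType) (n : nat)
    (M : matroid 'I_n.+1) :
  loop_free M -> (tropically_realizable R k M <-> realizable k M).
Proof.
move=> lf; split; first exact: tropical_realization.
by move=> /realizable_represents[r]; apply: represents_tropical.
Qed.
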